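(* Consider the edge–triangle model $P_{\beta,h}$ on edge weights of the complete graph $K_n$, and let $X\sim P_{\beta_0,h_0}$. Then the following hold (as $n\to\infty$, $N=\binom n2$). (a) Suppose $\mu$ is stochastically non-negative, $\beta_0>0$ and $h_0\ge0$. If either $h_0>0$ or $\kappa_-\ge0$, then $T_N(X)=o_p(1)$ under $P_{\beta_0,h_0}$. (b) Suppose $\kappa_-=0$ and $\mu(\{0\})>0$. For any $h_0\in\mathbb R$ there exists $L(h_0)>0$ such that for all $\beta_0\le-L(h_0)$ we have $P_{\beta_0,h_0}(T_N(X)>c)\to1$ for some $c>0$ depending on $(\beta_0,h_0,\mu)$. Consequently, the maximum pseudo-likelihood estimator exists with probability tending to one and is jointly $\sqrt N$-consistent.
   Context: Setting. $\kappa_-<\kappa_+$ are real numbers, $\mu$ is a fixed probability measure on $[\kappa_-,\kappa_+]$ with $\kappa_-,\kappa_+\in\mathrm{supp}(\mu)$, and $\Lambda(\lambda)=\log\int e^{\lambda z}\,d\mu(z)$. Let $N=\binom n2$ and identify $x\in[\kappa_-,\kappa_+]^N$ (indexed by the edges of $K_n$) with a symmetric $n\times n$ matrix $G$ with $G_{ii}=0$, $G_{ij}=G_{ji}=x_{\{i,j\}}$. The edge–triangle model is the probability measure $$\frac{dP_{\beta,h}}{d\mu^{\otimes N}}(G)=\frac{1}{Z_N(\beta,h)}\exp\Big(\frac{\beta}{3n}\sum_{i,j,k=1}^nG_{ij}G_{jk}G_{ki}+h\sum_{i<j}G_{ij}\Big),$$ with $Z_N(\beta,h)$ the normalizing constant.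 Equivalently, with $A_{e_0e_1e_2}=n^{-1}\mathbf 1\{(e_0,e_1,e_2)\text{ form a triangle}\}$ for edges $e_0,e_1,e_2$ of $K_n$, the exponent is $\frac\beta3\sum_{e_0,e_1,e_2}A_{e_0e_1e_2}x_{e_0}x_{e_1}x_{e_2}+h\sum_ex_e$. Put $m_e(x)=\sum_{e_1,e_2}A_{ee_1e_2}x_{e_1}x_{e_2}$, $\bar m(x)=\frac1N\sum_em_e(x)$, $T_N(x)=\frac1N\sum_e(m_e(x)-\bar m(x))^2$. Rate function: $I(t)=\sup_{\lambda\in\mathbb R}(\lambda t-\Lambda(\lambda))\in[0,\infty]$ for $t\in\mathbb R$. The measure $\mu$ is stochastically non-negative if $I(t)\le I(-t)$ for all $t\ge0$. Maximum pseudo-likelihood estimator: given $x$, $(\hat\beta,\hat h)$ is the unique solution $(\beta,h)\in\mathbb R^2$ (if there is a unique solution, in which case it is said to exist) of $$\sum_e m_e(x)\big(x_e-\Lambda'(\beta m_e(x)+h)\big)=0,\qquad \sum_e\big(x_e-\Lambda'(\beta m_e(x)+h)\big)=0.$$ Jointly $\sqrt N$-consistent means $\max(|\hat\beta-\beta_0|,|\hat h-h_0|)=O_p(N^{-1/2})$ under $P_{\beta_0,h_0}$. $o_p(1)$ means convergence to $0$ in probability. *)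

(* Defs.v *)
From HB Require Import structures.
From mathcomp Require Import all_boot all_order all_algebra.
From mathcomp Require Import all_classical all_reals all_analysis.

Set Implicit Arguments.
Unset Strict Implicit.
Unset Printing Implicit Defensive.

Import Order.TTheory GRing.Theory Num.Theory.
Import numFieldNormedType.Exports.

Local Open Scope classical_set_scope.
Local Open Scope ring_scope.

(** * Finite powers of a probability measure *)

Section power_measure.
Context d (T : measurableType d) (R : realType) (mu : probability T R).

Definition cons_pair n (p : T * n.-tuple T) : n.+1.-tuple T :=
  [the n.+1.-tuple T of p.1 :: p.2].

Lemma measurable_cons_pair n : measurable_fun [set: T * n.-tuple T] (@cons_pair n).
Proof. by apply: measurable_cons. Qed.

HB.instance Definition _ n :=
  isMeasurableFun.Build _ _ (T * n.-tuple T)%type (n.+1.-tuple T) (@cons_pair n)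
    (@measurable_cons_pair n).

Fixpoint power_measure n : probability (n.-tuple T) R :=
  match n return probability (n.-tuple T) R with
  | 0 => dirac [tuple]
  | n'.+1 => distribution (mu \x power_measure n')%E (@cons_pair n')
  end.

Lemma power_measure_box n (A : 'I_n -> set T) :
  (forall i, measurable (A i)) ->
  power_measure n [set x | forall i, A i (tnth x i)] = (\prod_(i < n) mu (A i))%E.
Proof.
elim: n A => [|n IH] A mA /=.
  rewrite big_ord0 diracE mem_set//= => -[]//.
rewrite /distribution /pushforward.
have -> : @cons_pair n @^-1` [set x | forall i, A i (tnth x i)] =
    A ord0 `*` [set x | forall i, A (lift ord0 i) (tnth x i)].
  apply/seteqP; split => -[a x] /=.
    move=> H; split => [|i]; first by have := H ord0; rewrite tnth0.
    by have := H (lift ord0 i); rewrite tnthS.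
  move=> [a0 H] i; case: (unliftP ord0 i) => [j|] ->; first by rewrite tnthS.
  by rewrite tnth0.
rewrite product_measure1E//; last first.
  rewrite (_ : [set x | _] =
      \bigcap_(i in [set: 'I_n]) ((@tnth n T)^~ i @^-1` A (lift ord0 i))).
    apply: fin_bigcap_measurable => // i _; rewrite -[X in measurable X]setTI.
    exact: measurable_tnth.
  by apply/seteqP; split => x /= H i; [move=> _; exact: H|exact: (H i I)].
by rewrite [RHS]big_ord_recl -(IH (fun i => A (lift ord0 i))).
Qed.

End power_measure.

(** * Edges of the complete graph and edge weights *)

Definition edge n := {e : {set 'I_n} | #|e| == 2}.

Lemma card_edge n : #|{: edge n}| = 'C(n, 2).
Proof.
have := card_draws 'I_n 2; rewrite card_ord card_sig => <-.
by apply: eq_card => A; rewrite !inE.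
Qed.

(* The coordinates of a tuple of weights are attached to the edges through the
   enumeration [enum_rank] of [edge n]. *)
Definition weights (R : realType) n := (#|{: edge n}|).-tuple (measurableTypeR R).

Section model.
Context (R : realType) (n : nat).
Implicit Types (x : weights R n) (e : edge n).

Definition weight x e : R := tnth x (enum_rank e).

(* [[set i; j]] is an edge iff [i != j], so the diagonal is [0]. *)
Definition adj x (i j : 'I_n) : R :=
  if insub [set i; j]%SET is Some e then weight x e else 0.

Definition num_edges : R := ('C(n, 2))%:R.

Definition edge_triangle_exponent (beta h : R) x : R :=
  beta / (3 * n%:R) *
    (\sum_(i < n) \sum_(j < n) \sum_(k < n) adj x i j * adj x j k * adj x k i)
  + h * \sum_(i < n) \sum_(j < n | (i < j)%N) adj x i j.

(* The vertices are automatically distinct because edges have two elements. *)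
Definition form_triangle e0 e1 e2 : bool :=
  [exists i : 'I_n, exists j : 'I_n, exists k : 'I_n,
    [&& val e0 == [set i; j]%SET, val e1 == [set j; k]%SET
      & val e2 == [set k; i]%SET]].

Definition triangle_coef e0 e1 e2 : R :=
  if form_triangle e0 e1 e2 then n%:R^-1 else 0.

Definition local_field x e : R :=
  \sum_(e1 : edge n) \sum_(e2 : edge n)
    triangle_coef e e1 e2 * weight x e1 * weight x e2.

Definition mean_field x : R := num_edges^-1 * \sum_(e : edge n) local_field x e.

Definition field_variance x : R :=
  num_edges^-1 * \sum_(e : edge n) (local_field x e - mean_field x) ^+ 2.

End model.

Section base_measure.
Context (R : realType) (mu : probability (measurableTypeR R) R).

Definition measure_support : set R :=
  [set t | forall U : set R, open U -> U t -> (0 < mu U)%E].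

Definition cumulant (l : R) : R := ln (\int[mu]_z expR (l * z)).

Definition rate (t : R) : \bar R :=
  ereal_sup [set (l * t - cumulant l)%:E | l in [set: R]].

Definition stochastically_nonneg : Prop :=
  forall t : R, 0 <= t -> (rate t <= rate (- t))%E.

Definition partition_function n (beta h : R) : R :=
  \int[power_measure mu #|{: edge n}|]_x expR (edge_triangle_exponent beta h x).

(* Meant for measurable sets [A] only. *)
Definition edge_triangle_model (beta h : R) n (A : set (weights R n)) : \bar R :=
  (\int[power_measure mu #|{: edge n}|]_(x in A)
    (expR (edge_triangle_exponent beta h x) / partition_function n beta h)%:E)%E.

Definition pseudo_likelihood_eqs n (x : weights R n) (beta h : R) : Prop :=
  \sum_(e : edge n) local_field x e *
    (weight x e - derive1 cumulant (beta * local_field x e + h)) = 0 /\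
  \sum_(e : edge n)
    (weight x e - derive1 cumulant (beta * local_field x e + h)) = 0.

Definition is_mple n (x : weights R n) (beta h : R) : Prop :=
  pseudo_likelihood_eqs x beta h /\
  forall beta' h', pseudo_likelihood_eqs x beta' h' -> beta' = beta /\ h' = h.

End base_measure.

(** * Asymptotic notions for a sequence of laws on the weights *)

Section asymptotics.
Context (R : realType) (P : forall n, set (weights R n) -> \bar R).
Implicit Types Y : forall n, weights R n -> R.

Definition little_op1 Y : Prop :=
  forall eps : R, 0 < eps ->
    P [set x : weights R n | eps < `|Y n x|] @[n --> \oo] --> 0%E.

(* Events whose measurability is not apparent are handled through measurable
   subsets; for measurable events this is the usual notion. *)
Definition with_prob_to_one (S : forall n, set (weights R n)) : Prop :=
  exists E : forall n, set (weights R n),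
    [/\ forall n, measurable (E n), forall n, E n `<=` S n
      & P (E n) @[n --> \oo] --> 1%E].

Definition mple_sqrtN_consistent (mu : probability (measurableTypeR R) R)
    (beta0 h0 : R) : Prop :=
  forall eps : R, 0 < eps -> exists2 K : R, 0 < K &
    \forall n \near \oo, exists E : set (weights R n),
      [/\ measurable E, ((1 - eps)%:E <= P E)%E &
        forall x, E x -> exists beta h : R, is_mple mu x beta h /\
          Num.max `|beta - beta0| `|h - h0| <= K / Num.sqrt (num_edges R n)].

End asymptotics.

(* Main.v *)
(* (a) A cut-norm net of [expR (O(n))] step matrices splits the weight space into convex cells
   on which the exponent is constant up to [o(N)]. By Jensen the mass of a cell is at most the
   exponential of minus the entropy at its barycenter. By AM-GM and stochastic non-negativity
   the exponent minus the entropy never exceeds [N] times the value of a scalar problem, which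
   is also a lower bound for [ln Z / N]; a quantitative form of AM-GM shows that the deficit is
   of order [N] when the local fields at the barycenter are not nearly constant, so such cells
   are exponentially unlikely.

   (b) Restricting to bipartite weights bounds [Z] from below uniformly in [beta], which for
   large [- beta] forces the triangle density to be small; whereas a small field variance makes
   that density at least about the cube of the edge density, hence forces an edge density so
   small that the resulting mass is exponentially smaller than [Z]. For consistency, the score
   is a sum of residuals each centred given the other weights, so its second moment is [O(N)],
   and where the field variance exceeds [c] the pseudo-likelihood gradient is strongly monotone
   with constant of order [N]. *)
Require Import Defs.
From HB Require Import structures.
From mathcomp Require Import all_boot all_order all_algebra.
From mathcomp Require Import all_classical all_reals all_analysis.
From mathcomp Require Import measurable_realfun ring lra.

Set Implicit Arguments.
Unset Strict Implicit.
Unset Printing Implicit Defensive.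

Import Order.TTheory GRing.Theory Num.Theory.
Import numFieldNormedType.Exports.
Local Open Scope classical_set_scope.
Local Open Scope ring_scope.

(** * Means of bounded functions *)

(** [mu] is carried by [[km, kp]] but weights range over all of [R], so every function of the
    weights is composed with [clamp]: it becomes bounded, and means are then linear and monotone
    without further conditions. Conditioning on all weights but one is expressed by redrawing one
    coordinate.

    In (a) a cell is represented by its barycenter because that is the point at which the entropy
    bound holds with a free tilt at every edge. Weights may be negative, so AM-GM acts on absolute
    values: stochastic non-negativity pays for this on the entropy side, and [0 < h] or [0 <= km]
    keeps the weights themselves close to their absolute values.

    In (b) everything is measured by the gap between the logarithm of the tilted mass and [ln] of
    the atom at 0. The complete bipartite graph achieves at least their average per edge, whereas a
    nearly empty graph gets only about the smaller of the two; that difference is the exponential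
    rate. *)

Lemma le_of_eq (R : realType) (x y : R) : x = y -> x <= y.
Proof. by move=> ->. Qed.

Section bounded_measurable.
Context d (T : measurableType d) (R : realType).
Implicit Types f g : T -> R.

Definition bounded_mfun f :=
  measurable_fun setT f /\ exists C : R, forall x, `|f x| <= C.

Lemma bounded_mfun_cst c : bounded_mfun (fun=> c).
Proof. by split; [exact: measurable_cst|exists `|c|]. Qed.

Lemma bounded_mfunD f g :
  bounded_mfun f -> bounded_mfun g -> bounded_mfun (fun x => f x + g x).
Proof.
move=> [mf [C Cf]] [mg [D Dg]]; split; first exact: measurable_funD.
by exists (C + D) => x; apply: le_trans (ler_normD _ _) _; exact: lerD.
Qed.

Lemma bounded_mfunM f g :
  bounded_mfun f -> bounded_mfun g -> bounded_mfun (fun x => f x * g x).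
Proof.
move=> [mf [C Cf]] [mg [D Dg]]; split; first exact: measurable_funM.
by exists (C * D) => x; rewrite normrM ler_pM.
Qed.

Lemma bounded_mfunN f : bounded_mfun f -> bounded_mfun (fun x => - f x).
Proof.
by move=> [mf [C Cf]]; split; [exact: measurableT_comp|exists C => x; rewrite normrN].
Qed.

Lemma bounded_mfunB f g :
  bounded_mfun f -> bounded_mfun g -> bounded_mfun (fun x => f x - g x).
Proof. by move=> bf bg; apply: bounded_mfunD => //; exact: bounded_mfunN. Qed.

Lemma bounded_mfunX f n : bounded_mfun f -> bounded_mfun (fun x => f x ^+ n).
Proof.
move=> bf; elim: n => [|n IH]; first exact: bounded_mfun_cst.
under [X in bounded_mfun X]funext do rewrite exprS.
exact: bounded_mfunM.
Qed.

Lemma bounded_mfun_sum (I : Type) (r : seq I) (P : pred I) (F : I -> T -> R) :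
  (forall i, bounded_mfun (F i)) ->
  bounded_mfun (fun x => \sum_(i <- r | P i) F i x).
Proof.
move=> bF; elim: r => [|i r IH].
  under [X in bounded_mfun X]funext do rewrite big_nil.
  exact: bounded_mfun_cst.
under [X in bounded_mfun X]funext do rewrite big_cons.
by case: (P i) => //; exact: bounded_mfunD.
Qed.

Lemma bounded_mfun_prod (I : Type) (r : seq I) (P : pred I) (F : I -> T -> R) :
  (forall i, bounded_mfun (F i)) ->
  bounded_mfun (fun x => \prod_(i <- r | P i) F i x).
Proof.
move=> bF; elim: r => [|i r IH].
  under [X in bounded_mfun X]funext do rewrite big_nil.
  exact: bounded_mfun_cst.
under [X in bounded_mfun X]funext do rewrite big_cons.
by case: (P i) => //; exact: bounded_mfunM.
Qed.

Lemma bounded_mfun_indic (A : set T) : measurable A -> bounded_mfun (\1_A : T -> R).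
Proof.
move=> mA; split; first exact: measurable_indic.
by exists 1 => x; rewrite indicE; case: (_ \in _); rewrite ?normr1 ?normr0.
Qed.

Lemma bounded_mfun_expR f : bounded_mfun f -> bounded_mfun (fun x => expR (f x)).
Proof.
move=> [mf [C Cf]]; split; first exact: measurableT_comp.
exists (expR C) => x; rewrite ger0_norm ?expR_ge0// ler_expR.
exact: le_trans (ler_norm _) (Cf x).
Qed.

End bounded_measurable.

Lemma bounded_mfun_comp d1 (T1 : measurableType d1) d2 (T2 : measurableType d2)
    (R : realType) (f : T2 -> R) (g : T1 -> T2) :
  bounded_mfun f -> measurable_fun setT g -> bounded_mfun (fun x => f (g x)).
Proof.
move=> [mf [C Cf]] mg; split; first exact: measurableT_comp.
by exists C => x.
Qed.

Section expectation.
Context d (T : measurableType d) (R : realType) (P : probability T R).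
Implicit Types f g : T -> R.

Lemma integrable_bounded_mfun f : bounded_mfun f -> P.-integrable setT (EFin \o f).
Proof.
move=> [mf [C Cf]]; apply: measurable_bounded_integrable => //.
  by rewrite (le_lt_trans (probability_le1 _ _)) ?ltry.
exists C; split; first by rewrite num_real.
by move=> M CM x _; exact: le_trans (Cf x) (ltW CM).
Qed.
#[local] Hint Resolve integrable_bounded_mfun : core.

Lemma mean_cst (c : R) : \int[P]_x c = c.
Proof.
rewrite Rintegral_cst// [X in fine X](_ : _ = 1%E) ?mulr1//.
exact: probability_setT.
Qed.

Lemma meanD f g : bounded_mfun f -> bounded_mfun g ->
  \int[P]_x (f x + g x) = \int[P]_x f x + \int[P]_x g x.
Proof. by move=> bf bg; rewrite RintegralD//; exact: integrable_bounded_mfun. Qed.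

Lemma meanB f g : bounded_mfun f -> bounded_mfun g ->
  \int[P]_x (f x - g x) = \int[P]_x f x - \int[P]_x g x.
Proof. by move=> bf bg; rewrite RintegralB//; exact: integrable_bounded_mfun. Qed.

Lemma meanZl f c : bounded_mfun f -> \int[P]_x (c * f x) = c * \int[P]_x f x.
Proof. by move=> bf; rewrite RintegralZl//; exact: integrable_bounded_mfun. Qed.

Lemma meanZr f c : bounded_mfun f -> \int[P]_x (f x * c) = \int[P]_x f x * c.
Proof. by move=> bf; rewrite RintegralZr//; exact: integrable_bounded_mfun. Qed.

Lemma mean_sum (I : Type) (r : seq I) (Q : pred I) (F : I -> T -> R) :
  (forall i, bounded_mfun (F i)) ->
  \int[P]_x (\sum_(i <- r | Q i) F i x) = \sum_(i <- r | Q i) \int[P]_x F i x.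
Proof.
move=> bF; elim: r => [|i r IH].
  under eq_Rintegral do rewrite big_nil.
  by rewrite mean_cst big_nil.
under eq_Rintegral do rewrite big_cons.
rewrite big_cons; case: (Q i) => //; rewrite meanD ?IH//.
exact: bounded_mfun_sum.
Qed.

Lemma le_mean f g : bounded_mfun f -> bounded_mfun g -> (forall x, f x <= g x) ->
  \int[P]_x f x <= \int[P]_x g x.
Proof. by move=> bf bg fg; apply: le_Rintegral => //; exact: integrable_bounded_mfun. Qed.

Lemma mean_ge0 f : (forall x, 0 <= f x) -> 0 <= \int[P]_x f x.
Proof. by move=> f0; exact: Rintegral_ge0. Qed.

(* Tangent line of [exp] at the weighted mean of [f]. *)
Lemma jensen_expR (w f : T -> R) : bounded_mfun w -> bounded_mfun f ->
  (forall x, 0 <= w x) -> 0 < \int[P]_x w x ->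
  \int[P]_x w x * expR (\int[P]_x (w x * f x) / \int[P]_x w x) <=
  \int[P]_x (w x * expR (f x)).
Proof.
move=> bw bf w0 Ew; set W := \int[P]_x w x; set a := _ / W.
have tangent (y : R) : expR a * (1 + (y - a)) <= expR y.
  by rewrite -{2}(subrK a y) [X in _ <= expR X]addrC expRD ler_wpM2l ?expR_ge0 ?expR_ge1Dx.
have -> : W * expR a = \int[P]_x (w x * (expR a * (1 + (f x - a)))).
  have -> : (fun x => w x * (expR a * (1 + (f x - a)))) =
      (fun x => (expR a * (1 - a)) * w x + expR a * (w x * f x)).
    by apply/funext => x; ring.
  have bwf := bounded_mfunM bw bf.
  rewrite meanD; [|exact: (bounded_mfunM (bounded_mfun_cst _ _))..].
  rewrite !meanZl// -/W /a; field.
  by rewrite gt_eqF.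
apply: le_mean => [||x]; last by rewrite ler_wpM2l.
- apply: bounded_mfunM => //; apply: (bounded_mfunM (bounded_mfun_cst _ _)).
  apply: (bounded_mfunD (bounded_mfun_cst _ _)).
  exact: (bounded_mfunB _ (bounded_mfun_cst _ _)).
- by apply: bounded_mfunM => //; exact: bounded_mfun_expR.
Qed.

End expectation.

(** * Fubini for bounded functions *)

Section product_mean.
Context d1 (T1 : measurableType d1) d2 (T2 : measurableType d2) (R : realType).
Variables (P1 : probability T1 R) (P2 : probability T2 R).

Let integrable_prod (f : T1 * T2 -> R) : bounded_mfun f ->
  (P1 \x P2)%E.-integrable setT (EFin \o f).
Proof. exact: (@integrable_bounded_mfun _ _ _ (P1 \x P2)%E). Qed.

Lemma bounded_mfun_pair2 (f : T1 * T2 -> R) a :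
  bounded_mfun f -> bounded_mfun (fun b => f (a, b)).
Proof.
move=> [mf [C Cf]]; split; last by exists C.
exact: measurableT_comp.
Qed.

Lemma bounded_mfun_pair1 (f : T1 * T2 -> R) b :
  bounded_mfun f -> bounded_mfun (fun a => f (a, b)).
Proof.
move=> [mf [C Cf]]; split; last by exists C.
exact: measurableT_comp.
Qed.

Lemma bounded_mfun_mean2 (f : T1 * T2 -> R) : bounded_mfun f ->
  bounded_mfun (fun a => \int[P2]_b f (a, b)).
Proof.
move=> bf; have [mf [C Cf]] := bf; split.
  apply: measurableT_comp => //.
  exact: (measurable_fubini_F (integrable_prod bf)).
exists C => a; apply: le_trans (le_normr_Rintegral _ _) _ => //.
  exact/integrable_bounded_mfun/bounded_mfun_pair2.
rewrite -[leRHS](mean_cst P2); apply: le_mean => //.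
  split; last by exists C => b; rewrite normr_id.
  by apply: measurableT_comp => //; case: (bounded_mfun_pair2 a bf).
exact: bounded_mfun_cst.
Qed.

Lemma mean_prod (f : T1 * T2 -> R) : bounded_mfun f ->
  \int[(P1 \x P2)%E]_z f z = \int[P1]_a \int[P2]_b f (a, b).
Proof.
move=> bf; rewrite /Rintegral -(integral12_prod_meas1 (integrable_prod bf)).
congr fine; apply: eq_integral => a _; rewrite /fubini_F fineK//.
apply: integrable_fin_num => //.
exact: (integrable_bounded_mfun P2 (bounded_mfun_pair2 a bf)).
Qed.

Lemma mean_exchange (f : T1 * T2 -> R) : bounded_mfun f ->
  \int[P1]_a \int[P2]_b f (a, b) = \int[P2]_b \int[P1]_a f (a, b).
Proof.
move=> bf; rewrite -mean_prod// /Rintegral -(integral21_prod_meas1 (integrable_prod bf)).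
congr fine; apply: eq_integral => b _; rewrite /fubini_G fineK//.
apply: integrable_fin_num => //.
exact: (integrable_bounded_mfun P1 (bounded_mfun_pair1 b bf)).
Qed.

End product_mean.

(** * Redrawing one coordinate of a product law, and independence *)

Section resampling.
Context d (T : measurableType d) (R : realType) (mu : probability T R).

Definition update n (x : n.-tuple T) (i : 'I_n) (z : T) : n.-tuple T :=
  [tuple if j == i then z else tnth x j | j < n].

Lemma tnth_update n (x : n.-tuple T) i z j :
  tnth (update x i z) j = if j == i then z else tnth x j.
Proof. by rewrite tnth_mktuple. Qed.

Lemma update_cons0 n a (t : n.-tuple T) z :
  update (cons_pair (a, t)) ord0 z = cons_pair (z, t).
Proof.
apply: eq_from_tnth => j; rewrite tnth_update.
by case: (unliftP ord0 j) => [k|] ->; rewrite ?eqxx ?tnth0 ?tnthS ?lift_eqF.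
Qed.

Lemma update_consS n a (t : n.-tuple T) i z :
  update (cons_pair (a, t)) (lift ord0 i) z = cons_pair (a, update t i z).
Proof.
apply: eq_from_tnth => j; rewrite tnth_update.
case: (unliftP ord0 j) => [k|] ->; rewrite ?tnth0 ?tnthS//.
by rewrite (inj_eq (@lift_inj _ _)) tnth_update.
Qed.

Lemma measurable_update n (i : 'I_n) :
  measurable_fun setT (fun p : n.-tuple T * T => update p.1 i p.2).
Proof.
apply/measurable_fun_tnthP => j /=.
under [X in measurable_fun _ X]funext do rewrite /= tnth_update.
case: (j == i); first exact: measurable_snd.
exact: (measurableT_comp (measurable_tnth j) measurable_fst).
Qed.

Lemma mean_cons n (f : n.+1.-tuple T -> R) : bounded_mfun f ->
  \int[power_measure mu n.+1]_x f x =
  \int[mu]_a \int[power_measure mu n]_t f (cons_pair (a, t)).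
Proof.
move=> bf; have bfc : bounded_mfun (fun p : T * n.-tuple T => f (cons_pair p)).
  by apply: bounded_mfun_comp bf _; exact: measurable_cons_pair.
rewrite -(mean_prod _ _ bfc) /Rintegral; congr fine => /=.
rewrite /distribution integral_pushforward//=.
  by case: bf => mf _; exact/measurable_EFinP.
exact: (integrable_bounded_mfun (mu \x power_measure mu n)%E bfc).
Qed.

(** Invariance of the product law under redrawing one coordinate, which plays the role of
    conditional expectation given the other coordinates. For the head coordinate the redrawn value
    replaces the outer variable, whose mean becomes that of a constant, and Fubini exchanges the two
    remaining means. *)
Lemma mean_update n (f : n.-tuple T -> R) (i : 'I_n) : bounded_mfun f ->
  \int[power_measure mu n]_x f x =
  \int[power_measure mu n]_x \int[mu]_z f (update x i z).
Proof.
elim: n f i => [|n IH] f i bf; first by case: i.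
have bfu m (g : m.-tuple T -> R) (j : 'I_m) : bounded_mfun g ->
    bounded_mfun (fun p : m.-tuple T * T => g (update p.1 j p.2)).
  by move=> bg; apply: bounded_mfun_comp bg _; exact: measurable_update.
have bfc : bounded_mfun (fun p : T * n.-tuple T => f (cons_pair p)).
  by apply: bounded_mfun_comp bf _; exact: measurable_cons_pair.
rewrite (mean_cons (bounded_mfun_mean2 (power_measure mu n.+1) mu (bfu _ _ i bf))) (mean_cons bf) /=.
case: (unliftP ord0 i) => [j|] ->.
  apply: eq_Rintegral => a _.
  under [RHS]eq_Rintegral do under eq_Rintegral do rewrite update_consS.
  by apply: (IH (fun t => f (cons_pair (a, t)))); exact: (bounded_mfun_pair2 a bfc).
under [RHS]eq_Rintegral do under eq_Rintegral do
  under eq_Rintegral do rewrite update_cons0.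
by rewrite mean_cst (mean_exchange _ _ bfc).
Qed.

Lemma mean_prod_tuple n (f : 'I_n -> T -> R) : (forall i, bounded_mfun (f i)) ->
  \int[power_measure mu n]_x \prod_(i < n) f i (tnth x i) =
  \prod_(i < n) \int[mu]_z f i z.
Proof.
have bprod m (g : 'I_m -> T -> R) : (forall i, bounded_mfun (g i)) ->
    bounded_mfun (fun x : m.-tuple T => \prod_(i < m) g i (tnth x i)).
  move=> bg; apply: bounded_mfun_prod => i.
  by apply: bounded_mfun_comp (bg i) _; exact: measurable_tnth.
elim: n f => [|n IH] f bf.
  by under eq_Rintegral do rewrite big_ord0; rewrite mean_cst big_ord0.
rewrite (mean_cons (bprod _ _ bf)) big_ord_recl -meanZr//.
apply: eq_Rintegral => a _; rewrite -IH//.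
rewrite -(meanZl _ _ (bprod _ (fun i => f (lift ord0 i)) _))//.
apply: eq_Rintegral => t _; rewrite big_ord_recl tnth0; congr (_ * _).
by apply: eq_bigr => i _; rewrite tnthS.
Qed.

End resampling.

(** * Exponential family of the base measure *)

Section clamp.
Context (R : realType) (km kp : R).
Hypothesis km_lt_kp : km < kp.

Definition clamp (z : R) : R := Num.max km (Num.min kp z).

Lemma clamp_itv z : km <= clamp z <= kp.
Proof.
by rewrite /clamp le_max lexx /= ge_max (ltW km_lt_kp) ge_min lexx.
Qed.

Lemma clamp_id z : km <= z <= kp -> clamp z = z.
Proof. by move=> /andP[kz zk]; rewrite /clamp min_r// max_r. Qed.

Definition support_radius : R := Num.max `|km| `|kp|.

Lemma support_radius_gt0 : 0 < support_radius.
Proof.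
rewrite /support_radius lt_max !normr_gt0; have := km_lt_kp.
by case: (eqVneq km 0) => //= ->; rewrite lt0r => /andP[].
Qed.

Lemma norm_le_support_radius z : km <= z <= kp -> `|z| <= support_radius.
Proof.
move=> /andP[kz zk]; rewrite /support_radius le_max; case: (leP 0 z) => z0.
  by rewrite (ger0_norm z0) (ger0_norm (le_trans z0 zk)) zk orbT.
by rewrite (ltr0_norm z0) (ltr0_norm (le_lt_trans kz z0)) lerN2 kz.
Qed.

Lemma norm_clamp z : `|clamp z| <= support_radius.
Proof. exact/norm_le_support_radius/clamp_itv. Qed.

Lemma measurable_clamp : measurable_fun setT clamp.
Proof.
apply: measurable_maxr; first exact: measurable_cst.
by apply: measurable_minr; [exact: measurable_cst|exact: measurable_id].
Qed.

Lemma bounded_mfun_clamp : bounded_mfun clamp.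
Proof. by split; [exact: measurable_clamp|exists support_radius; exact: norm_clamp]. Qed.

End clamp.

Lemma ratio_sub (R : realType) (x1 x2 y1 y2 : R) : x2 != 0 -> y2 != 0 ->
  x1 / x2 - y1 / y2 = ((x1 - y1) + y1 / y2 * (y2 - x2)) / x2.
Proof. by move=> x20 y20; field; rewrite x20. Qed.

(** Squeezes a difference quotient [q] between two slopes [a] and [b]. Multiplying by the increment
    [d] treats both of its signs at once. *)
Lemma norm_sub_between (R : realType) (d q a b : R) :
  d != 0 -> d * a <= d * q -> d * q <= d * b -> `|a - q| <= `|a - b|.
Proof.
case: (ltrgtP d 0) => // d0 _.
  rewrite !(ler_nM2l d0) => qa bq.
  by rewrite !ger0_norm ?subr_ge0 ?(le_trans bq)// lerD2l lerN2.
rewrite !(ler_pM2l d0) => aq qb.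
by rewrite !ler0_norm ?subr_le0 ?(le_trans aq)// lerN2 lerD2l lerN2.
Qed.

Section exponential_family.
Context (R : realType) (km kp : R) (mu : probability (measurableTypeR R) R).
Hypothesis km_lt_kp : km < kp.
Hypothesis mu_itv : mu [set z : R | km <= z <= kp] = 1%E.
Local Notation c := (clamp km kp).
Local Notation r := (support_radius km kp).
Local Notation Lam := (cumulant mu).

Lemma measurable_interval_mu : measurable [set z : measurableTypeR R | km <= z <= kp].
Proof.
rewrite (_ : [set z | _] = `[km, kp]%classic); first exact: measurable_itv.
by apply/seteqP; split => z /=; rewrite in_itv.
Qed.

Lemma mean_clamp (f : R -> R) : measurable_fun setT f ->
  \int[mu]_z f z = \int[mu]_z f (c z).
Proof.
move=> mf; congr fine; apply: ae_eq_integral => //.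
- exact/measurable_EFinP.
- apply/measurable_EFinP; apply: measurableT_comp => //; exact: measurable_clamp.
- exists (~` [set z : R | km <= z <= kp]); split.
  + exact: (measurableC measurable_interval_mu).
  + transitivity (1 - mu [set z : R | (km <= z <= kp)%R])%E.
      exact: (probability_setC mu measurable_interval_mu).
    by rewrite mu_itv subee.
  + by move=> z /= nz kz; apply: nz => _; rewrite clamp_id.
Qed.

Definition mgf (l : R) : R := \int[mu]_z expR (l * c z).
Definition mgf1 (l : R) : R := \int[mu]_z (c z * expR (l * c z)).
(** Mean of [mu] tilted by [expR (l * z)]; it turns out to be the derivative of the cumulant. *)
Definition tilted_mean (l : R) : R := mgf1 l / mgf l.
Local Notation phi := tilted_mean.

Let bc : bounded_mfun (c : measurableTypeR R -> R).
Proof. exact: bounded_mfun_clamp. Qed.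

Lemma bounded_mfun_expc l : bounded_mfun (fun z : measurableTypeR R => expR (l * c z)).
Proof. exact/bounded_mfun_expR/(bounded_mfunM (bounded_mfun_cst _ _)). Qed.
Let bec := bounded_mfun_expc.

Lemma bounded_mfun_cexpc l :
  bounded_mfun (fun z : measurableTypeR R => c z * expR (l * c z)).
Proof. exact: bounded_mfunM. Qed.
Let bcec := bounded_mfun_cexpc.

Let expc_bound C l z : `|l| <= C -> expR (- (C * r)) <= expR (l * c z) <= expR (C * r).
Proof.
move=> lC; rewrite !ler_expR -ler_norml normrM ler_pM//.
exact: norm_clamp.
Qed.

Lemma mgf_bound C l : `|l| <= C -> expR (- (C * r)) <= mgf l.
Proof.
move=> lC; rewrite -[leLHS](mean_cst mu); apply: le_mean => //.
  exact: bounded_mfun_cst.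
by move=> z; case/andP: (expc_bound z lC).
Qed.

Lemma mgf_gt0 l : 0 < mgf l.
Proof. exact: lt_le_trans (expR_gt0 _) (mgf_bound (lexx _)). Qed.

Lemma cumulantE l : Lam l = ln (mgf l).
Proof.
rewrite /cumulant /mgf; congr ln.
apply: (mean_clamp (f := fun z => expR (l * z))).
by apply: measurableT_comp => //; exact: measurable_funM.
Qed.

Lemma expR_cumulant l : expR (Lam l) = mgf l.
Proof. by rewrite cumulantE lnK// posrE mgf_gt0. Qed.

(** Jensen for [mu] tilted by [a], whose mean is [phi a]: the line of slope [phi a] through the
    point at [a] stays below the cumulant. The derivative is deduced from this inequality, and not
    conversely. *)
Lemma cumulant_convex a b : (b - a) * phi a <= Lam b - Lam a.
Proof.
rewrite lerBrDl -ler_expR expRD !expR_cumulant.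
have -> : (b - a) * phi a =
    (\int[mu]_z (expR (a * c z) * ((b - a) * c z))) / (\int[mu]_z expR (a * c z)).
  rewrite /phi -/(mgf a) mulrA -meanZl//; congr (_ / _).
  by apply: eq_Rintegral => z _; ring.
have -> : mgf b = \int[mu]_z (expR (a * c z) * expR ((b - a) * c z)).
  by apply: eq_Rintegral => z _; rewrite -expRD; congr expR; ring.
apply: jensen_expR => //.
- exact: (bounded_mfunM (bounded_mfun_cst _ _)).
- exact: mgf_gt0.
Qed.

Lemma tilted_mean_itv l : km <= phi l <= kp.
Proof.
have M0 := mgf_gt0 l; rewrite /phi ler_pdivlMr// ler_pdivrMr// -!meanZl//.
by apply/andP; split; apply: le_mean => // [|z];
  rewrite ?ler_wpM2r ?expR_ge0//; try exact: (bounded_mfunM (bounded_mfun_cst _ _));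
  case/andP: (clamp_itv km_lt_kp z).
Qed.

Lemma norm_tilted_mean l : `|phi l| <= r.
Proof. exact/norm_le_support_radius/tilted_mean_itv. Qed.

Lemma expR_lipschitz (D u v : R) : `|u| <= D -> `|v| <= D ->
  `|expR u - expR v| <= expR D * `|u - v|.
Proof.
wlog uv : u v / v <= u.
  move=> H uD vD; case: (leP v u) => uv; first exact: H.
  by rewrite distrC (distrC u); apply: H => //; exact: ltW.
move=> uD vD; rewrite !ger0_norm ?subr_ge0 ?ler_expR//.
apply: (@le_trans _ _ (expR u * (u - v))); last first.
  by rewrite ler_wpM2r ?subr_ge0// ler_expR (le_trans (ler_norm _)).
have -> : expR v = expR u * expR (v - u) by rewrite -expRD; congr expR; ring.
have := expR_ge1Dx (v - u); have := expR_gt0 u; nra.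
Qed.

Lemma norm_mean_le (f : measurableTypeR R -> R) C : bounded_mfun f ->
  (forall z, `|f z| <= C) -> `|\int[mu]_z f z| <= C.
Proof.
move=> bf fC; rewrite ler_norml -[- C](mean_cst mu) -[X in _ && (_ <= X)](mean_cst mu).
apply/andP; split; apply: le_mean => //; try exact: bounded_mfun_cst.
  by move=> z; have := fC z; rewrite ler_norml => /andP[].
by move=> z; have := fC z; rewrite ler_norml => /andP[].
Qed.

(** Numerator and denominator are Lipschitz because [exp] is on bounded sets, and the denominator is
    at least [e^-1] with [e = expR (C * r)]. *)
Lemma tilted_mean_lipschitz C : exists2 L : R, 0 < L &
  forall a b, `|a| <= C -> `|b| <= C -> `|phi a - phi b| <= L * `|a - b|.
Proof.
pose e := expR (C * r); have e0 : 0 < e by exact: expR_gt0.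
have r0 := support_radius_gt0 km_lt_kp.
exists (2 * r ^+ 2 * e ^+ 2); first by rewrite !mulr_gt0// exprn_gt0.
move=> a b aC bC.
have cz z := norm_clamp km_lt_kp z.
have eab z : `|expR (a * c z) - expR (b * c z)| <= e * r * `|a - b|.
  have lC l : `|l| <= C -> `|l * c z| <= C * r by move=> ?; rewrite normrM ler_pM.
  apply: le_trans (expR_lipschitz (lC _ aC) (lC _ bC)) _.
  rewrite -mulrBl normrM -/e -mulrA ler_wpM2l ?expR_ge0//.
  by rewrite [leRHS]mulrC ler_wpM2l.
have Mab : `|mgf b - mgf a| <= e * r * `|a - b|.
  rewrite -meanB//; apply: norm_mean_le; first exact: bounded_mfunB.
  by move=> z; rewrite distrC.
have M1ab : `|mgf1 a - mgf1 b| <= r * (e * r * `|a - b|).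
  rewrite -meanB//; apply: norm_mean_le; first exact: bounded_mfunB.
  by move=> z; rewrite -mulrBr normrM ler_pM.
have Ma0 := mgf_gt0 a; have Mb0 := mgf_gt0 b.
have -> : phi a - phi b = ((mgf1 a - mgf1 b) + phi b * (mgf b - mgf a)) / mgf a.
  by apply: ratio_sub; rewrite gt_eqF.
rewrite normrM normfV (gtr0_norm Ma0) ler_pdivrMr//.
have Mae : e^-1 <= mgf a by rewrite /e -expRN; exact: mgf_bound.
apply: (@le_trans _ _ (2 * r ^+ 2 * e ^+ 2 * `|a - b| * e^-1)); last first.
  by rewrite ler_wpM2l// !mulr_ge0// ?exprn_ge0// ltW.
have -> : 2 * r ^+ 2 * e ^+ 2 * `|a - b| / e =
    r * (e * r * `|a - b|) + r * (e * r * `|a - b|).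
  by field; rewrite gt_eqF.
apply: le_trans (ler_normD _ _) _; rewrite lerD// normrM ler_pM//.
exact: norm_tilted_mean.
Qed.

Lemma continuous_tilted_mean : continuous phi.
Proof.
move=> a; have [L L0 HL] := tilted_mean_lipschitz (`|a| + 1).
apply/cvgrPdist_le => e e0; near=> b.
have ab : `|a - b| <= Num.min 1 (e / L).
  near: b; apply: cvgr_dist_le; last by rewrite lt_min ltr01 divr_gt0.
  exact: cvg_id.
move: ab; rewrite le_min => /andP[ab1 abe].
apply: le_trans (HL _ _ _ _) _; first by rewrite lerDl.
  rewrite -[b](subKr a) (le_trans (ler_normB _ _))// lerD2l//.
by rewrite mulrC -ler_pdivlMr.
Unshelve. all: by end_near. Qed.

(** The convexity inequality, written at [l] and at [h + l], traps the difference quotient between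
    [phi l] and [phi (h + l)]; continuity of [phi] concludes. *)
Lemma is_derive_cumulant l : is_derive l (1 : R) Lam (phi l).
Proof.
have H : h^-1 *: (Lam (h *: (1 : R) + l) - Lam l) @[h --> 0^'] --> phi l.
  apply/cvgrPdist_le => e e0.
  have phil : phi (h + l) @[h --> (0 : R)] --> phi l.
    rewrite -[X in _ --> phi X]add0r.
    apply: (@continuous_comp _ _ _ (fun h : R => h + l) phi).
      by apply: cvgD; [exact: cvg_id|exact: cvg_cst].
    exact: continuous_tilted_mean.
  have {}phil : phi (h + l) @[h --> 0^'] --> phi l.
    by move=> U /phil; exact: nbhs_dnbhs.
  near=> h.
  have h0 : h != 0 by near: h; exact: nbhs_dnbhs_neq.
  have pe : `|phi l - phi (h + l)| <= e by near: h; exact: cvgr_dist_le.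
  apply: le_trans pe; rewrite -[h *: 1]/(h * 1) mulr1 -[_ *: _]/(_ * _).
  have c1 := cumulant_convex l (h + l); have c2 := cumulant_convex (h + l) l.
  rewrite addrK in c1; rewrite opprD addrCA subrr addr0 in c2.
  set q := h^-1 * _.
  have hq : Lam (h + l) - Lam l = h * q by rewrite /q mulrA divff ?mul1r.
  apply: (norm_sub_between h0); rewrite -hq; first exact: c1.
  by rewrite -[leLHS]opprK lerNl opprB -mulNr.
by split; [apply/cvg_ex; exists (phi l)|exact: cvg_lim].
Unshelve. all: by end_near. Qed.

Lemma derive1_cumulant l : derive1 Lam l = phi l.
Proof. by rewrite derive1E; have := is_derive_cumulant l => -[]. Qed.

End exponential_family.

Ltac bmf := repeat first [ assumption | exact: bounded_mfun_cst | exact: bounded_mfun_clamp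
  | apply: bounded_mfunD | apply: bounded_mfunN | apply: bounded_mfunM
  | apply: bounded_mfunX | apply: bounded_mfun_expR ].

Lemma clamp_dist (R : realType) (km kp : R) z k : km <= k <= kp ->
  `|clamp km kp z - k| <= `|z - k|.
Proof.
move=> /andP[k1 k2]; case: (leP k z) => [kz|/ltW zk].
  have h1 : k <= clamp km kp z by rewrite /clamp le_max le_min k2 kz orbT.
  have h2 : clamp km kp z <= z by rewrite /clamp ge_max (le_trans k1 kz) ge_min lexx orbT.
  by rewrite !ger0_norm ?subr_ge0// lerD2r.
have h1 : clamp km kp z <= k by rewrite /clamp ge_max k1 ge_min zk orbT.
have h2 : z <= clamp km kp z by rewrite /clamp le_max le_min lexx (le_trans zk k2) orbT.
by rewrite !ler0_norm ?subr_le0// lerN2 lerD2r.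
Qed.

(** * Strong convexity of the cumulant on bounded sets *)

Section strong_monotonicity.
Context (R : realType) (km kp : R) (mu : probability (measurableTypeR R) R).
Hypothesis km_lt_kp : km < kp.
Hypothesis mu_itv : mu [set z : R | km <= z <= kp] = 1%E.
Hypothesis km_supp : measure_support mu km.
Hypothesis kp_supp : measure_support mu kp.
Local Notation c := (clamp km kp).
Local Notation r := (support_radius km kp).
Local Notation phi := (tilted_mean km kp mu).
Local Notation mgf := (mgf km kp mu).
Local Notation mgf1 := (mgf1 km kp mu).

Lemma mean_indic d (T : measurableType d) (P : probability T R) (A : set T) :
  measurable A -> \int[P]_x \1_A x = fine (P A).
Proof. by move=> mA; rewrite /Rintegral integral_indic// setIT. Qed.

Lemma exprB_sqr_ge (D x y : R) : - D <= x -> - D <= y ->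
  expR (- D) * (x - y) ^+ 2 <= (x - y) * (expR x - expR y).
Proof.
wlog xy : x y / y <= x.
  move=> H Dx Dy; case: (leP y x) => xy; first exact: H.
  rewrite -[leRHS]mulrNN !opprB -sqrrN opprB.
  by apply: H => //; exact: ltW.
move=> Dx Dy.
have -> : expR x = expR y * expR (x - y) by rewrite -expRD; congr expR; ring.
have h1 := expR_ge1Dx (x - y); have h2 := expR_gt0 y.
have h3 : expR (- D) <= expR y by rewrite ler_expR.
have h4 : 0 <= x - y by rewrite subr_ge0.
rewrite expr2 mulrCA ler_wpM2l//.
by apply: le_trans (ler_wpM2r h4 h3) _; nra.
Qed.

(** One of the endpoints is at distance at least half the length of the interval from the mean. It
    belongs to the support, so a ball around it, with radius [s] a quarter of the length, has
    positive mass, and there the variable stays at distance [s] from the mean. *)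
Lemma variance_gt0 : 0 < \int[mu]_z (c z ^+ 2) - (\int[mu]_z c z) ^+ 2.
Proof.
set m := \int[mu]_z c z; pose s := (kp - km) / 4.
have s0 : 0 < s by rewrite divr_gt0 ?subr_gt0.
have bc : bounded_mfun (c : measurableTypeR R -> R) by bmf.
have -> : \int[mu]_z (c z ^+ 2) - m ^+ 2 = \int[mu]_z ((c z - m) ^+ 2).
  have -> : \int[mu]_z ((c z - m) ^+ 2) = \int[mu]_z (c z ^+ 2 + (- (2 * m) * c z + m ^+ 2)).
    by apply: eq_Rintegral => z _; ring.
  by rewrite meanD ?meanD ?meanZl ?mean_cst -/m; [ring|bmf..].
have [k [kI ksupp km2]] : exists k, [/\ km <= k <= kp, measure_support mu k & 2 * s <= `|k - m|].
  have [h|h] := leP (2 * s) `|kp - m|; first by exists kp; rewrite lexx (ltW km_lt_kp).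
  exists km; rewrite lexx (ltW km_lt_kp); split => //.
  move: h; rewrite ltr_norml => /andP[h1 h2]; rewrite ler0_norm; rewrite /s in h1 h2 *; lra.
have oU : open (ball k s) by exact: ball_open.
have mU : measurable (ball k s : set (measurableTypeR R)) by exact: open_measurable.
have muU : 0 < fine (mu (ball k s)).
  rewrite fine_gt0// (ksupp _ oU (ballxx _ s0)) /=.
  by rewrite (le_lt_trans (probability_le1 _ mU)) ?ltry.
apply: (@lt_le_trans _ _ (s ^+ 2 * fine (mu (ball k s)))).
  by rewrite mulr_gt0// exprn_gt0.
rewrite -mean_indic// -meanZl; last exact: bounded_mfun_indic.
apply: le_mean => [||z].
- by apply: bounded_mfunM; [bmf|exact: bounded_mfun_indic].
- by bmf.
- rewrite indicE; case: (boolP (z \in _)) => zU; last by rewrite mulr0 sqr_ge0.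
  move: zU; rewrite inE /ball/= distrC => zU.
  rewrite mulr1 -[leRHS]real_normK ?num_real// lerXn2r ?nnegrE ?(ltW s0)//.
  have := clamp_dist z kI; have := ler_distD (c z) k m.
  rewrite (distrC k (c z)); lra.
Qed.

(** Symmetrization with two independent copies [z], [w]: the double mean of [g] is twice
    [mgf a * mgf b * (phi b - phi a)], and [d * g z w] dominates pointwise a multiple of
    [(c z - c w) ^+ 2], whose double mean is twice the variance. *)
Lemma tilted_mean_strong_mono C : exists2 k : R, 0 < k &
  forall a b, `|a| <= C -> `|b| <= C -> k * (b - a) ^+ 2 <= (b - a) * (phi b - phi a).
Proof.
set V := \int[mu]_z (c z ^+ 2) - (\int[mu]_z c z) ^+ 2.
have V0 : 0 < V := variance_gt0.
have bc : bounded_mfun (c : measurableTypeR R -> R) by bmf.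
pose e x : R := expR (- (x * r)).
(* Of the exponent [6 * C], a part [4 * C] is lost in the pointwise bound and [C] in bounding each
   of the two factors [mgf a] and [mgf b]. *)
exists (V * e (6 * C)); first by rewrite mulr_gt0 ?expR_gt0.
move=> a b aC bC; set d := b - a.
have C0 : 0 <= C := le_trans (normr_ge0 a) aC.
have r0 := support_radius_gt0 km_lt_kp.
pose g z w : R := (c z - c w) * (expR (b * c z) * expR (a * c w) - expR (b * c w) * expR (a * c z)).
have be l : bounded_mfun (fun z : measurableTypeR R => expR (l * c z)) by bmf.
have bce l : bounded_mfun (fun z : measurableTypeR R => c z * expR (l * c z)) by bmf.
have gE z : \int[mu]_w g z w = c z * expR (b * c z) * mgf a - c z * expR (a * c z) * mgf b
    - expR (b * c z) * mgf1 a + expR (a * c z) * mgf1 b.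
  transitivity (\int[mu]_w ((c z * expR (b * c z)) * expR (a * c w)
     + ((- (c z * expR (a * c z))) * expR (b * c w)
     + ((- expR (b * c z)) * (c w * expR (a * c w))
     + expR (a * c z) * (c w * expR (b * c w)))))).
    by apply: eq_Rintegral => w _; rewrite /g; ring.
  by rewrite !(meanD, meanZl) -/(mgf _) -/(mgf1 _); [rewrite /mgf /mgf1; ring|bmf..].
have ggE : \int[mu]_z \int[mu]_w g z w = 2 * (mgf1 b * mgf a - mgf b * mgf1 a).
  under eq_Rintegral do rewrite gE.
  transitivity (\int[mu]_z (mgf a * (c z * expR (b * c z)) + ((- mgf b) * (c z * expR (a * c z))
     + ((- mgf1 a) * expR (b * c z) + mgf1 b * expR (a * c z))))).
    by apply: eq_Rintegral => z _; ring.
  by rewrite !(meanD, meanZl) -/(mgf _) -/(mgf1 _); [rewrite /mgf /mgf1; ring|bmf..].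
have qE z : \int[mu]_w ((c z - c w) ^+ 2) =
    c z ^+ 2 - 2 * c z * (\int[mu]_w c w) + \int[mu]_w (c w ^+ 2).
  transitivity (\int[mu]_w (c z ^+ 2 + ((- (2 * c z)) * c w + c w ^+ 2))).
    by apply: eq_Rintegral => w _; ring.
  by rewrite !(meanD, meanZl) ?mean_cst; [ring|bmf..].
have qqE : \int[mu]_z \int[mu]_w ((c z - c w) ^+ 2) = 2 * V.
  under eq_Rintegral do rewrite qE.
  transitivity (\int[mu]_z (c z ^+ 2 + ((- (2 * \int[mu]_w c w)) * c z + \int[mu]_w (c w ^+ 2)))).
    by apply: eq_Rintegral => z _; ring.
  by rewrite !(meanD, meanZl) ?mean_cst; [rewrite /V; ring|bmf..].
have pw z w : e (4 * C) * d ^+ 2 * (c z - c w) ^+ 2 <= d * g z w.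
  have lc l y : `|l| <= 2 * C -> - (2 * C * r) <= l * c y.
    move=> lC; have : `|l * c y| <= 2 * C * r by rewrite normrM ler_pM// norm_clamp.
    by rewrite ler_norml => /andP[].
  have dC : `|d| <= 2 * C by rewrite (le_trans (ler_normB _ _))// mulr2n mulrDl mul1r lerD.
  have := exprB_sqr_ge (lc d z dC) (lc d w dC).
  rewrite -mulrBr exprMn => h.
  have h2 : expR (- (2 * C * r)) <= expR (a * (c z + c w)).
    rewrite ler_expR; have : `|a * (c z + c w)| <= 2 * C * r.
      rewrite normrM [2 * C]mulrC -mulrA ler_pM// (le_trans (ler_normD _ _))//.
      by rewrite mulr2n mulrDl mul1r lerD ?norm_clamp.
    by rewrite ler_norml => /andP[].
  have -> : d * g z w = expR (a * (c z + c w)) *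
      (d * (c z - c w) * (expR (d * c z) - expR (d * c w))).
    have ee y : expR (b * y) = expR (a * y) * expR (d * y).
      by rewrite -expRD; congr expR; rewrite /d; ring.
    have -> : expR (a * (c z + c w)) = expR (a * c z) * expR (a * c w).
      by rewrite -expRD; congr expR; ring.
    by rewrite /g !ee; ring.
  have -> : e (4 * C) = expR (- (2 * C * r)) * expR (- (2 * C * r)).
    by rewrite /e -expRD; congr expR; ring.
  move: h h2; set u := expR (- _) => h h2; rewrite -(mulrA u) -(mulrA u).
  apply: ler_pM => //; rewrite ?expR_ge0// -mulrA.
    by rewrite mulr_ge0 ?expR_ge0// mulr_ge0 ?sqr_ge0.
  exact: h.
have key : e (4 * C) * d ^+ 2 * (2 * V) <= d * (2 * (mgf1 b * mgf a - mgf b * mgf1 a)).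
  rewrite -qqE -ggE -!meanZl.
  - apply: le_mean => [||z].
    + apply: bounded_mfunM; first by bmf.
      by under [X in bounded_mfun X]funext do rewrite qE; bmf.
    + apply: bounded_mfunM; first by bmf.
      by under [X in bounded_mfun X]funext do rewrite gE; bmf.
    + rewrite -!meanZl; [|by rewrite /g; bmf|bmf].
      by apply: le_mean => [||w]; [bmf|rewrite /g; bmf|exact: pw].
  - by under [X in bounded_mfun X]funext do rewrite gE; bmf.
  - by under [X in bounded_mfun X]funext do rewrite qE; bmf.
have Ma0 := mgf_gt0 mu km_lt_kp a; have Mb0 := mgf_gt0 mu km_lt_kp b.
have Mle l : `|l| <= C -> mgf l * e C <= 1.
  move=> lC; rewrite /e expRN -/(e C) ler_pdivrMr ?expR_gt0// mul1r.
  rewrite -[leRHS](mean_cst mu); apply: le_mean => [||z]; [bmf|bmf|].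
  rewrite ler_expR; apply: le_trans (ler_norm _) _; rewrite normrM ler_pM//.
  exact: norm_clamp.
have -> : phi b - phi a = (mgf1 b * mgf a - mgf b * mgf1 a) / (mgf b * mgf a).
  by rewrite /tilted_mean -mulNr addf_div ?gt_eqF// mulNr (mulrC (mgf1 a)).
rewrite [leRHS]mulrA ler_pdivlMr ?mulr_gt0//.
have -> : V * e (6 * C) * d ^+ 2 * (mgf b * mgf a) =
   e (4 * C) * d ^+ 2 * V * ((mgf b * e C) * (mgf a * e C)).
  have -> : e (6 * C) = e (4 * C) * (e C * e C).
    by rewrite /e -!expRD; congr expR; ring.
  ring.
apply: (@le_trans _ _ (e (4 * C) * d ^+ 2 * V)); last first.
  by rewrite -(@ler_pM2l _ 2)// mulrCA [leRHS]mulrCA; exact: key.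
have e0 x : 0 <= e x by exact: expR_ge0.
apply: ler_piMr; first by rewrite mulr_ge0 ?(ltW V0)// mulr_ge0 ?sqr_ge0.
by apply: mulr_ile1; rewrite ?Mle// mulr_ge0// ltW.
Qed.

End strong_monotonicity.

(** * The edge weights under the model *)

Section measurability.
Context (R : realType) (n : nat).

Lemma measurable_weight (e : edge n) :
  measurable_fun setT (fun x : weights R n => weight x e).
Proof. exact: measurable_tnth. Qed.

Lemma measurable_adj i j : measurable_fun setT (fun x : weights R n => adj x i j).
Proof.
rewrite /adj; case: insub => [e|]; first exact: measurable_weight.
exact: measurable_cst.
Qed.

Lemma measurable_local_field (e : edge n) :
  measurable_fun setT (fun x : weights R n => local_field x e).
Proof.
apply: measurable_sum => e1; apply: measurable_sum => e2.
apply: measurable_funM; last exact: measurable_weight.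
by apply: measurable_funM; [exact: measurable_cst|exact: measurable_weight].
Qed.

Lemma measurable_mean_field : measurable_fun setT (fun x : weights R n => mean_field x).
Proof.
apply: measurable_funM; first exact: measurable_cst.
by apply: measurable_sum => e; exact: measurable_local_field.
Qed.

Lemma measurable_field_variance :
  measurable_fun setT (fun x : weights R n => field_variance x).
Proof.
apply: measurable_funM; first exact: measurable_cst.
apply: measurable_sum => e; apply: measurable_funX; apply: measurable_funB.
  exact: measurable_local_field.
exact: measurable_mean_field.
Qed.

Lemma measurable_exponent beta h :
  measurable_fun setT (fun x : weights R n => edge_triangle_exponent beta h x).
Proof.
apply: measurable_funD; (apply: measurable_funM; first exact: measurable_cst).
  do 3 (apply: measurable_sum => ?).
  by apply: measurable_funM; [apply: measurable_funM|]; exact: measurable_adj.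
apply: measurable_sum => i.
rewrite (_ : (fun x : weights R n => _) = fun x : weights R n =>
    \sum_(j < n) if (i < j)%N then adj x i j else 0); last first.
  by apply/funext => x; rewrite big_mkcond.
apply: measurable_sum => j; case: (i < j)%N; first exact: measurable_adj.
exact: measurable_cst.
Qed.

Lemma measurable_superlevel d (T : measurableType d) (f : T -> R) c :
  measurable_fun setT f -> measurable [set x | c < f x].
Proof.
move=> mf; rewrite (_ : [set x | _] = f @^-1` `]c, +oo[%classic); last first.
  by apply/seteqP; split => x /=; rewrite in_itv/= andbT.
by rewrite -[X in measurable X]setTI; apply: mf => //; exact: measurable_itv.
Qed.

Lemma measurable_sublevel d (T : measurableType d) (f : T -> R) c :
  measurable_fun setT f -> measurable [set x | f x <= c].
Proof.
move=> mf; rewrite (_ : [set x | _] = f @^-1` `]-oo, c]%classic); last first.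
  by apply/seteqP; split => x /=; rewrite in_itv.
by rewrite -[X in measurable X]setTI; apply: mf => //; exact: measurable_itv.
Qed.

End measurability.

Section clamped_weights.
Context (R : realType) (km kp : R) (mu : probability (measurableTypeR R) R).
Hypothesis km_lt_kp : km < kp.
Hypothesis mu_itv : mu [set z : R | km <= z <= kp] = 1%E.

Definition in_box n (x : weights R n) := forall i, km <= tnth x i <= kp.

Definition clampt n (x : weights R n) : weights R n :=
  [tuple clamp km kp (tnth x i) | i < #|{: edge n}|].

Lemma in_box_clampt n (x : weights R n) : in_box (clampt x).
Proof. by move=> i; rewrite tnth_mktuple clamp_itv. Qed.

Lemma clampt_id n (x : weights R n) : in_box x -> clampt x = x.
Proof. by move=> bx; apply: eq_from_tnth => i; rewrite tnth_mktuple clamp_id. Qed.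

Lemma measurable_clampt n : measurable_fun setT (@clampt n).
Proof.
apply/measurable_fun_tnthP => i /=.
under [X in measurable_fun _ X]funext do rewrite /= tnth_mktuple.
apply: (measurableT_comp (measurable_clamp km kp)); exact: measurable_tnth.
Qed.

Lemma clampt_update n (x : weights R n) i z :
  clampt (update x i z) = update (clampt x) i (clamp km kp z).
Proof.
apply: eq_from_tnth => j; rewrite tnth_mktuple !tnth_update.
by case: eqP => // _; rewrite tnth_mktuple.
Qed.

Lemma bounded_mfun_tnth n i :
  bounded_mfun (fun x : weights R n => tnth (clampt x) i).
Proof.
under [X in bounded_mfun X]funext do rewrite tnth_mktuple.
apply: (bounded_mfun_comp (bounded_mfun_clamp km_lt_kp)); exact: measurable_tnth.
Qed.

Lemma bounded_mfun_weight n (e : edge n) :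
  bounded_mfun (fun x : weights R n => weight (clampt x) e).
Proof. exact: bounded_mfun_tnth. Qed.

Lemma bounded_mfun_adj n i j :
  bounded_mfun (fun x : weights R n => adj (clampt x) i j).
Proof.
rewrite /adj; case: insub => [e|]; first exact: bounded_mfun_weight.
exact: bounded_mfun_cst.
Qed.

Lemma bounded_mfun_local_field n (e : edge n) :
  bounded_mfun (fun x : weights R n => local_field (clampt x) e).
Proof.
do 2 (apply: bounded_mfun_sum => ?).
apply: bounded_mfunM; last exact: bounded_mfun_weight.
by apply: bounded_mfunM; [exact: bounded_mfun_cst|exact: bounded_mfun_weight].
Qed.

Lemma bounded_mfun_exponent n beta h :
  bounded_mfun (fun x : weights R n => edge_triangle_exponent beta h (clampt x)).
Proof.
apply: bounded_mfunD; (apply: bounded_mfunM; first exact: bounded_mfun_cst).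
  do 3 (apply: bounded_mfun_sum => ?).
  by apply: bounded_mfunM; [apply: bounded_mfunM|]; exact: bounded_mfun_adj.
by do 2 (apply: bounded_mfun_sum => ?); exact: bounded_mfun_adj.
Qed.

Lemma bounded_mfun_indic_clampt n (A : set (weights R n)) : measurable A ->
  bounded_mfun (fun x : weights R n => \1_A (clampt x) : R).
Proof.
move=> mA; apply: (bounded_mfun_comp (bounded_mfun_indic R mA)).
exact: measurable_clampt.
Qed.

Definition expect n (F : weights R n -> R) : R :=
  \int[power_measure mu #|{: edge n}|]_x F (clampt x).

Lemma expect_prod n (F : edge n -> R -> R) :
  (forall e, bounded_mfun (fun z : measurableTypeR R => F e (clamp km kp z))) ->
  expect (fun x : weights R n => \prod_e F e (weight x e)) = \prod_e \int[mu]_z F e (clamp km kp z).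
Proof.
move=> bF.
transitivity (\int[power_measure mu #|{: edge n}|]_x
    \prod_(i < #|{: edge n}|) (fun z => F (enum_val i) (clamp km kp z)) (tnth x i)).
  apply: eq_Rintegral => x _.
  rewrite [LHS](reindex_onto enum_val enum_rank) => [|e _]; last exact: enum_rankK.
  apply: eq_big => [i|i _]; first by rewrite enum_valK eqxx.
  by rewrite /weight enum_valK tnth_mktuple.
rewrite (mean_prod_tuple mu (f := fun i z => F (enum_val i) (clamp km kp z))) => [|i]; last exact: bF.
rewrite [RHS](reindex_onto enum_val enum_rank) => [|e _]; last exact: enum_rankK.
by apply: eq_big => [i|i _]; first by rewrite enum_valK eqxx.
Qed.

Lemma expect_expR_sum n (l : edge n -> R) :
  expect (fun x => expR (\sum_e l e * weight x e)) = expR (\sum_e cumulant mu (l e)).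
Proof.
transitivity (expect (fun x => \prod_e (fun e z => expR (l e * z)) e (weight x e))).
  by apply: eq_Rintegral => x _; rewrite expR_sum.
rewrite (expect_prod (F := fun e z => expR (l e * z))) => [|e]; last exact: bounded_mfun_expc.
by rewrite expR_sum; apply: eq_bigr => e _; rewrite (expR_cumulant km_lt_kp mu_itv).
Qed.

Lemma measurable_box n : measurable [set x : weights R n | in_box x].
Proof.
rewrite (_ : [set x | _] = \bigcap_(i in [set: 'I_#|{: edge n}|])
    ((@tnth _ (measurableTypeR R))^~ i @^-1` [set z : R | km <= z <= kp])).
  apply: fin_bigcap_measurable => // i _; rewrite -[X in measurable X]setTI.
  by apply: measurable_tnth => //; exact: measurable_interval_mu.
by apply/seteqP; split => x /= H i; [move=> _; exact: H|exact: (H i I)].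
Qed.

Lemma power_measure_boxC n :
  power_measure mu #|{: edge n}| (~` [set x : weights R n | in_box x]) = 0%E.
Proof.
transitivity (1 - power_measure mu #|{: edge n}| [set x : weights R n | in_box x])%E.
  exact: (probability_setC _ (@measurable_box n)).
have /= -> := @power_measure_box _ _ R mu #|{: edge n}| (fun=> [set z : R | km <= z <= kp])
  (fun=> measurable_interval_mu km kp).
by rewrite big1 ?subee// => i _; exact: mu_itv.
Qed.

Lemma integral_clampt n (f : weights R n -> \bar R) : measurable_fun setT f ->
  (\int[power_measure mu #|{: edge n}|]_x f x =
   \int[power_measure mu #|{: edge n}|]_x f (clampt x))%E.
Proof.
move=> mf; apply: ae_eq_integral => //.
  by apply: measurableT_comp => //; exact: measurable_clampt.
exists (~` [set x : weights R n | in_box x]); split.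
- exact: (measurableC (@measurable_box n)).
- exact: power_measure_boxC.
- by move=> x /= nx bx; apply: nx => _; rewrite clampt_id.
Qed.

(** Real-valued ratio form of [edge_triangle_model], so that all estimates are inequalities between
    means of bounded functions; [model_gibbs] identifies the two on measurable sets. *)
Definition gibbs_prob beta h n (A : set (weights R n)) : R :=
  expect (fun x : weights R n => \1_A x * expR (edge_triangle_exponent beta h x)) /
  expect (fun x : weights R n => expR (edge_triangle_exponent beta h x)).

Lemma model_gibbs beta h n (A : set (weights R n)) : measurable A ->
  edge_triangle_model mu beta h A = (gibbs_prob beta h A)%:E.
Proof.
move=> mA; rewrite /edge_triangle_model.
have mH := @measurable_exponent R n beta h.
have meH : measurable_fun setT (fun x : weights R n =>
    expR (edge_triangle_exponent beta h x)) by exact: measurableT_comp.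
have -> : partition_function mu n beta h =
    expect (fun x : weights R n => expR (edge_triangle_exponent beta h x)).
  by apply: (congr1 fine); apply: integral_clampt; exact/measurable_EFinP.
rewrite /gibbs_prob; set Z := expect _.
rewrite integral_mkcond.
rewrite (_ : _ \_ A = fun x : weights R n =>
    (\1_A x * expR (edge_triangle_exponent beta h x) * Z^-1)%:E); last first.
  apply/funext => x; rewrite patchE indicE; case: ifPn => _ /=.
    by rewrite mul1r.
  by rewrite !mul0r.
have b1 := @bounded_mfun_indic_clampt n A mA.
have b2 := bounded_mfun_expR (@bounded_mfun_exponent n beta h).
rewrite integral_clampt; last first.
  apply/measurable_EFinP; apply: measurable_funM => //.
  by apply: measurable_funM => //; exact: measurable_indic.
have b3 := bounded_mfunM b1 b2.
rewrite -meanZr// /Rintegral fineK//.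
apply: integrable_fin_num => //.
apply: integrable_bounded_mfun; apply: bounded_mfunM => //.
exact: bounded_mfun_cst.
Qed.

End clamped_weights.

(** * Triangles and local fields *)

Lemma sum_ord_const (R : realType) n (b : R) : \sum_(k < n) b = n%:R * b.
Proof. by rewrite sumr_const card_ord mulr_natl. Qed.

Section edges.
Context (R : realType) (n : nat).
Implicit Types (e : edge n) (i j k : 'I_n).

Lemma set2_eq (a b i j : 'I_n) : a != b ->
  ([set a; b]%SET == [set i; j]%SET) = (i == a) && (j == b) || (i == b) && (j == a).
Proof.
move=> ab; apply/eqP/idP; last first.
  by case/orP => /andP[/eqP -> /eqP ->] //; rewrite finset.setUC.
move=> H; have : a \in [set i; j]%SET by rewrite -H finset.set21.
have : b \in [set i; j]%SET by rewrite -H finset.set22.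
by rewrite !finset.in_set2 => /orP[] /eqP bE /orP[] /eqP aE; move: ab;
  rewrite aE bE !eqxx /= ?orbT.
Qed.

Lemma edge_neq e i j : val e = [set i; j]%SET -> i != j.
Proof. by move=> eE; have := valP e; rewrite /= eE cards2; case: (i != j). Qed.

Lemma edgeP e : exists i j, (i < j)%N /\ val e = [set i; j]%SET.
Proof.
have /cards2P[i [j [ij eE]]] := valP e.
case: (ltngtP i j) => ij'; first by exists i, j.
  by exists j, i; rewrite finset.setUC.
by move/val_inj: ij' ij => ->; rewrite eqxx.
Qed.

Lemma sum_delta (T : finType) (f : T -> R) (a : T) :
  \sum_(i : T) (i == a)%:R * f i = f a.
Proof.
rewrite (bigD1 a)//= eqxx mul1r big1 ?addr0// => i /negbTE ->.
by rewrite mul0r.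
Qed.

Lemma natr_set2_eq (a b i j : 'I_n) : a != b ->
  ([set a; b]%SET == [set i; j]%SET)%:R =
    (i == a)%:R * (j == b)%:R + (i == b)%:R * (j == a)%:R :> R.
Proof.
move=> ab; rewrite set2_eq// -!natrM -natrD !mulnb.
case: (eqVneq i a) => [->|_] /=; last by rewrite add0n.
by rewrite (negbTE ab) orbF addn0.
Qed.

Lemma sum_edge_indic (f : 'I_n -> 'I_n -> R) e i j : val e = [set i; j]%SET ->
  \sum_k \sum_l (val e == [set k; l]%SET)%:R * f k l = f i j + f j i.
Proof.
move=> eE; have ij := edge_neq eE; rewrite eE.
transitivity (\sum_k ((k == i)%:R * f k j + (k == j)%:R * f k i)).
  apply: eq_bigr => k _; rewrite -!(sum_delta (fun l => f k l)) !mulr_sumr -big_split/=.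
  by apply: eq_bigr => l _; rewrite natr_set2_eq//; ring.
by rewrite big_split/= (sum_delta (f^~ j)) (sum_delta (f^~ i)).
Qed.

(** The dictionary between edges and off-diagonal pairs of vertices: each edge comes from two
    ordered pairs, hence the factor 2. *)
Lemma sum_edges (fe : edge n -> R) (f : 'I_n -> 'I_n -> R) :
  (forall e i j, val e = [set i; j]%SET -> fe e = f i j) ->
  \sum_i \sum_(j | j != i) f i j = 2 * \sum_e fe e.
Proof.
move=> fE; rewrite mulr_sumr.
transitivity (\sum_i \sum_j \sum_e (val e == [set i; j]%SET)%:R * fe e).
  apply: eq_bigr => i _; rewrite big_mkcond; apply: eq_bigr => j _.
  case: (eqVneq j i) => [->|ji] /=.
    rewrite big1// => e _; case: eqP => [/edge_neq|]; first by rewrite eqxx.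
    by rewrite mul0r.
  have c2 : #|[set i; j]%SET| == 2 by rewrite cards2 (eq_sym i j) ji.
  rewrite (bigD1 (exist (fun e : {set 'I_n} => #|e| == 2) _ c2 : edge n))//= eqxx mul1r big1 ?addr0 => [|e ne].
    by rewrite (fE _ i j).
  by case: eqP => [eE|]; rewrite ?mul0r//; case/eqP: ne; apply: val_inj.
under eq_bigr do rewrite exchange_big/=.
rewrite exchange_big/=; apply: eq_bigr => e _.
have [i [j [_ eE]]] := edgeP e.
by rewrite (sum_edge_indic (fun _ _ => fe e) eE); ring.
Qed.

Variable x : weights R n.

Lemma adjE i j : adj x i j = \sum_e (val e == [set i; j]%SET)%:R * weight x e.
Proof.
rewrite /adj; case: insubP => [e _ eE|ne].
  rewrite (bigD1 e)//= eE eqxx mul1r big1 ?addr0// => e' ne.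
  by case: eqP => [e'E|]; rewrite ?mul0r//; case/eqP: ne; apply: val_inj; rewrite eE.
rewrite big1// => e _; case: eqP => [eE|]; last by rewrite mul0r.
by rewrite -eE (valP e) in ne.
Qed.

Lemma adj_edge e i j : val e = [set i; j]%SET -> adj x i j = weight x e.
Proof.
move=> eE; rewrite adjE (bigD1 e)//= eE eqxx mul1r big1 ?addr0// => e' ne.
by case: eqP => [e'E|]; rewrite ?mul0r//; case/eqP: ne; apply: val_inj; rewrite eE.
Qed.

Lemma adj_sym i j : adj x i j = adj x j i.
Proof. by rewrite /adj finset.setUC. Qed.

Lemma adj_diag i : adj x i i = 0.
Proof.
rewrite /adj; case: insubP => // e _ eE.
by have := edge_neq eE; rewrite eqxx.
Qed.

Lemma sum_adj_lt : \sum_(i < n) \sum_(j < n | (i < j)%N) adj x i j = \sum_e weight x e.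
Proof.
transitivity (\sum_(i < n) \sum_(j < n) \sum_(e : edge n) (val e == [set i; j]%SET)%:R * ((i < j)%N%:R * weight x e)).
  apply: eq_bigr => i _; rewrite big_mkcond; apply: eq_bigr => j _.
  rewrite adjE; case: (i < j)%N.
    by apply: eq_bigr => e _; rewrite mul1r.
  by rewrite big1// => e _; rewrite mul0r mulr0.
under eq_bigr do rewrite exchange_big/=.
rewrite exchange_big/=; apply: eq_bigr => e _.
have [i [j [ij eE]]] := edgeP e.
rewrite (sum_edge_indic (fun i j => (i < j)%N%:R * weight x e) eE) ij.
by rewrite ltnNge (ltnW ij) /= mul0r addr0 mul1r.
Qed.

(** Once [e] joins [i] and [j], a triangle is determined by its third vertex [k] and by which of
    [e1], [e2] meets [j]. At most one of these possibilities holds for given edges, so the sum of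
    indicators is itself 0 or 1. *)
Lemma form_triangleE e e1 e2 i j : val e = [set i; j]%SET ->
  (form_triangle e e1 e2)%:R = \sum_k
    ((val e1 == [set j; k]%SET)%:R * (val e2 == [set k; i]%SET)%:R
     + (val e1 == [set i; k]%SET)%:R * (val e2 == [set k; j]%SET)%:R) :> R.
Proof.
move=> eE; have ij := edge_neq eE.
have main a b k0 : a != b -> val e1 = [set b; k0]%SET -> val e2 = [set k0; a]%SET ->
    \sum_k ((val e1 == [set b; k]%SET)%:R * (val e2 == [set k; a]%SET)%:R
     + (val e1 == [set a; k]%SET)%:R * (val e2 == [set k; b]%SET)%:R) = 1 :> R.
  move=> ab e1E e2E; have bk := edge_neq e1E; have ka := edge_neq e2E.
  rewrite (bigD1 k0)//= e1E e2E !eqxx big1 => [|k kk0].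
    by rewrite set2_eq// (negbTE ab) (eq_sym a) (negbTE ka) /= mul0r mulr1 !addr0.
  rewrite !set2_eq// !eqxx (negbTE kk0) (negbTE ab) (negbTE bk) (eq_sym a k0) (negbTE ka) /=.
  by rewrite !mul0r addr0.
case: (boolP (form_triangle e e1 e2)) => [|/existsPn H].
  case/existsP => a /existsP[b /existsP[k0 /and3P[/eqP e0E /eqP e1E /eqP e2E]]].
  move/eqP: (eE); rewrite e0E set2_eq; last exact: edge_neq e0E.
  case/orP => /andP[/eqP ia /eqP jb]; subst a b; first by rewrite (main i j k0).
  rewrite -[LHS](main j i k0)// 1?eq_sym//.
  by apply: eq_bigr => k _; rewrite addrC.
rewrite big1// => k _.
have H' a b : val e = [set a; b]%SET ->
    (val e1 == [set b; k]%SET)%:R * (val e2 == [set k; a]%SET)%:R = 0 :> R.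
  move=> eab; case: eqP => [e1E|]; last by rewrite mul0r.
  case: eqP => [e2E|]; last by rewrite mulr0.
  have /existsPn/(_ b)/existsPn/(_ k) := H a.
  by rewrite eab e1E e2E !eqxx.
by rewrite (H' i j)// (H' j i) ?addr0// eE finset.setUC.
Qed.

(** The factor 2 counts the two orders in which the remaining edges of a triangle can be listed. *)
Lemma local_fieldE e i j : val e = [set i; j]%SET ->
  local_field x e = 2 / n%:R * \sum_k adj x i k * adj x k j.
Proof.
move=> eE; rewrite /local_field /triangle_coef.
transitivity (n%:R^-1 * \sum_k (adj x j k * adj x k i + adj x i k * adj x k j)); last first.
  rewrite [2 * _]mulrC -mulrA; congr (_ * _); rewrite mulr_sumr; apply: eq_bigr => k _.
  by rewrite (adj_sym j k) (adj_sym k i); ring.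
transitivity (n%:R^-1 * \sum_k \sum_e1 \sum_e2
    ((val e1 == [set j; k]%SET)%:R * (val e2 == [set k; i]%SET)%:R
     + (val e1 == [set i; k]%SET)%:R * (val e2 == [set k; j]%SET)%:R)
     * (weight x e1 * weight x e2)).
  rewrite [in RHS]exchange_big mulr_sumr; apply: eq_bigr => e1 _.
  rewrite [in RHS]exchange_big mulr_sumr; apply: eq_bigr => e2 _.
  rewrite -mulr_suml -(form_triangleE _ _ eE).
  by case: form_triangle; rewrite ?mul0r ?mulr0 ?mul1r -?mulrA.
congr (_ * _); apply: eq_bigr => k _.
rewrite !adjE !mulr_suml -big_split/=; apply: eq_bigr => e1 _.
rewrite !mulr_sumr -big_split/=; apply: eq_bigr => e2 _.
ring.
Qed.

End edges.

Section edge_counts.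
Context (R : realType) (n : nat).
Local Notation N := (num_edges R n).

Lemma sum_edges_cst (a : R) : \sum_(e : edge n) a = N * a.
Proof. by rewrite sumr_const card_edge /num_edges mulr_natl. Qed.

Lemma num_edgesE : N = n%:R * (n%:R - 1) / 2 :> R.
Proof.
rewrite /num_edges; have /(congr1 (fun k => k%:R : R)) := mul_bin_left n 1.
rewrite bin1 subn1 !natrM => H.
case: (posnP n) => [->|n0]; first by rewrite bin0n !mul0r.
move: H; rewrite -subn1 natrB// => H.
apply: (@mulfI _ 2); first by rewrite pnatr_eq0.
by rewrite H; field.
Qed.

Lemma num_edges_ge0 : 0 <= N. Proof. exact: ler0n. Qed.

Lemma num_edges_le : N <= n%:R ^+ 2 / 2.
Proof. by rewrite num_edgesE; have : 0 <= n%:R :> R by []; nra. Qed.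

Lemma num_edges_ge : (1 < n)%N -> n%:R ^+ 2 / 4 <= N.
Proof.
move=> n1; rewrite num_edgesE; have : 2 <= n%:R :> R by rewrite ler_nat.
by nra.
Qed.

Lemma num_edges_gt0 : (1 < n)%N -> 0 < N.
Proof. by move=> n1; rewrite /num_edges ltr0n bin_gt0. Qed.

Lemma sum_edges_le (fe : edge n -> R) (f : 'I_n -> 'I_n -> R) :
  (forall i j, 0 <= f i j) ->
  (forall e i j, val e = [set i; j]%SET -> fe e = f i j) ->
  2 * \sum_e fe e <= \sum_i \sum_j f i j.
Proof.
move=> f0 fE; rewrite -(sum_edges fE); apply: ler_sum => i _.
by rewrite big_mkcond; apply: ler_sum => j _; case: (j != i).
Qed.

End edge_counts.

Section matrix_form.
Context (R : realType) (n : nat).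
Implicit Types x y : weights R n.

(** The local field extended to all ordered pairs, diagonal included, so that it can be summed over
    full squares. *)
Definition matrix_field x (i j : 'I_n) : R := 2 / n%:R * \sum_k adj x i k * adj x k j.

Definition triangle_sum x : R := \sum_i \sum_j \sum_k adj x i j * adj x j k * adj x k i.

Lemma sum_edges_adj (f : R -> R) x : f 0 = 0 ->
  2 * \sum_e f (weight x e) = \sum_i \sum_j f (adj x i j).
Proof.
move=> f0; rewrite -(sum_edges (f := fun i j => f (adj x i j))); last first.
  by move=> e i j eE; rewrite (adj_edge x eE).
apply: eq_bigr => i _; rewrite big_mkcond; apply: eq_bigr => j _.
by case: eqP => // ->; rewrite adj_diag.
Qed.

Lemma triangle_sum_edges x :
  triangle_sum x = n%:R * \sum_e weight x e * local_field x e.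
Proof.
case: (posnP n) x => [n0 x|n0 x].
  have -> : n%:R = 0 :> R by rewrite n0.
  rewrite mul0r /triangle_sum big1// => i _; by have := ltn_ord i; rewrite {2}n0.
apply: (@mulfI _ 2); first by rewrite pnatr_eq0.
rewrite mulrCA -(sum_edges (f := fun i j => adj x i j * matrix_field x i j)); last first.
  by move=> e i j eE; rewrite (adj_edge x eE) (local_fieldE x eE).
rewrite /triangle_sum [LHS]mulr_sumr [RHS]mulr_sumr; apply: eq_bigr => i _.
rewrite [in RHS]big_mkcond [LHS]mulr_sumr [RHS]mulr_sumr; apply: eq_bigr => j _.
case: eqP => [->|_] /=.
  by rewrite mulr0 big1 ?mulr0// => k _; rewrite adj_diag !mul0r.
rewrite (eq_bigr (fun k => adj x i j * (adj x i k * adj x k j))) => [|k _].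
  by rewrite -mulr_sumr /matrix_field; field; rewrite pnatr_eq0 -lt0n.
by rewrite (adj_sym x j k) (adj_sym x k i); ring.
Qed.

Lemma exponentE beta h x :
  edge_triangle_exponent beta h x =
  beta / (3 * n%:R) * triangle_sum x + h * \sum_e weight x e.
Proof. by rewrite /edge_triangle_exponent sum_adj_lt. Qed.

Lemma exponent_edges beta h x :
  edge_triangle_exponent beta h x =
  beta / 3 * (\sum_e weight x e * local_field x e) + h * \sum_e weight x e.
Proof.
rewrite exponentE triangle_sum_edges; case: (posnP n) x => [n0 x|n0 x].
  rewrite big1 ?mulr0// => e _; have [i _] := edgeP e.
  by have := ltn_ord i; rewrite {2}n0.
by congr (_ + _); field; rewrite pnatr_eq0 -lt0n.
Qed.

End matrix_form.

Section box_bounds.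
Context (R : realType) (km kp : R).
Hypothesis km_lt_kp : km < kp.
Local Notation r := (support_radius km kp).
Context (n : nat).
Implicit Types x y : weights R n.
Local Notation in_box := (in_box km kp).
Local Notation N := (num_edges R n).

Let r0 : 0 < r. Proof. exact: support_radius_gt0. Qed.

Lemma norm_weight_le x e : in_box x -> `|weight x e| <= r.
Proof. by move=> bx; exact: norm_le_support_radius (bx _). Qed.

Lemma norm_adj_le x i j : in_box x -> `|adj x i j| <= r.
Proof.
by move=> bx; rewrite /adj; case: insub => [e|]; rewrite ?norm_weight_le// normr0 ltW.
Qed.

Lemma norm_local_field_le x e : in_box x -> `|local_field x e| <= 2 * r ^+ 2.
Proof.
move=> bx; have [i [j [ij eE]]] := edgeP e.
have n0 : (0 < n)%N := leq_ltn_trans (leq0n _) (ltn_ord i).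
rewrite (local_fieldE x eE) normrM ger0_norm ?divr_ge0// -mulrA ler_wpM2l//.
rewrite mulrC ler_pdivrMr ?ltr0n//; apply: le_trans (ler_norm_sum _ _ _) _.
rewrite -[n in leRHS]card_ord mulr_natr -sumr_const; apply: ler_sum => k _.
by rewrite normrM expr2 ler_pM ?norm_adj_le.
Qed.

Lemma norm_mean_field_le x : in_box x -> `|mean_field x| <= 2 * r ^+ 2.
Proof.
move=> bx; have R0 : 0 <= 2 * r ^+ 2 by rewrite mulr_ge0 ?sqr_ge0.
rewrite /mean_field; case: (ltnP 1 n) => n1; last first.
  by rewrite /num_edges bin_small// invr0 mul0r normr0.
have N0 := num_edges_gt0 R n1.
rewrite normrM normfV (gtr0_norm N0) mulrC ler_pdivrMr//.
apply: le_trans (ler_norm_sum _ _ _) _; rewrite mulrC -sum_edges_cst.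
by apply: ler_sum => e _; exact: norm_local_field_le.
Qed.

(* Each local field is a sum over paths of length two, and an edge lies on few of them. *)
Lemma local_field_lipschitz x y : in_box x -> in_box y ->
  \sum_e `|local_field x e - local_field y e| <=
  4 * r * \sum_e `|weight x e - weight y e|.
Proof.
move=> bx by_; case: (posnP n) => [n0|n0].
  rewrite !big1 ?mulr0// => e _; have [i _] := edgeP e.
    by have := ltn_ord i; rewrite {2}n0.
  by have := ltn_ord i; rewrite {2}n0.
have n0' : 0 < n%:R :> R by rewrite ltr0n.
pose D i j := `|adj x i j - adj y i j|.
have DE : 2 * \sum_e `|weight x e - weight y e| = \sum_i \sum_j D i j.
  rewrite -(sum_edges (f := D)); last first.
    by move=> e i j eE; rewrite /D !(adj_edge _ eE).
  apply: eq_bigr => i _; rewrite big_mkcond; apply: eq_bigr => j _.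
  by rewrite /D; case: eqP => // ->; rewrite !adj_diag subrr normr0.
have H : 2 * \sum_e `|local_field x e - local_field y e| <=
    \sum_i \sum_j `|matrix_field x i j - matrix_field y i j|.
  by apply: sum_edges_le => // e i j eE; rewrite (local_fieldE x eE) (local_fieldE y eE).
suff : \sum_i \sum_j `|matrix_field x i j - matrix_field y i j| <= 4 * r * \sum_i \sum_j D i j.
  by rewrite -DE; lra.
have term i j : `|matrix_field x i j - matrix_field y i j| <=
    2 / n%:R * r * (\sum_k D i k + \sum_k D k j).
  rewrite /matrix_field -mulrBr normrM ger0_norm ?divr_ge0// -mulrA ler_wpM2l ?divr_ge0//.
  rewrite -sumrB; apply: le_trans (ler_norm_sum _ _ _) _.
  rewrite -big_split/= mulr_sumr; apply: ler_sum => k _.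
  have -> : adj x i k * adj x k j - adj y i k * adj y k j =
    (adj x i k - adj y i k) * adj x k j + (adj x k j - adj y k j) * adj y i k by ring.
  apply: le_trans (ler_normD _ _) _; rewrite !normrM mulrDr -/(D i k) -/(D k j).
  by rewrite lerD// mulrC ler_wpM2r ?normr_ge0// norm_adj_le.
apply: (@le_trans _ _ (\sum_i \sum_j (2 / n%:R * r * (\sum_k D i k + \sum_k D k j)))).
  by apply: ler_sum => i _; apply: ler_sum => j _.
have -> : \sum_(i < n) \sum_(j < n) (2 / n%:R * r * (\sum_k D i k + \sum_k D k j)) =
    2 / n%:R * r * (\sum_(i < n) \sum_(j < n) \sum_k D i k + \sum_(i < n) \sum_(j < n) \sum_k D k j).
  rewrite -big_split mulr_sumr; apply: eq_bigr => i _ /=.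
  by rewrite -big_split mulr_sumr.
have -> : \sum_(i < n) \sum_(j < n) \sum_k D i k = n%:R * \sum_i \sum_k D i k.
  by rewrite mulr_sumr; apply: eq_bigr => i _; rewrite sumr_const card_ord mulr_natl.
have -> : \sum_(i < n) \sum_(j < n) \sum_k D k j = n%:R * \sum_i \sum_k D i k.
  by rewrite sumr_const card_ord mulr_natl exchange_big.
by rewrite le_eqVlt; apply/orP; left; apply/eqP; field; rewrite gt_eqF.
Qed.

End box_bounds.

(** * Dependence on a single edge weight *)

Section coordinate.
Context (R : realType) (n : nat).
Implicit Types (x : weights R n) (e f : edge n) (z : R).

Definition set_weight x e z : weights R n := update x (enum_rank e) z.

Lemma weight_set x e z f : weight (set_weight x e z) f = if f == e then z else weight x f.
Proof. by rewrite /weight tnth_update (inj_eq enum_rank_inj). Qed.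

Lemma adj_set x e z i j : adj (set_weight x e z) i j =
  if val e == [set i; j]%SET then z else adj x i j.
Proof.
case: eqP => [eE|ne]; first by rewrite (adj_edge _ eE) weight_set eqxx.
rewrite !adjE; apply: eq_bigr => f _; case: eqP => [fE|]; last by rewrite !mul0r.
by rewrite weight_set; case: eqP => // fe; case: ne; rewrite -fe.
Qed.

(** The other two edges of a triangle containing [e] differ from [e]; the terms in which [k] is an
    endpoint of [e] contain a diagonal entry and vanish. *)
Lemma local_field_set x e z : local_field (set_weight x e z) e = local_field x e.
Proof.
have [i [j [ij eE]]] := edgeP e.
rewrite !(local_fieldE _ eE); congr (_ * _); apply: eq_bigr => k _.
rewrite !adj_set eE.
have ij' : i != j by rewrite neq_ltn ij.
case: (eqVneq k i) => [->|ki]; first by rewrite !set2_eq// (negbTE ij') !eqxx !andbF /= !adj_diag !mul0r.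
case: (eqVneq k j) => [->|kj].
  by rewrite !set2_eq// !eqxx (eq_sym j i) (negbTE ij') /= ?andbF /= adj_diag !mulr0.
by rewrite !set2_eq// (negbTE ki) (negbTE kj) ?andbF ?andFb /= ?andbF.
Qed.

(** With [adj = adj x0 + z * D], the terms of order two and three in [z] vanish because no triangle
    uses an edge twice. The three terms of order one agree after cyclic relabelling of the vertices,
    and each equals [n * local_field x e]. *)
Lemma triangle_sum_set x e z : triangle_sum (set_weight x e z) =
  triangle_sum (set_weight x e 0) + 3 * n%:R * z * local_field x e.
Proof.
case: (posnP n) x e => [n0 x e|n0 x e].
  by have [i _] := edgeP e; have := ltn_ord i; rewrite {2}n0.
have [i0 [j0 [_ eE]]] := edgeP e.
set x0 := set_weight x e 0.
pose D i j : R := (val e == [set i; j]%SET)%:R.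
have aE i j : adj (set_weight x e z) i j = adj x0 i j + z * D i j.
  by rewrite !adj_set /D; case: eqP => _; rewrite ?mulr1 ?mulr0 ?add0r ?addr0.
have DD i j k : D i j * D j k * adj x0 k i = 0.
  rewrite /D; case: eqP => [e1|]; last by rewrite !mul0r.
  case: eqP => [e2|]; last by rewrite mulr0 mul0r.
  rewrite (_ : k = i) ?adj_diag ?mulr0//.
  move/eqP: (e2); rewrite e1 set2_eq; last exact: edge_neq e1.
  by case/orP => /andP[/eqP a /eqP b]//; have := edge_neq e1; rewrite a eqxx.
have DDD i j k : D i j * D j k * D k i = 0.
  rewrite /D; case: eqP => [e1|]; last by rewrite !mul0r.
  case: eqP => [e2|]; last by rewrite mulr0 mul0r.
  case: eqP => [e3|]; last by rewrite mulr0.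
  move/eqP: (e2); rewrite e1 set2_eq; last exact: edge_neq e1.
  have := edge_neq e3; have := edge_neq e1.
  by move=> n1 n3 /orP[] /andP[/eqP a /eqP b]; [move: n1|move: n3]; rewrite ?a ?b eqxx.
pose T := \sum_i \sum_j \sum_k D i j * (adj x0 j k * adj x0 k i).
have TE : T = n%:R * local_field x e.
  rewrite /T -(local_field_set x e 0) -/x0.
  under eq_bigr do under eq_bigr do rewrite -mulr_sumr.
  rewrite (sum_edge_indic (fun i j => \sum_k adj x0 j k * adj x0 k i) eE).
  rewrite (local_fieldE x0 eE).
  have -> : \sum_k adj x0 j0 k * adj x0 k i0 = \sum_k adj x0 i0 k * adj x0 k j0.
    by apply: eq_bigr => k _; rewrite (adj_sym x0 j0) (adj_sym x0 k i0) mulrC.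
  by field; rewrite pnatr_eq0 -lt0n.
have T2 : \sum_i \sum_j \sum_k adj x0 i j * (D j k * adj x0 k i) = T.
  rewrite exchange_big/=; apply: eq_bigr => j _; rewrite exchange_big/=.
  by apply: eq_bigr => k _; apply: eq_bigr => i _; ring.
have T3 : \sum_i \sum_j \sum_k adj x0 i j * (adj x0 j k * D k i) = T.
  rewrite -[RHS]T2 exchange_big/=; apply: eq_bigr => j _; rewrite exchange_big/=.
  by apply: eq_bigr => k _; apply: eq_bigr => i _; ring.
transitivity (triangle_sum x0 + z * (T + T + T)); last first.
  by rewrite TE; ring.
rewrite -{2}T2 -{2}T3 /T /triangle_sum -!big_split mulr_sumr -big_split.
apply: eq_bigr => i _; rewrite -!big_split mulr_sumr -big_split.
apply: eq_bigr => j _; rewrite -!big_split mulr_sumr -big_split.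
apply: eq_bigr => k _; rewrite /= !aE.
have h1 := DD i j k; have h2 := DD j k i; have h3 := DD k i j; have h4 := DDD i j k.
transitivity (adj x0 i j * adj x0 j k * adj x0 k i +
   z * (D i j * (adj x0 j k * adj x0 k i) + adj x0 i j * (D j k * adj x0 k i)
     + adj x0 i j * (adj x0 j k * D k i))
   + z ^+ 2 * (D i j * D j k * adj x0 k i + D j k * D k i * adj x0 i j + D k i * D i j * adj x0 j k)
   + z ^+ 3 * (D i j * D j k * D k i)); first by ring.
by rewrite h1 h2 h3 h4; ring.
Qed.

Lemma exponent_set beta h x e z :
  edge_triangle_exponent beta h (set_weight x e z) =
  edge_triangle_exponent beta h (set_weight x e 0) + z * (beta * local_field x e + h).
Proof.
case: (posnP n) x e => [n0 x e|n0 x e].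
  by have [i _] := edgeP e; have := ltn_ord i; rewrite {2}n0.
rewrite !exponentE triangle_sum_set.
have -> : \sum_f weight (set_weight x e z) f = \sum_f weight (set_weight x e 0) f + z.
  rewrite !(bigD1 e (P := xpredT))//= !weight_set eqxx add0r addrC; congr (_ + _).
  by apply: eq_bigr => f /negbTE fe; rewrite !weight_set fe.
by field; rewrite pnatr_eq0 -lt0n.
Qed.

End coordinate.

(** * Second moment of centred scores *)

Section score.
Context (R : realType) (km kp : R) (mu : probability (measurableTypeR R) R).
Hypothesis km_lt_kp : km < kp.
Local Notation r := (support_radius km kp).
Local Notation phi := (tilted_mean km kp mu).
Local Notation clampt := (clampt km kp).
Local Notation expect := (expect km kp mu).
Local Notation in_box := (in_box km kp).

Lemma measurable_tilted_mean : measurable_fun setT (phi : measurableTypeR R -> R).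
Proof. by apply: continuous_measurable_fun; exact: continuous_tilted_mean. Qed.

Lemma in_box_set_weight n (x : weights R n) e z :
  km <= z <= kp -> in_box x -> in_box (set_weight x e z).
Proof. by move=> zI bx i; rewrite tnth_update; case: eqP. Qed.

Lemma bounded_mfun_set_weight n (F : weights R n -> R) e z : km <= z <= kp ->
  measurable_fun setT F -> bounded_mfun (fun x => F (clampt x)) ->
  bounded_mfun (fun x => F (set_weight (clampt x) e z)).
Proof.
move=> zI mF [_ [C FC]]; split; last first.
  exists C => x; rewrite -[set_weight _ _ _](clampt_id (km := km) (kp := kp))//.
  by apply: in_box_set_weight => //; exact: in_box_clampt.
apply: (measurableT_comp mF).
apply/measurable_fun_tnthP => j /=.
under [X in measurable_fun _ X]funext do rewrite /= /set_weight tnth_update tnth_mktuple.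
case: (j == _); first exact: measurable_cst.
apply: (measurableT_comp (measurable_clamp km kp)); exact: measurable_tnth.
Qed.

Variables (beta h : R).
Section fixed_n.
Variable n : nat.
Local Notation H := (@edge_triangle_exponent R n beta h).

Definition residual (x : weights R n) e := weight x e - phi (beta * local_field x e + h).

Lemma measurable_residual e : measurable_fun setT (residual^~ e).
Proof.
apply: measurable_funB; first exact: measurable_weight.
apply: (measurableT_comp measurable_tilted_mean).
apply: measurable_funD => //; apply: measurable_funM => //.
exact: measurable_local_field.
Qed.

Lemma bounded_mfun_tilted_mean e :
  bounded_mfun (fun x : weights R n => phi (beta * local_field (clampt x) e + h)).
Proof.
split; last by exists r => x; exact: norm_tilted_mean.
apply: (measurableT_comp measurable_tilted_mean).
have [mm _] := bounded_mfun_local_field km_lt_kp e.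
by apply: measurable_funD => //; exact: measurable_funM.
Qed.

Lemma bounded_mfun_residual e : bounded_mfun (fun x => residual (clampt x) e).
Proof.
by apply: bounded_mfunB; [exact: bounded_mfun_weight|exact: bounded_mfun_tilted_mean].
Qed.

Lemma norm_residual_le x e : in_box x -> `|residual x e| <= 2 * r.
Proof.
move=> bx; apply: le_trans (ler_normB _ _) _.
by rewrite mulr2n mulrDl mul1r lerD ?norm_tilted_mean// norm_weight_le.
Qed.

(* Conditionally on the other weights, [weight x e] has the law [mu] tilted by
   [beta * local_field x e + h]. *)
Lemma expect_residual (g : weights R n -> R) e :
  bounded_mfun (fun x => g (clampt x)) ->
  (forall x z, g (set_weight x e z) = g x) ->
  expect (fun x => residual x e * g x * expR (H x)) = 0.
Proof.
move=> bg gi.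
have bH := bounded_mfun_expR (@bounded_mfun_exponent R km kp km_lt_kp n beta h).
rewrite /expect (mean_update mu (enum_rank e)); last first.
  by apply: bounded_mfunM => //; apply: bounded_mfunM => //; exact: bounded_mfun_residual.
rewrite -[RHS](mean_cst (power_measure mu #|{: edge n}|)); apply: eq_Rintegral => x _.
pose X := clampt x; pose l := beta * local_field X e + h.
pose A := g X * expR (H (set_weight X e 0)).
transitivity (\int[mu]_z (A * (clamp km kp z * expR (l * clamp km kp z))
    - (A * phi l) * expR (l * clamp km kp z))).
  apply: eq_Rintegral => z _.
  rewrite clampt_update -/(set_weight (clampt x) e (clamp km kp z)) gi exponent_set.
  rewrite /residual local_field_set weight_set eqxx expRD -/l -/X /A.
  by rewrite (mulrC (clamp km kp z) l); ring.
have be := bounded_mfun_expc km_lt_kp l.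
have bce := bounded_mfun_cexpc km_lt_kp l.
rewrite meanB; [|by bmf..]; rewrite !meanZl// -/(mgf km kp mu l) -/(mgf1 km kp mu l).
by rewrite /tilted_mean; field; rewrite gt_eqF// mgf_gt0.
Qed.

End fixed_n.

Definition gibbs_partition n : R :=
  expect (fun x : weights R n => expR (edge_triangle_exponent beta h x)).

Lemma gibbs_partition_gt0 n : 0 < gibbs_partition n.
Proof.
have bH := @bounded_mfun_exponent R km kp km_lt_kp n beta h.
have [_ [C HC]] := bH.
apply: (@lt_le_trans _ _ (expR (- C))); first exact: expR_gt0.
rewrite -[leLHS](mean_cst (power_measure mu #|{: edge n}|)).
apply: le_mean; [bmf|exact: bounded_mfun_expR|move=> x].
by rewrite ler_expR; have := HC x; rewrite ler_norml => /andP[].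
Qed.

Record score_weights (a : forall n, weights R n -> edge n -> R) := ScoreWeights {
  score_weightsM : forall n e, measurable_fun setT ((@a n)^~ e);
  score_weights_set : forall n x e z, a n (set_weight x e z) e = a n x e;
  score_weights_bound : exists A : R, forall n (x : weights R n) e,
    in_box x -> `|a n x e| <= A;
  score_weights_lipschitz : exists L : R, forall n (x y : weights R n),
    in_box x -> in_box y ->
    \sum_e `|a n x e - a n y e| <= L * \sum_e `|weight x e - weight y e| }.

(* Since the residual at [e] is centred given the other weights, the cross terms of the
   second moment only see how the score changes when the weight of [e] is reset. *)
Lemma score_second_moment (a : forall n, weights R n -> edge n -> R) :
  score_weights a -> exists2 C : R, 0 < C & forall n,
  expect (fun x : weights R n => (\sum_e a n x e * residual x e) ^+ 2 *
     expR (edge_triangle_exponent beta h x)) <= C * num_edges R n * gibbs_partition n.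
Proof.
case=> ma aset [A0 aA0] [L0 aL0].
have r0 := support_radius_gt0 km_lt_kp.
pose A := Num.max 1 A0; pose L := Num.max 1 L0.
have A1 : 1 <= A by rewrite le_max lexx.
have L1 : 1 <= L by rewrite le_max lexx.
have aA n (x : weights R n) e : in_box x -> `|a n x e| <= A.
  by move=> bx; rewrite (le_trans (aA0 _ _ _ bx))// le_max lexx orbT.
have aL n (x y : weights R n) : in_box x -> in_box y ->
    \sum_e `|a n x e - a n y e| <= L * \sum_e `|weight x e - weight y e|.
  move=> bx by_; apply: le_trans (aL0 _ _ _ bx by_) _.
  by rewrite ler_wpM2r ?sumr_ge0// le_max lexx orbT.
pose M := `|beta| * (2 * r ^+ 2) + `|h|.
have [Lp Lp0 phiL] := tilted_mean_lipschitz mu km_lt_kp M.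
(* [B] bounds the change of the score when one weight is reset: the weights move by at most [2 * r]
   in l1, the local fields by at most [4 * r] times as much, and coefficients and residuals follow
   by their Lipschitz bounds. *)
pose B := 2 * r * (L * (2 * r)) + A * ((1 + Lp * `|beta| * (4 * r)) * (2 * r)).
have Apos : 0 < A := lt_le_trans ltr01 A1.
have Lpos : 0 < L := lt_le_trans ltr01 L1.
have B0 : 0 < B.
  have Lq : 0 <= Lp * `|beta| * (4 * r) by rewrite !mulr_ge0// ltW.
  have Lq1 : 0 < 1 + Lp * `|beta| * (4 * r) by rewrite ltr_wpDr.
  by rewrite /B addr_gt0// !mulr_gt0.
have prodB (a1 b1 a2 b2 : R) : a1 * b1 - a2 * b2 = b1 * (a1 - a2) + a2 * (b1 - b2) by ring.
have opprB4 (a1 b1 a2 b2 : R) : (a1 - b1) - (a2 - b2) = (a1 - a2) - (b1 - b2) by ring.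
have affB (b1 m1 m2 h1 : R) : b1 * m1 + h1 - (b1 * m2 + h1) = b1 * (m1 - m2) by ring.
have prodS (a1 b1 c1 c2 d1 : R) : a1 * b1 * c1 * d1 - b1 * (a1 * c2) * d1 =
  a1 * b1 * (c1 - c2) * d1 by ring.
exists (A * (2 * r) * B); first by rewrite !mulr_gt0// (lt_le_trans ltr01).
move=> n.
pose S (x : weights R n) := \sum_e a n x e * residual x e.
pose H := @edge_triangle_exponent R n beta h.
have bH : bounded_mfun (fun x => expR (H (clampt x))).
  exact/bounded_mfun_expR/bounded_mfun_exponent.
have ba e : bounded_mfun (fun x : weights R n => a n (clampt x) e).
  split; first by apply: (measurableT_comp (ma n e)); exact: measurable_clampt.
  by exists A => x; apply: aA; exact: in_box_clampt.
have bres e := @bounded_mfun_residual n e.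
have bS : bounded_mfun (fun x => S (clampt x)).
  by apply: bounded_mfun_sum => e; exact: bounded_mfunM.
have mS : measurable_fun setT S.
  apply: measurable_sum => e; apply: measurable_funM; first exact: ma.
  exact: measurable_residual.
have kmI : km <= km <= kp by rewrite lexx ltW.
(* The score with the weight of [e] frozen at [km]. As it ignores that weight, its product with the
   residual at [e] has mean zero under the Gibbs weight and can be subtracted freely. *)
pose S' e x := S (set_weight x e km).
have bS' e : bounded_mfun (fun x => S' e (clampt x)) by exact: bounded_mfun_set_weight.
have SS' e x : in_box x -> `|S x - S' e x| <= B.
  move=> bx; have by_ := in_box_set_weight e kmI bx; set y := set_weight x e km in by_.
  have wxy : \sum_f `|weight x f - weight y f| <= 2 * r.
    rewrite (bigD1 e)//= big1 => [|f /negbTE fe]; last by rewrite weight_set fe subrr normr0.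
    rewrite addr0 (le_trans (ler_normB _ _))// mulr2n mulrDl mul1r.
    by rewrite lerD ?norm_weight_le.
  rewrite /S' /S -sumrB; apply: le_trans (ler_norm_sum _ _ _) _.
  have lM (z : weights R n) f : in_box z -> `|beta * local_field z f + h| <= M.
    move=> bz; rewrite (le_trans (ler_normD _ _))// lerD2r normrM ler_wpM2l//.
    exact: (norm_local_field_le km_lt_kp).
  apply: (@le_trans _ _ (\sum_f (2 * r * `|a n x f - a n y f| + A * (`|weight x f - weight y f|
      + Lp * `|beta| * `|local_field x f - local_field y f|)))).
    apply: ler_sum => f _.
    have -> : a n x f * residual x f - a n y f * residual y f =
      residual x f * (a n x f - a n y f) + a n y f * (residual x f - residual y f).
      exact: prodB.
    apply: le_trans (ler_normD _ _) _; rewrite !normrM; apply: lerD.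
      by rewrite ler_wpM2r ?norm_residual_le.
    apply: ler_pM => //; first exact: aA.
    have -> : residual x f - residual y f = (weight x f - weight y f)
      - (phi (beta * local_field x f + h) - phi (beta * local_field y f + h)).
      exact: opprB4.
    apply: le_trans (ler_normB _ _) _; rewrite lerD2l.
    apply: le_trans (phiL _ _ (lM _ _ bx) (lM _ _ by_)) _.
    by rewrite -mulrA -normrM ler_wpM2l ?(ltW Lp0)//; apply: le_of_eq; congr `|_|; exact: affB.
  rewrite big_split/= -!mulr_sumr big_split/= -mulr_sumr /B; apply: lerD.
    rewrite ler_wpM2l ?mulr_ge0 ?(ltW r0)// (le_trans (aL _ _ _ bx by_))//.
    by rewrite ler_wpM2l// (le_trans ler01).
  rewrite ler_wpM2l ?(le_trans ler01)// mulrDl mul1r lerD//.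
  rewrite -[leRHS]mulrA ler_wpM2l ?mulr_ge0 ?(ltW Lp0)//.
  rewrite (le_trans (local_field_lipschitz km_lt_kp bx by_))//.
  by rewrite ler_wpM2l// mulr_ge0// ltW.
have term e : expect (fun x => a n x e * residual x e * S x * expR (H x)) <=
    A * (2 * r) * B * gibbs_partition n.
  have H0 := @expect_residual n (fun x => a n x e * S' e x) e.
  rewrite -[leLHS]subr0 -[X in _ - X <= _]H0; last 2 first.
    exact: (bounded_mfunM (ba e) (bS' e)).
    move=> x z; rewrite aset /S'; congr (_ * S _).
    apply: eq_from_tnth => j; rewrite !tnth_update; case: eqP => // _.
  have b1 := bounded_mfunM (bounded_mfunM (bounded_mfunM (ba e) (bres e)) bS) bH.
  have b2 := bounded_mfunM (bounded_mfunM (bres e) (bounded_mfunM (ba e) (bS' e))) bH.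
  rewrite /expect -(meanB _ b1 b2) /gibbs_partition /expect -meanZl//.
  apply: le_mean => [||x]; [exact: (bounded_mfunB b1 b2)|bmf|].
  set X := clampt x; have bX : in_box X := in_box_clampt km_lt_kp x.
  have -> : a n X e * residual X e * S X * expR (H X) -
      residual X e * (a n X e * S' e X) * expR (edge_triangle_exponent beta h X) =
     a n X e * residual X e * (S X - S' e X) * expR (H X) by exact: prodS.
  rewrite ler_wpM2r ?expR_ge0// (le_trans (ler_norm _))// !normrM.
  apply: ler_pM => //; last exact: SS'.
  by apply: ler_pM => //; [exact: aA|exact: norm_residual_le].
apply: (@le_trans _ _ (\sum_(e : edge n) A * (2 * r) * B * gibbs_partition n)); last first.
  by rewrite sum_edges_cst; apply: le_of_eq; ring.
apply: le_trans (ler_sum _ (fun e _ => term e)).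
have bt e := bounded_mfunM (bounded_mfunM (bounded_mfunM (ba e) (bres e)) bS) bH.
rewrite /expect -(mean_sum _ _ _ bt).
apply: le_of_eq; apply: eq_Rintegral => x _.
by rewrite -mulr_suml -mulr_suml expr2.
Qed.

Lemma score_chebyshev (a : forall n, weights R n -> edge n -> R) :
  score_weights a -> exists2 C : R, 0 < C & forall n K, 0 < K -> (1 < n)%N ->
  gibbs_prob km kp mu beta h
    [set x : weights R n | K ^+ 2 * num_edges R n < (\sum_e a n x e * residual x e) ^+ 2]
    <= C / K ^+ 2.
Proof.
move=> sa; have [C C0 HC] := score_second_moment sa; exists C => // n K K0 n1.
have Z0 := gibbs_partition_gt0 n; have N0 := num_edges_gt0 R n1.
have K20 : 0 < K ^+ 2 by rewrite exprn_gt0.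
case: sa => ma aset [A aA] _.
have mS : measurable_fun setT (fun x : weights R n => (\sum_e a n x e * residual x e) ^+ 2).
  apply: measurable_funX; apply: measurable_sum => e; apply: measurable_funM; first exact: ma.
  exact: measurable_residual.
have bS : bounded_mfun (fun x : weights R n =>
    \sum_e a n (clampt x) e * residual (clampt x) e).
  apply: bounded_mfun_sum => e; apply: bounded_mfunM; last exact: bounded_mfun_residual.
  split; first by apply: (measurableT_comp (ma n e)); exact: measurable_clampt.
  by exists A => x; apply: aA; exact: in_box_clampt.
have bI := bounded_mfun_indic_clampt km kp (measurable_superlevel (K ^+ 2 * num_edges R n) mS).
have bH := bounded_mfun_expR (@bounded_mfun_exponent R km kp km_lt_kp n beta h).
rewrite /gibbs_prob -/(gibbs_partition n) ler_pdivrMr// [leRHS]mulrAC ler_pdivlMr//.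
rewrite -(ler_pM2r N0) [leRHS]mulrAC; apply: le_trans _ (HC n); rewrite -mulrA mulrC.
rewrite /expect -meanZl; last exact: bounded_mfunM.
apply: le_mean => [||x]; [bmf|bmf|].
rewrite mulrA ler_wpM2r ?expR_ge0// indicE; case: (boolP (_ \in _)) => xI.
  by rewrite mulr1; move: xI; rewrite inE => /ltW.
by rewrite mulr0 sqr_ge0.
Qed.

Lemma score_weights1 : score_weights (fun n x e => 1).
Proof.
split=> //; first by exists 1 => *; rewrite normr1.
exists 0 => n x y _ _; rewrite mul0r big1// => e _.
by rewrite subrr normr0.
Qed.

Lemma score_weights_local_field : score_weights (@local_field R).
Proof.
split.
- exact: measurable_local_field.
- exact: local_field_set.
- by exists (2 * r ^+ 2) => n x e; exact: norm_local_field_le.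
- by exists (4 * r) => n x y; exact: local_field_lipschitz.
Qed.

End score.

(** * The pseudo-likelihood equations *)

Section quadratic_form.
Context (R : realType) (n : nat).
Hypothesis n1 : (1 < n)%N.
Local Notation N := (num_edges R n).
Variable x : weights R n.

Lemma sum_local_field : \sum_e local_field x e = N * mean_field x.
Proof. by rewrite /mean_field mulrA divff ?mul1r// gt_eqF// num_edges_gt0. Qed.

Lemma sum_sqr_local_field :
  \sum_e (local_field x e - mean_field x) ^+ 2 = N * field_variance x.
Proof. by rewrite /field_variance mulrA divff ?mul1r// gt_eqF// num_edges_gt0. Qed.

Lemma field_variance_ge0 : 0 <= field_variance x.
Proof.
by rewrite /field_variance mulr_ge0 ?invr_ge0 ?num_edges_ge0// sumr_ge0// => e _; rewrite sqr_ge0.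
Qed.

Lemma sum_sqr_affine (u v : R) :
  \sum_e (u * local_field x e + v) ^+ 2 =
  N * (u ^+ 2 * field_variance x + (u * mean_field x + v) ^+ 2).
Proof.
pose b := u * mean_field x + v.
transitivity (\sum_e (u ^+ 2 * (local_field x e - mean_field x) ^+ 2
   + (2 * u * b * local_field x e + (b ^+ 2 - 2 * u * b * mean_field x)))).
  by apply: eq_bigr => e _; rewrite /b; ring.
rewrite big_split big_split/= -!mulr_sumr sum_sqr_local_field sum_local_field sum_edges_cst.
by rewrite /b; ring.
Qed.

(** Lower bound on the quadratic form of second moments of the pair [(local_field, 1)]: the variance
    controls [u], the mean term controls [t = u * m + v], and [v = t - u * m] is recovered from both
    since [m] is bounded by [M]. *)
Lemma affine_coercive (c M u v : R) : 0 < c -> `|mean_field x| <= M -> c < field_variance x ->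
  N * (u ^+ 2 + v ^+ 2) <=
  (c^-1 + 2 + 2 * M ^+ 2 / c) * \sum_e (u * local_field x e + v) ^+ 2.
Proof.
move=> c0 mM cT; rewrite sum_sqr_affine mulrCA ler_wpM2l ?num_edges_ge0//.
set m := mean_field x in mM *; set t := u * m + v.
set q := u ^+ 2 * field_variance x + t ^+ 2.
have uq : u ^+ 2 <= c^-1 * q.
  rewrite mulrC ler_pdivlMr// /q; have := sqr_ge0 u; have := sqr_ge0 t; nra.
have mM2 : m ^+ 2 <= M ^+ 2.
  by rewrite -[m ^+ 2]real_normK ?num_real// lerXn2r ?nnegrE// (le_trans _ mM).
have M20 := sqr_ge0 M.
have tq : t ^+ 2 <= q.
  by rewrite /q lerDr mulr_ge0 ?sqr_ge0// ltW// (lt_trans c0).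
have vq : v ^+ 2 <= 2 * t ^+ 2 + 2 * (u ^+ 2 * M ^+ 2).
  have -> : v = t - u * m by rewrite /t; ring.
  have h1 : u ^+ 2 * m ^+ 2 <= u ^+ 2 * M ^+ 2 by rewrite ler_wpM2l ?sqr_ge0.
  by have := sqr_ge0 (t + u * m); nra.
have u2M : u ^+ 2 * M ^+ 2 <= M ^+ 2 / c * q.
  have -> : M ^+ 2 / c * q = (c^-1 * q) * M ^+ 2 by ring.
  by rewrite ler_wpM2r.
have -> : (c^-1 + 2 + 2 * M ^+ 2 / c) * q = c^-1 * q + (2 * q + 2 * (M ^+ 2 / c * q)) by ring.
lra.
Qed.

End quadratic_form.

Section pseudo_likelihood.
Context (R : realType) (km kp : R) (mu : probability (measurableTypeR R) R).
Hypothesis km_lt_kp : km < kp.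
Hypothesis mu_itv : mu [set z : R | km <= z <= kp] = 1%E.
Hypothesis km_supp : measure_support mu km.
Hypothesis kp_supp : measure_support mu kp.
Local Notation r := (support_radius km kp).
Local Notation phi := (tilted_mean km kp mu).
Local Notation Lam := (cumulant mu).
Local Notation in_box := (in_box km kp).

Lemma continuous_cumulant : continuous Lam.
Proof.
move=> l; apply: differentiable_continuous; apply/derivable1_diffP.
by have [] := is_derive_cumulant km_lt_kp mu_itv l.
Qed.

Definition linear_field n (x : weights R n) (p : R * R) e := p.1 * local_field x e + p.2.

Definition neg_pseudo_likelihood n (x : weights R n) (p : R * R) : R :=
  \sum_e (Lam (linear_field x p e) - weight x e * linear_field x p e).

(** Directional derivative of [neg_pseudo_likelihood] at [p] along [d]; it vanishes for all [d]
    exactly at the solutions of the pseudo-likelihood equations. *)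
Definition pl_gradient n (x : weights R n) (p d : R * R) : R :=
  \sum_e linear_field x d e * (phi (linear_field x p e) - weight x e).

Lemma continuous_neg_pseudo_likelihood n (x : weights R n) :
  continuous (neg_pseudo_likelihood x : R^o * R^o -> R^o).
Proof.
move=> p; rewrite /neg_pseudo_likelihood.
apply: cvg_big => [|e _]; first exact: add_continuous.
have cl : linear_field x q e @[q --> p] --> linear_field x p e.
  by apply: cvgD; [apply: cvgMr_tmp; exact: cvg_fst|exact: cvg_snd].
apply: cvgB; last exact: cvgMl_tmp.
by apply: (cvg_comp _ _ cl); exact: continuous_cumulant.
Qed.

Lemma pl_eqsE n (x : weights R n) beta h : pseudo_likelihood_eqs mu x beta h <->
  (forall d, pl_gradient x (beta, h) d = 0).
Proof.
have E d : pl_gradient x (beta, h) d =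
   - (d.1 * \sum_(e : edge n) local_field x e *
       (weight x e - derive1 Lam (beta * local_field x e + h))
     + d.2 * \sum_(e : edge n) (weight x e - derive1 Lam (beta * local_field x e + h))).
  rewrite !mulr_sumr -big_split -sumrN; apply: eq_bigr => e _ /=.
  by rewrite (derive1_cumulant km_lt_kp mu_itv) /linear_field /=; ring.
split=> [[E1 E2] d|G]; first by rewrite E E1 E2 !mulr0 addr0 oppr0.
split.
  by have := G (1, 0); rewrite E /= mul1r mul0r addr0 => /eqP; rewrite oppr_eq0 => /eqP.
by have := G (0, 1); rewrite E /= mul1r mul0r add0r => /eqP; rewrite oppr_eq0 => /eqP.
Qed.

Lemma pl_gradientB n (x : weights R n) (p q d : R * R) :
  pl_gradient x q d - pl_gradient x p d =
  \sum_e linear_field x d e * (phi (linear_field x q e) - phi (linear_field x p e)).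
Proof. by rewrite -sumrB; apply: eq_bigr => e _; ring. Qed.

Lemma linear_fieldD n (x : weights R n) p t d e :
  linear_field x (p.1 + t * d.1, p.2 + t * d.2) e = linear_field x p e + t * linear_field x d e.
Proof. by rewrite /linear_field /=; ring. Qed.

(* Convexity of the cumulant bounds the increment of the objective by the gradient at
   the endpoint. *)
Lemma neg_pl_increment n (x : weights R n) (p d : R * R) t :
  neg_pseudo_likelihood x (p.1 + t * d.1, p.2 + t * d.2) - neg_pseudo_likelihood x p <=
  t * pl_gradient x (p.1 + t * d.1, p.2 + t * d.2) d.
Proof.
rewrite /neg_pseudo_likelihood -sumrB mulr_sumr; apply: ler_sum => e _.
rewrite linear_fieldD; set a := linear_field x p e; set b := linear_field x d e.
have := cumulant_convex km_lt_kp mu_itv (a + t * b) a.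
set q := a + t * b; have -> : a - q = - (t * b) by rewrite /q; ring.
move=> H; have -> : t * (b * (phi q - weight x e)) = t * b * phi q - weight x e * (q - a).
  by rewrite /q; ring.
have -> : Lam q - weight x e * q - (Lam a - weight x e * a) =
    (Lam q - Lam a) - weight x e * (q - a) by ring.
by rewrite lerD2r -lerN2 opprB -mulNr.
Qed.

Lemma linear_field_bound n (x : weights R n) p e : in_box x ->
  `|linear_field x p e| <= `|p.1| * (2 * r ^+ 2) + `|p.2|.
Proof.
move=> bx; rewrite (le_trans (ler_normD _ _))// lerD2r normrM ler_wpM2l//.
exact: (norm_local_field_le km_lt_kp).
Qed.

(** First-order condition at a minimum along a segment. Were the gradient [g] negative, it would
    remain negative at a nearby point of the segment because [phi] is Lipschitz, whereas minimality
    and the increment bound make it non-negative there. *)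
Lemma pl_gradient_ge0 n (x : weights R n) (p d : R * R) : in_box x ->
  (forall t, 0 < t -> t <= 1 ->
     neg_pseudo_likelihood x p <= neg_pseudo_likelihood x (p.1 + t * d.1, p.2 + t * d.2)) ->
  0 <= pl_gradient x p d.
Proof.
move=> bx Fmin; rewrite leNgt; apply/negP => G0.
pose M (q : R * R) : R := `|q.1| * (2 * r ^+ 2) + `|q.2|.
have [L L0 phiL] := tilted_mean_lipschitz mu km_lt_kp (M p + M d).
pose K := \sum_(e : edge n) L * linear_field x d e ^+ 2.
have K0 : 0 <= K by rewrite sumr_ge0// => e _; rewrite mulr_ge0 ?sqr_ge0 ?(ltW L0).
set g := pl_gradient x p d in G0.
(* Chosen so that [t * K <= - g / 2]: the gradient at [p + t d] is then at most [g / 2]. *)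
pose t := Num.min 1 (- g / (2 * (K + 1))).
have K1 : 0 < 2 * (K + 1) by rewrite mulr_gt0// ltr_wpDl.
have t0 : 0 < t by rewrite lt_min ltr01 divr_gt0// oppr_gt0.
have t1 : t <= 1 by rewrite ge_min lexx.
have tK : t * K <= - g / 2.
  have : t <= - g / (2 * (K + 1)) by rewrite ge_min lexx orbT.
  by rewrite ler_pdivlMr//; nra.
have := neg_pl_increment x p d t; have := Fmin t t0 t1.
set q := (p.1 + t * d.1, p.2 + t * d.2) => Fq Fi.
have gq0 : 0 <= pl_gradient x q d.
  by rewrite -(pmulr_rge0 _ t0); apply: le_trans Fi; rewrite subr_ge0.
suff : pl_gradient x q d - g <= t * K by lra.
rewrite /g pl_gradientB /K mulr_sumr; apply: ler_sum => e _.
apply: le_trans (ler_norm _) _; rewrite normrM.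
have := phiL (linear_field x q e) (linear_field x p e).
have -> : linear_field x q e - linear_field x p e = t * linear_field x d e.
  by rewrite /q linear_fieldD; ring.
move=> H.
apply: (@le_trans _ _ (`|linear_field x d e| * (L * `|t * linear_field x d e|))).
  rewrite ler_wpM2l//; apply: H.
    rewrite /q linear_fieldD; apply: le_trans (ler_normD _ _) _.
    rewrite lerD ?linear_field_bound// normrM.
    by rewrite (ger0_norm (ltW t0)) -[leRHS]mul1r ler_pM ?linear_field_bound// ltW.
  by rewrite (le_trans (linear_field_bound _ _ bx))// lerDl addr_ge0// mulr_ge0// mulr_ge0 ?sqr_ge0.
rewrite normrM (ger0_norm (ltW t0)) -[linear_field x d e ^+ 2]real_normK ?num_real//.
by apply: le_of_eq; ring.
Qed.

(** Strong monotonicity of [phi] with constant [k] is applied edge by edge, and coercivity turns the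
    sum of squares of the linear field into the squared distance of the parameters. The resulting
    constant [k / D] depends neither on [n] nor on the weights. *)
Lemma pl_gradient_mono c C : 0 < c -> exists2 k : R, 0 < k & forall n (x : weights R n) p q,
  (1 < n)%N -> in_box x -> c < field_variance x ->
  (forall e, `|linear_field x p e| <= C) -> (forall e, `|linear_field x q e| <= C) ->
  k * (num_edges R n * ((q.1 - p.1) ^+ 2 + (q.2 - p.2) ^+ 2)) <=
  pl_gradient x q (q.1 - p.1, q.2 - p.2) - pl_gradient x p (q.1 - p.1, q.2 - p.2).
Proof.
move=> c0; have [k k0 Hk] := tilted_mean_strong_mono km_lt_kp km_supp kp_supp C.
pose D : R := c^-1 + 2 + 2 * (2 * r ^+ 2) ^+ 2 / c.
have D0 : 0 < D.
  rewrite /D ltr_wpDr//; last by rewrite addr_gt0 ?invr_gt0.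
  by apply: divr_ge0; rewrite ?(ltW c0)// mulr_ge0 ?sqr_ge0.
exists (k / D); first by rewrite divr_gt0.
move=> n x p q n1 bx cT pC qC; set d := (q.1 - p.1, q.2 - p.2).
have dE e : linear_field x d e = linear_field x q e - linear_field x p e.
  by rewrite /linear_field /d /=; ring.
have mM := norm_mean_field_le km_lt_kp bx.
have H := affine_coercive n1 d.1 d.2 c0 mM cT; rewrite -/D in H.
rewrite pl_gradientB mulrAC ler_pdivrMr//.
apply: le_trans (ler_wpM2l (ltW k0) H) _; rewrite mulrCA [leRHS]mulrC ler_wpM2l ?(ltW D0)//.
rewrite mulr_sumr; apply: ler_sum => e _.
by rewrite -/(linear_field x d e) dE; exact: Hk.
Qed.

Lemma pl_eqs_unique n (x : weights R n) p q : (1 < n)%N -> in_box x ->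
  0 < field_variance x -> pseudo_likelihood_eqs mu x p.1 p.2 ->
  pseudo_likelihood_eqs mu x q.1 q.2 -> q = p.
Proof.
move=> n1 bx T0; rewrite !pl_eqsE -!surjective_pairing => Gp Gq.
pose M (q : R * R) : R := `|q.1| * (2 * r ^+ 2) + `|q.2|.
(* Half the variance serves as the strict lower bound that [pl_gradient_mono] asks for. *)
have T20 : 0 < field_variance x / 2 by rewrite divr_gt0.
have [k k0 H] := pl_gradient_mono (Num.max (M p) (M q)) T20.
have T2 : field_variance x / 2 < field_variance x by rewrite ltr_pdivrMr// ltr_pMr// ltr1n.
have pC e : `|linear_field x p e| <= Num.max (M p) (M q) by rewrite le_max linear_field_bound.
have qC e : `|linear_field x q e| <= Num.max (M p) (M q).
  by rewrite le_max linear_field_bound ?orbT.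
have {H} := H _ x p q n1 bx T2 pC qC.
rewrite Gp Gq subrr.
rewrite pmulr_rle0// pmulr_rle0 ?num_edges_gt0// => H.
  have h1 := sqr_ge0 (q.1 - p.1); have h2 := sqr_ge0 (q.2 - p.2).
  have /eqP : (q.1 - p.1) ^+ 2 = 0 by apply/eqP; rewrite eq_le h1 andbT; lra.
  have /eqP : (q.2 - p.2) ^+ 2 = 0 by apply/eqP; rewrite eq_le h2 andbT; lra.
  rewrite !sqrf_eq0 !subr_eq0 => /eqP e2 /eqP e1.
  by rewrite [q]surjective_pairing e1 e2 -surjective_pairing.
Qed.

(* The objective is minimized over a square around the true parameter; strong
   monotonicity of the gradient keeps the minimizer away from the boundary. *)
Lemma mple_near c beta0 h0 : 0 < c -> exists K s0 : R, [/\ 0 < K, 0 < s0 &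
  forall n (x : weights R n) s, (1 < n)%N -> in_box x -> c < field_variance x ->
  0 <= s -> s <= s0 ->
  `|\sum_e local_field x e * (weight x e - phi (beta0 * local_field x e + h0))|
     <= s * num_edges R n ->
  `|\sum_e (weight x e - phi (beta0 * local_field x e + h0))| <= s * num_edges R n ->
  exists beta h, is_mple mu x beta h /\ Num.max `|beta - beta0| `|h - h0| <= K * s].
Proof.
move=> c0.
pose C := (`|beta0| + 1) * (2 * r ^+ 2) + (`|h0| + 1).
have [k k0 Hk] := pl_gradient_mono C c0.
(* For [s <= k / 4] the distance bound [2 / k * s] is at most 1/2, so the minimizer over the square
   of half-side 1 is interior. *)
exists (2 / k), (k / 4); split; rewrite ?divr_gt0//.
move=> n x s n1 bx cT s_ge0 s_le score1 score2.
have N0 := num_edges_gt0 R n1.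
pose A := (`[beta0 - 1, beta0 + 1] `*` `[h0 - 1, h0 + 1])%classic : set (R^o * R^o).
have AP (b h : R) : A (b, h) <-> `|b - beta0| <= 1 /\ `|h - h0| <= 1.
  rewrite /A /= !in_itv /= !ler_distl.
  by split => [[-> ->]|[-> ->]].
have [|||[b1 h1] p1A p1min] := @compact_EVT_min (R^o * R^o)%type R (neg_pseudo_likelihood x) A.
- by exists (beta0, h0); apply/AP; rewrite !subrr normr0.
- by apply: compact_setX; exact: segment_compact.
- by apply: continuous_subspaceT => q; exact: continuous_neg_pseudo_likelihood.
move: p1A; rewrite inE AP => -[bb hh].
pose p0 := (beta0, h0); pose p1 := (b1, h1).
have lin_bound (p : R * R) e : `|p.1 - beta0| <= 1 -> `|p.2 - h0| <= 1 ->
    `|linear_field x p e| <= C.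
  have norm_shift (y y0 : R) : `|y - y0| <= 1 -> `|y| <= `|y0| + 1.
    by move=> yy; rewrite -[X in `|X|](subrK y0) addrC (le_trans (ler_normD _ _))// lerD2l.
  move=> h1' h2'; rewrite (le_trans (linear_field_bound _ _ bx))// lerD ?norm_shift//.
  by rewrite ler_wpM2r ?norm_shift// mulr_ge0 ?sqr_ge0.
pose a := Num.max `|b1 - beta0| `|h1 - h0|.
have a0 : 0 <= a by rewrite le_max normr_ge0.
have a1 : a <= 1 by rewrite ge_max bb hh.
have segment_min (d : R * R) : (forall t, 0 < t -> t <= 1 -> A (b1 + t * d.1, h1 + t * d.2)) ->
    0 <= pl_gradient x p1 d.
  move=> Ad; apply: pl_gradient_ge0 => // t t0 t1.
  by apply: p1min; rewrite inE; exact: Ad.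
(* The segment from the minimizer to the true parameter stays in the square, so the gradient at [p1]
   along [d = p1 - p0] is at most 0. Strong monotonicity then gives
   [k * N * a ^ 2 <= - pl_gradient x p0 d], and the score bounds make the right-hand side at most
   [2 * a * s * N]. *)
have a_le : a <= 2 / k * s.
  pose d := (b1 - beta0, h1 - h0).
  have G0 : pl_gradient x p1 d <= 0.
    rewrite -oppr_ge0; have -> : - pl_gradient x p1 d = pl_gradient x p1 (- d.1, - d.2).
      by rewrite /pl_gradient -sumrN; apply: eq_bigr => e _; rewrite /linear_field /=; ring.
    apply: segment_min => t t0 t1; apply/AP.
    have tt : 0 <= 1 - t by rewrite subr_ge0.
    have tt1 : 1 - t <= 1 by rewrite gerBl ltW.
    split.
      have -> : b1 + t * - (b1 - beta0) - beta0 = (1 - t) * (b1 - beta0) by ring.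
      by rewrite normrM ger0_norm// mulr_ile1.
    have -> : h1 + t * - (h1 - h0) - h0 = (1 - t) * (h1 - h0) by ring.
    by rewrite normrM ger0_norm// mulr_ile1.
  have p0C e : `|linear_field x p0 e| <= C by apply: lin_bound; rewrite subrr normr0.
  have p1C e : `|linear_field x p1 e| <= C by exact: lin_bound.
  have := Hk n x p0 p1 n1 bx cT p0C p1C.
  rewrite [_.1 - _]/(b1 - beta0) [_.2 - _]/(h1 - h0) -/d => mono.
  set S1 := \sum_e _ * _ in score1; set S2 := \sum_e _ in score2.
  have G1 : pl_gradient x p0 d = - ((b1 - beta0) * S1 + (h1 - h0) * S2).
    rewrite /pl_gradient /S1 /S2 !mulr_sumr -big_split -sumrN; apply: eq_bigr => e _.
    by rewrite /linear_field /=; ring.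
  have sN0 : 0 <= s * num_edges R n by rewrite mulr_ge0// ltW.
  have G2 : - pl_gradient x p0 d <= 2 * a * (s * num_edges R n).
    rewrite G1 opprK (le_trans (ler_norm _))// (le_trans (ler_normD _ _))// !normrM.
    rewrite -mulrA mulr2n mulrDl mul1r; apply: lerD; apply: ler_pM => //.
      by rewrite le_max lexx.
    by rewrite le_max lexx orbT.
  have a2 : a ^+ 2 <= (b1 - beta0) ^+ 2 + (h1 - h0) ^+ 2.
    rewrite /a; case: (leP `|b1 - beta0| `|h1 - h0|) => _; rewrite real_normK ?num_real//.
      by rewrite lerDr sqr_ge0.
    by rewrite lerDl sqr_ge0.
  have : a * (k * a) <= a * (2 * s).
    rewrite -(ler_pM2r N0); apply: le_trans (_ : _ <= 2 * a * (s * num_edges R n)) _; last first.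
      by apply: le_of_eq; ring.
    apply: le_trans G2; apply: (@le_trans _ _ (k * (num_edges R n * a ^+ 2))).
      by apply: le_of_eq; ring.
    apply: le_trans (_ : _ <= k * (num_edges R n * ((b1 - beta0) ^+ 2 + (h1 - h0) ^+ 2))) _.
      by rewrite ler_pM2l// ler_pM2l.
    by apply: le_trans mono _; rewrite -[leRHS]add0r lerD2r.
  have [<-|aN0] := eqVneq 0 a; first by rewrite mulr_ge0 ?divr_ge0// ltW.
  by rewrite ler_pM2l ?lt_def 1?eq_sym ?aN0// mulrAC ler_pdivlMr// mulrC.
have a_half : a <= 1 / 2.
  apply: le_trans a_le _; apply: (@le_trans _ _ (2 / k * (k / 4))).
    by rewrite ler_wpM2l// divr_ge0// ltW.
  by apply: le_of_eq; field; rewrite gt_eqF.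
have bb2 : `|b1 - beta0| <= 1 / 2 by apply: le_trans a_half; rewrite le_max lexx.
have hh2 : `|h1 - h0| <= 1 / 2 by apply: le_trans a_half; rewrite le_max lexx orbT.
(* Around an interior minimizer every direction is admissible once scaled down to length at most
   1/2; using [d] and [- d] gives a critical point. *)
have grad_ge0 (d : R * R) : 0 <= pl_gradient x p1 d.
  pose delta : R := (2 * (`|d.1| + `|d.2| + 1))^-1.
  have D0 : 0 < `|d.1| + `|d.2| + 1 by rewrite ltr_wpDl// addr_ge0.
  have delta0 : 0 < delta by rewrite invr_gt0 mulr_gt0.
  have dd (t y : R) : 0 < t -> t <= 1 -> `|y| <= `|d.1| + `|d.2| + 1 -> `|t * (delta * y)| <= 1 / 2.
    move=> t0 t1 yD; rewrite !normrM (gtr0_norm t0) (gtr0_norm delta0).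
    apply: le_trans (_ : _ <= 1 * (delta * (`|d.1| + `|d.2| + 1))) _.
      by apply: ler_pM => //; [exact: ltW|rewrite mulr_ge0// ltW|rewrite ler_pM2l].
    by apply: le_of_eq; rewrite /delta; field; rewrite gt_eqF.
  have := segment_min (delta * d.1, delta * d.2).
  have -> : pl_gradient x p1 (delta * d.1, delta * d.2) = delta * pl_gradient x p1 d.
    by rewrite /pl_gradient mulr_sumr; apply: eq_bigr => e _; rewrite /linear_field /=; ring.
  rewrite (pmulr_rge0 _ delta0); apply => t t0 t1; apply/AP => /=; split.
    rewrite addrAC (le_trans (ler_normD _ _))//.
    have := dd t d.1 t0 t1; rewrite -addrA lerDl addr_ge0// => /(_ isT); lra.
  rewrite addrAC (le_trans (ler_normD _ _))//.
  have := dd t d.2 t0 t1; rewrite (addrC `|d.1|) -addrA lerDl addr_ge0// => /(_ isT); lra.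
exists b1, h1; split; last exact: a_le.
have eqs : pseudo_likelihood_eqs mu x b1 h1.
  apply/pl_eqsE => d; apply/eqP; rewrite eq_le grad_ge0 andbT -oppr_ge0.
  have -> : - pl_gradient x (b1, h1) d = pl_gradient x p1 (- d.1, - d.2).
    by rewrite /pl_gradient -sumrN; apply: eq_bigr => e _; rewrite /linear_field /=; ring.
  exact: grad_ge0.
split=> // b' h' eqs'.
by have [-> ->] := @pl_eqs_unique n x (b1, h1) (b', h') n1 bx (lt_trans c0 cT) eqs eqs'.
Qed.

End pseudo_likelihood.

(** * Cut norm *)

Section cut_norm.
Context (R : realType) (n : nat).
Implicit Types (D : 'I_n -> 'I_n -> R) (u v : {ffun 'I_n -> bool}).

Definition sign_of u i : R := (-1) ^+ u i.

Definition cut_form D u v : R := \sum_i \sum_j D i j * (sign_of u i * sign_of v j).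

(** The norm from l-infinity to l1, equivalent to the cut norm. Testing on sign vectors only leaves
    finitely many constraints, all linear in [D]. *)
Definition cut_le D (B : R) := forall u v, `|cut_form D u v| <= B.

Lemma cut_form_neg D u v : cut_form D [ffun i => ~~ u i] v = - cut_form D u v.
Proof.
rewrite /cut_form -sumrN; apply: eq_bigr => i _; rewrite -sumrN; apply: eq_bigr => j _.
by rewrite /sign_of ffunE signrN; ring.
Qed.

(** A bounded vector does no better than signs: [v] takes the signs of the column sums [c], then [u]
    those of the row sums [d], and the form at [u], [v] equals the l1 norm of [d]. *)
Lemma cut_le_bilinear D B (a b : 'I_n -> R) alpha gamma : cut_le D B -> 0 <= alpha ->
  0 <= gamma -> (forall i, `|a i| <= alpha) -> (forall j, `|b j| <= gamma) ->
  `|\sum_i \sum_j D i j * (a i * b j)| <= alpha * gamma * B.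
Proof.
move=> DB al0 ga0 aA bG.
pose c j := \sum_i D i j * a i.
pose v : {ffun 'I_n -> bool} := [ffun j => c j < 0].
pose d i := \sum_j D i j * sign_of v j.
pose u : {ffun 'I_n -> bool} := [ffun i => d i < 0].
have -> : \sum_i \sum_j D i j * (a i * b j) = \sum_j b j * c j.
  rewrite exchange_big; apply: eq_bigr => j _; rewrite mulr_sumr.
  by apply: eq_bigr => i _; ring.
have cE : \sum_j `|c j| = \sum_i a i * d i.
  transitivity (\sum_j sign_of v j * c j).
    by apply: eq_bigr => j _; rewrite normrEsign /sign_of ffunE.
  under eq_bigr do rewrite mulr_sumr.
  rewrite exchange_big; apply: eq_bigr => i _; rewrite mulr_sumr.
  by apply: eq_bigr => j _; ring.
have dE : \sum_i `|d i| = cut_form D u v.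
  apply: eq_bigr => i _; rewrite normrEsign mulr_sumr; apply: eq_bigr => j _.
  by rewrite /sign_of !ffunE; ring.
have d_le : \sum_i `|d i| <= B by rewrite dE (le_trans (ler_norm _) (DB u v)).
have c_le : \sum_j `|c j| <= alpha * B.
  rewrite cE; apply: le_trans (_ : _ <= alpha * \sum_i `|d i|) _; last by rewrite ler_wpM2l.
  rewrite mulr_sumr; apply: ler_sum => i _.
  by rewrite (le_trans (ler_norm _))// normrM ler_wpM2r.
apply: le_trans (ler_norm_sum _ _ _) _.
apply: le_trans (_ : _ <= gamma * \sum_j `|c j|) _.
  by rewrite mulr_sumr; apply: ler_sum => j _; rewrite normrM ler_wpM2r.
by rewrite (mulrC alpha) -mulrA ler_wpM2l.
Qed.

Local Notation cut_step := (option ({ffun 'I_n -> bool} * {ffun 'I_n -> bool})).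

(** The coefficient of every step is [eps] and [None] pads the list to length [k], so for given
    [eps] and [k] the step matrices are indexed by a finite type. *)
Definition step_matrix (eps : R) (l : seq cut_step) (i j : 'I_n) : R :=
  \sum_(o <- l) if o is Some p then eps * (sign_of p.1 i * sign_of p.2 j) else 0.

Lemma sign_of_sqr u i : sign_of u i ^+ 2 = 1.
Proof. by rewrite /sign_of sqrr_sign. Qed.

(* Energy decrement: subtracting [eps] times a sign rectangle on which the form exceeds
   [eps * n ^ 2] lowers the squared norm by at least [eps ^ 2 * n ^ 2]. *)
Lemma weak_regularity (eps : R) k D : 0 < eps ->
  \sum_i \sum_j D i j ^+ 2 <= k%:R * (eps ^+ 2 * n%:R ^+ 2) ->
  exists l : k.-tuple cut_step,
    cut_le (fun i j => D i j - step_matrix eps l i j) (eps * n%:R ^+ 2).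
Proof.
move=> eps0; have E0 : 0 <= eps * n%:R ^+ 2 by rewrite mulr_ge0 ?sqr_ge0 ?ltW.
(* Flipping all signs of [u] negates the form. It is thus enough to remove violations from above,
   always with coefficient [+ eps]. *)
have oneside D' : (forall u v, cut_form D' u v <= eps * n%:R ^+ 2) ->
    cut_le D' (eps * n%:R ^+ 2).
  move=> H u v; rewrite ler_norml H andbT lerNl -cut_form_neg; exact: H.
suff : \sum_i \sum_j D i j ^+ 2 <= k%:R * (eps ^+ 2 * n%:R ^+ 2) ->
  exists l : k.-tuple cut_step, forall u v,
    cut_form (fun i j => D i j - step_matrix eps l i j) u v <= eps * n%:R ^+ 2.
  by move=> H /H[l Hl]; exists l; exact: oneside.
have ext D1 D2 u v : (forall i j, D1 i j = D2 i j) -> cut_form D1 u v = cut_form D2 u v.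
  by move=> DD; apply: eq_bigr => i _; apply: eq_bigr => j _; rewrite DD.
elim: k D => [|k IH] D DE.
  exists [tuple] => u v; rewrite (ext _ (fun _ _ => 0)) => [|i j].
    by rewrite /cut_form big1// => i _; rewrite big1// => j _; rewrite mul0r.
  rewrite /step_matrix big_nil subr0; apply/eqP.
  rewrite -sqrf_eq0 eq_le sqr_ge0 andbT.
  rewrite mul0r in DE; apply: le_trans DE.
  rewrite (bigD1 i)//= (bigD1 j)//= -addrA lerDl addr_ge0// sumr_ge0// => i' _.
    by rewrite sqr_ge0.
  by rewrite sumr_ge0// => j' _; rewrite sqr_ge0.
case: (boolP [exists u, exists v, eps * n%:R ^+ 2 < cut_form D u v]) => [|noviol].
  case/existsP => u /existsP[v viol].
  pose D' i j := D i j - eps * (sign_of u i * sign_of v j).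
  have [l Hl] : exists l : k.-tuple cut_step, forall u v,
      cut_form (fun i j => D' i j - step_matrix eps l i j) u v <= eps * n%:R ^+ 2.
    apply: IH.
    have -> : \sum_i \sum_j D' i j ^+ 2 =
        \sum_i \sum_j D i j ^+ 2 - 2 * eps * cut_form D u v + eps ^+ 2 * n%:R ^+ 2.
      have -> : eps ^+ 2 * n%:R ^+ 2 = \sum_(i < n) \sum_(j < n) eps ^+ 2.
        by under eq_bigr do rewrite sum_ord_const; rewrite sum_ord_const; ring.
      rewrite /cut_form mulr_sumr -sumrB -big_split; apply: eq_bigr => i _.
      rewrite mulr_sumr -sumrB -big_split; apply: eq_bigr => j _ /=.
      rewrite /D'; have := sign_of_sqr u i; have := sign_of_sqr v j.
      set a := sign_of u i; set b := sign_of v j => b2 a2.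
      transitivity (D i j ^+ 2 - 2 * eps * (D i j * (a * b)) + eps ^+ 2 * (a ^+ 2 * b ^+ 2)).
        by ring.
      by rewrite a2 b2 !mulr1.
    have : 2 * eps * (eps * n%:R ^+ 2) <= 2 * eps * cut_form D u v.
      by rewrite ler_pM2l ?mulr_gt0// ltW.
    move: DE; rewrite -natr1 mulrDl mul1r; lra.
  exists [tuple of Some (u, v) :: l] => u' v'; apply: le_trans (Hl u' v').
  apply: le_of_eq; apply: ext => i j.
  by rewrite /step_matrix /= big_cons /D' opprD addrA.
exists [tuple of nseq k.+1 None] => u v.
rewrite (ext _ D) => [|i j]; last first.
  have step0 m : step_matrix eps (nseq m None) i j = 0.
    by rewrite /step_matrix; elim: m => [|m IHm]; rewrite ?big_nil//= big_cons add0r.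
  by rewrite (step0 k.+1) subr0.
rewrite leNgt; apply/negP => viol; move/negP: noviol; apply.
by apply/existsP; exists u; apply/existsP; exists v.
Qed.

End cut_norm.

(** * Continuity of the local fields, the exponent and the field variance in cut norm *)

Section cut_lipschitz.
Context (R : realType) (km kp : R).
Hypothesis km_lt_kp : km < kp.
Local Notation r := (support_radius km kp).
Local Notation in_box := (in_box km kp).
Context (n : nat).
Local Notation N := (num_edges R n).
Variables (x y : weights R n) (B : R).
Hypotheses (bx : in_box x) (by_ : in_box y).
Hypothesis cut : cut_le (fun i j => adj x i j - adj y i j) B.

Let r0 : 0 <= r. Proof. exact/ltW/support_radius_gt0. Qed.
Let D i j := adj x i j - adj y i j.
Let ax i j : `|adj x i j| <= r. Proof. exact: (norm_adj_le km_lt_kp). Qed.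
Let ay i j : `|adj y i j| <= r. Proof. exact: (norm_adj_le km_lt_kp). Qed.

(** The absolute values are written with signs [s i j]. After changing one factor at a time, each
    sum is, for one vertex held fixed, a bilinear form in [D] with bounded coefficients; the sign
    then depends on one free index only. *)
Lemma cut_local_field : \sum_e `|local_field x e - local_field y e| <= 2 * r * B.
Proof.
case: (posnP n) => [n0|n0].
  have e0 (e : edge n) : False.
    by have [i _] := edgeP e; have := ltn_ord i; rewrite {2}n0.
  rewrite big1 => [|e]; last by case: (e0 e).
  have B0 := cut [ffun=> true] [ffun=> true].
  by rewrite !mulr_ge0// (le_trans _ B0).
have n0' : 0 < n%:R :> R by rewrite ltr0n.
pose s i j : R := (-1) ^+ (matrix_field x i j - matrix_field y i j < 0)%R.
have s1 i j : `|s i j| = 1 by rewrite /s normr_sign.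
have H : 2 * \sum_e `|local_field x e - local_field y e| <=
    \sum_i \sum_j `|matrix_field x i j - matrix_field y i j|.
  by apply: sum_edges_le => // e i j eE; rewrite (local_fieldE x eE) (local_fieldE y eE).
have E : \sum_i \sum_j `|matrix_field x i j - matrix_field y i j| =
    2 / n%:R * (\sum_j \sum_i \sum_k D i k * (s i j * adj x k j)
      + \sum_i \sum_k \sum_j D k j * (adj y i k * s i j)).
  have -> : \sum_j \sum_i \sum_k D i k * (s i j * adj x k j) =
      \sum_i \sum_j \sum_k D i k * (s i j * adj x k j) by exact: exchange_big.
  have -> : \sum_i \sum_k \sum_j D k j * (adj y i k * s i j) =
      \sum_i \sum_j \sum_k D k j * (adj y i k * s i j).
    by apply: eq_bigr => i _; exact: exchange_big.
  rewrite -big_split mulr_sumr; apply: eq_bigr => i _.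
  rewrite -big_split mulr_sumr; apply: eq_bigr => j _ /=.
  rewrite normrEsign -/(s i j) /matrix_field -mulrBr -sumrB mulrCA -big_split /=; congr (_ * _).
  by rewrite mulr_sumr; apply: eq_bigr => k _; rewrite /D; ring.
have b1 : \sum_j \sum_i \sum_k D i k * (s i j * adj x k j) <= n%:R * (r * B).
  rewrite -[n in leRHS]card_ord mulr_natl -sumr_const; apply: ler_sum => j _.
  rewrite -[r]mul1r; apply: le_trans (ler_norm _) _.
  by apply: (cut_le_bilinear cut) => // i; rewrite s1.
have b2 : \sum_i \sum_k \sum_j D k j * (adj y i k * s i j) <= n%:R * (r * B).
  rewrite -[n in leRHS]card_ord mulr_natl -sumr_const; apply: ler_sum => i _.
  rewrite -[r]mulr1; apply: le_trans (ler_norm _) _.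
  by apply: (cut_le_bilinear cut) => // j; rewrite s1.
rewrite -(@ler_pM2l _ 2)//; apply: le_trans H _; rewrite E.
apply: le_trans (_ : _ <= 2 / n%:R * (n%:R * (r * B) + n%:R * (r * B))) _.
  by rewrite ler_wpM2l ?divr_ge0// lerD.
by apply: le_of_eq; field; rewrite gt_eqF.
Qed.

Lemma cut_sum_weights : `|\sum_e weight x e - \sum_e weight y e| <= B / 2.
Proof.
have : `|\sum_i \sum_j D i j * (1 * 1)| <= 1 * 1 * B.
  by apply: (cut_le_bilinear cut) => // *; rewrite normr1.
have -> : \sum_i \sum_j D i j * (1 * 1) = 2 * (\sum_e weight x e - \sum_e weight y e).
  rewrite mulrBr !(sum_edges_adj (f := id))// -sumrB; apply: eq_bigr => i _.
  by rewrite -sumrB; apply: eq_bigr => j _; rewrite /D !mulr1.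
by rewrite normrM ger0_norm// !mul1r ler_pdivlMr// mulrC.
Qed.

(** Telescoping over the three factors: for each value of the vertex opposite to the changed edge,
    the term is a bilinear form in [D] with coefficients bounded by [r]. *)
Lemma cut_triangle_sum : `|triangle_sum x - triangle_sum y| <= 3 * n%:R * r ^+ 2 * B.
Proof.
have sumn (F : 'I_n -> R) : (forall k, `|F k| <= r * r * B) ->
    `|\sum_k F k| <= n%:R * (r ^+ 2 * B).
  move=> FB; apply: le_trans (ler_norm_sum _ _ _) _.
  by rewrite -[n in leRHS]card_ord mulr_natl -sumr_const expr2; apply: ler_sum.
pose T1 := \sum_k \sum_i \sum_j D i j * (adj x k i * adj x j k).
pose T2 := \sum_i \sum_j \sum_k D j k * (adj y i j * adj x k i).
pose T3 := \sum_j \sum_k \sum_i D k i * (adj y j k * adj y i j).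
have -> : triangle_sum x - triangle_sum y = T1 + T2 + T3.
  have -> : T1 = \sum_i \sum_j \sum_k D i j * (adj x k i * adj x j k).
    by rewrite /T1 exchange_big; apply: eq_bigr => i _; rewrite exchange_big.
  have -> : T3 = \sum_i \sum_j \sum_k D k i * (adj y j k * adj y i j).
    rewrite /T3 (eq_bigr _ (fun j _ => exchange_big _ _ _ _ _ _)) /=.
    by rewrite exchange_big.
  rewrite /triangle_sum /T2 -sumrB -!big_split; apply: eq_bigr => i _.
  rewrite -sumrB -!big_split; apply: eq_bigr => j _.
  rewrite -sumrB -!big_split; apply: eq_bigr => k _; rewrite /D /=; ring.
have b1 : `|T1| <= n%:R * (r ^+ 2 * B).
  by apply: sumn => k; exact: (cut_le_bilinear cut).
have b2 : `|T2| <= n%:R * (r ^+ 2 * B).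
  by apply: sumn => k; exact: (cut_le_bilinear cut).
have b3 : `|T3| <= n%:R * (r ^+ 2 * B).
  by apply: sumn => k; exact: (cut_le_bilinear cut).
apply: le_trans (ler_normD _ _) _; have := ler_normD T1 T2.
have -> : 3 * n%:R * r ^+ 2 * B = n%:R * (r ^+ 2 * B) + n%:R * (r ^+ 2 * B) + n%:R * (r ^+ 2 * B) by ring.
lra.
Qed.

Lemma cut_exponent beta h : (0 < n)%N ->
  `|edge_triangle_exponent beta h x - edge_triangle_exponent beta h y| <=
  (`|beta| * r ^+ 2 + `|h|) * B.
Proof.
move=> n0; have n0' : 0 < n%:R :> R by rewrite ltr0n.
rewrite !exponentE.
have -> : forall a b c d : R, a * b + h * c - (a * d + h * (\sum_e weight y e)) =
   a * (b - d) + h * (c - \sum_e weight y e) by move=> *; ring.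
apply: le_trans (ler_normD _ _) _; rewrite !normrM [leRHS]mulrDl; apply: lerD.
  apply: le_trans (ler_wpM2l _ cut_triangle_sum) _; first by rewrite mulr_ge0.
  rewrite normfV (ger0_norm (x := 3 * n%:R)) ?mulr_ge0//.
  by apply: le_of_eq; field; rewrite gt_eqF.
rewrite ler_wpM2l//; apply: le_trans cut_sum_weights _.
have := cut_sum_weights; have := normr_ge0 (\sum_e weight x e - \sum_e weight y e); lra.
Qed.

Lemma cut_field_variance : (1 < n)%N ->
  `|field_variance x - field_variance y| <= 32 * r ^+ 3 * B / N.
Proof.
move=> n1; have N0 := num_edges_gt0 R n1.
have mdiff : `|mean_field x - mean_field y| <= 2 * r * B / N.
  rewrite /mean_field -mulrBr normrM normfV (gtr0_norm N0) mulrC ler_wpM2r ?invr_ge0 ?(ltW N0)//.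
  by rewrite -sumrB; apply: le_trans (ler_norm_sum _ _ _) cut_local_field.
rewrite /field_variance -mulrBr normrM normfV (gtr0_norm N0) mulrC ler_wpM2r ?invr_ge0 ?(ltW N0)//.
rewrite -sumrB; apply: le_trans (ler_norm_sum _ _ _) _.
(* A difference of squares is a sum times a difference; both deviations from the mean are at most
   [4 * r ^+ 2], hence [M] for their sum. *)
pose M := 8 * r ^+ 2; have M0 : 0 <= M by rewrite mulr_ge0 ?sqr_ge0.
apply: (@le_trans _ _ (\sum_e M * (`|local_field x e - local_field y e|
    + `|mean_field x - mean_field y|))).
  apply: ler_sum => e _; rewrite subr_sqr normrM mulrC.
  have dev z : in_box z -> `|local_field z e - mean_field z| <= 4 * r ^+ 2.
    move=> bz; apply: le_trans (ler_normB _ _) _.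
    have := norm_local_field_le km_lt_kp e bz; have := norm_mean_field_le km_lt_kp bz; lra.
  apply: ler_pM => //.
    by apply: le_trans (ler_normD _ _) _; have := dev x bx; have := dev y by_; rewrite /M; lra.
  have -> : local_field x e - mean_field x - (local_field y e - mean_field y) =
    (local_field x e - local_field y e) - (mean_field x - mean_field y) by ring.
  exact: ler_normB.
rewrite -mulr_sumr big_split/= sum_edges_cst.
have : N * `|mean_field x - mean_field y| <= 2 * r * B.
  by rewrite mulrC -ler_pdivlMr.
have := cut_local_field; have -> : 32 * r ^+ 3 * B = M * (2 * r * B + 2 * r * B) by rewrite /M; ring.
by move=> h1 h2; rewrite ler_wpM2l// lerD.
Qed.

End cut_lipschitz.

(** * Entropy of cut-norm cells and the mean-field problem *)

Section cells.
Context (R : realType) (km kp : R) (mu : probability (measurableTypeR R) R).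
Hypothesis km_lt_kp : km < kp.
Hypothesis mu_itv : mu [set z : R | km <= z <= kp] = 1%E.
Local Notation r := (support_radius km kp).
Local Notation phi := (tilted_mean km kp mu).
Local Notation Lam := (cumulant mu).
Local Notation clampt := (clampt km kp).
Local Notation expect := (expect km kp mu).
Local Notation in_box := (in_box km kp).
Context (n : nat).

Definition cell (W : 'I_n -> 'I_n -> R) (B : R) : set (weights R n) :=
  [set x | cut_le (fun i j => adj x i j - W i j) B].

Lemma measurable_cell W B : measurable (cell W B).
Proof.
pose F (p : {ffun 'I_n -> bool} * {ffun 'I_n -> bool}) (x : weights R n) :=
  `|cut_form (fun i j => adj x i j - W i j) p.1 p.2|.
rewrite (_ : cell W B = \bigcap_(p in [set: {ffun 'I_n -> bool} * {ffun 'I_n -> bool}])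
    [set x | F p x <= B]).
  apply: fin_bigcap_measurable => // p _; apply: measurable_sublevel.
  apply: measurableT_comp => //.
  apply: measurable_sum => i; apply: measurable_sum => j.
  by apply: measurable_funM => //; apply: measurable_funB => //; exact: measurable_adj.
apply/seteqP; split => x H; first by move=> p _; exact: H.
by move=> u v; exact: (H (u, v)).
Qed.

Lemma cell_diff W B x y : cell W B x -> cell W B y ->
  cut_le (fun i j => adj x i j - adj y i j) (2 * B).
Proof.
move=> Wx Wy u v.
have -> : cut_form (fun i j => adj x i j - adj y i j) u v =
    cut_form (fun i j => adj x i j - W i j) u v - cut_form (fun i j => adj y i j - W i j) u v.
  rewrite -sumrB; apply: eq_bigr => i _; rewrite -sumrB; apply: eq_bigr => j _; ring.
by apply: le_trans (ler_normB _ _) _; rewrite mulr2n mulrDl mul1r lerD.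
Qed.

Variable K : set (weights R n).
Hypothesis mK : measurable K.

Definition mass : R := expect (\1_K : weights R n -> R).

(** Mean of the weights conditioned on [K] under the product law, not under the Gibbs law. *)
Definition barycenter : weights R n :=
  [tuple expect (fun x => \1_K x * tnth x i) / mass | i < #|{: edge n}|].

Hypothesis mass_gt0 : 0 < mass.

Let bK : bounded_mfun (fun x : weights R n => \1_K (clampt x) : R).
Proof. exact: bounded_mfun_indic_clampt. Qed.
Let bt i := @bounded_mfun_tnth R km kp km_lt_kp n i.
Let K0 x : 0 <= \1_K x :> R. Proof. by rewrite indicE; case: (_ \in _). Qed.

Lemma barycenter_in_box : in_box barycenter.
Proof.
move=> i; rewrite tnth_mktuple ler_pdivlMr// ler_pdivrMr//.
rewrite /mass /expect -!meanZl//; apply/andP.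
split; apply: le_mean => [||x]; try by bmf.
  by rewrite mulrC ler_wpM2l//; case/andP: (in_box_clampt km_lt_kp x i).
by rewrite [leRHS]mulrC ler_wpM2l//; case/andP: (in_box_clampt km_lt_kp x i).
Qed.

Lemma adj_barycenter i j :
  expect (fun x => \1_K x * adj x i j) = mass * adj barycenter i j.
Proof.
rewrite /adj; case: insub => [e|]; last first.
  rewrite mulr0 /expect -[RHS](mean_cst (power_measure mu #|{: edge n}|)).
  by apply: eq_Rintegral => x _; rewrite mulr0.
by rewrite /weight tnth_mktuple mulrC divfK// gt_eqF.
Qed.

Lemma expect_indic_le (F : weights R n -> R) B : bounded_mfun (fun x => F (clampt x)) ->
  (forall x, K x -> `|F x| <= B) -> `|expect (fun x => \1_K x * F x)| <= mass * B.
Proof.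
move=> bF FB; rewrite mulrC /mass /expect -meanZl// ler_norml -mulN1r -meanZl; last by bmf.
apply/andP; split; apply: le_mean => [||x]; try bmf.
all: rewrite indicE; case: (boolP (_ \in _)) => [|_]; rewrite ?mulr0 ?mul0r//.
  by rewrite inE => /FB; rewrite ler_norml !mulr1 mul1r mulN1r => /andP[].
by rewrite inE => /FB; rewrite ler_norml !mulr1 mul1r => /andP[].
Qed.

(** Each cut constraint bounds an affine function of the weights, so it survives averaging over
    [K]. *)
Lemma barycenter_cell W B : K `<=` cell W B -> cell W B barycenter.
Proof.
move=> KW u v; have badj i j := @bounded_mfun_adj R km kp km_lt_kp n i j.
have H := @expect_indic_le (fun x => cut_form (fun i j => adj x i j - W i j) u v) B.
rewrite -(ler_pM2l mass_gt0) -[X in X * _](gtr0_norm mass_gt0) -normrM.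
have E : expect (fun x => \1_K x * cut_form (fun i j => adj x i j - W i j) u v) =
    mass * cut_form (fun i j => adj barycenter i j - W i j) u v.
  pose s i j := sign_of R u i * sign_of R v j.
  transitivity (\int[power_measure mu #|{: edge n}|]_x \sum_i \sum_j
      (s i j * (\1_K (clampt x) * adj (clampt x) i j) + (- (s i j * W i j)) * \1_K (clampt x))).
    apply: eq_Rintegral => x _; rewrite mulr_sumr; apply: eq_bigr => i _.
    by rewrite mulr_sumr; apply: eq_bigr => j _; rewrite /s; ring.
  rewrite mean_sum => [|i]; last by apply: bounded_mfun_sum => j; bmf.
  rewrite mulr_sumr; apply: eq_bigr => i _; rewrite mean_sum => [|j]; last by bmf.
  rewrite mulr_sumr; apply: eq_bigr => j _; rewrite meanD; [|by bmf..].
  rewrite !meanZl; [|by bmf..].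
  have -> : \int[power_measure mu #|{: edge n}|]_x \1_K (clampt x) = mass by [].
  have := adj_barycenter i j; rewrite /expect => ->; rewrite /s /=; ring.
rewrite -E; apply: H => [|x Kx]; last exact: KW.
apply: bounded_mfun_sum => i; apply: bounded_mfun_sum => j.
by apply: bounded_mfunM; bmf.
Qed.

(* Jensen on [K] against any product tilt: the mass of [K] is at most the exponential of
   minus the entropy at its barycenter. *)
Lemma mass_entropy (l : edge n -> R) :
  mass * expR (\sum_e (l e * weight barycenter e - Lam (l e))) <= 1.
Proof.
pose S x := \sum_(e : edge n) l e * weight x e.
have bw (e : edge n) := bounded_mfun_weight km_lt_kp e.
have bS : bounded_mfun (fun x => S (clampt x)).
  by apply: bounded_mfun_sum => e; bmf.
have ES : expect (fun x => \1_K x * S x) / mass = \sum_e l e * weight barycenter e.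
  rewrite /expect /S; transitivity ((\int[power_measure mu #|{: edge n}|]_x
      \sum_e (l e * (\1_K (clampt x) * weight (clampt x) e))) / mass).
    congr (_ / _); apply: eq_Rintegral => x _; rewrite mulr_sumr.
    by apply: eq_bigr => e _; ring.
  rewrite mean_sum => [|e]; last by bmf.
  rewrite mulr_suml; apply: eq_bigr => e _; rewrite meanZl; last by bmf.
  by rewrite -mulrA /weight tnth_mktuple.
have J := jensen_expR bK bS (fun x => K0 (clampt x)) mass_gt0.
rewrite -/(expect (fun x => \1_K x * S x)) -/mass ES in J.
have M : expect (fun x => expR (S x)) = expR (\sum_e Lam (l e)) := expect_expR_sum km_lt_kp mu_itv l.
rewrite sumrB expRD expRN mulrA ler_pdivrMr ?expR_gt0// mul1r -M; apply: le_trans J _.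
apply: le_mean => [||x]; [bmf|bmf|].
by rewrite ler_piMl ?expR_ge0// indicE; case: (_ \in _).
Qed.

End cells.

(** * The mean-field problem in one real variable *)

Section scalar_optimization.
Context (R : realType) (km kp : R) (mu : probability (measurableTypeR R) R).
Hypothesis km_lt_kp : km < kp.
Hypothesis mu_itv : mu [set z : R | km <= z <= kp] = 1%E.
Local Notation r := (support_radius km kp).
Local Notation phi := (tilted_mean km kp mu).
Local Notation Lam := (cumulant mu).
Variables (beta h : R).
Hypotheses (beta0 : 0 <= beta) (h_ge0 : 0 <= h).

(** Leading value of the exponent per edge at constant weight [t], where the local fields are close
    to [2 * t ^+ 2]. *)
Definition cubic (t : R) : R := 2 * beta / 3 * t ^+ 3 + h * t.

(* The mean-field functional at the constant [phi l]; [l * phi l - Lam l] is the rate there. *)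
Definition free_energy (l : R) : R := cubic (phi l) - (l * phi l - Lam l).

Let a0 : 0 <= 2 * beta / 3. Proof. by rewrite divr_ge0// mulr_ge0. Qed.

Lemma cubic_mono s t : s <= t -> cubic s <= cubic t.
Proof.
move=> st; rewrite /cubic lerD ?ler_wpM2l//.
by have := sqr_ge0 (s + t); have := sqr_ge0 s; have := sqr_ge0 t; nra.
Qed.

Lemma cubic_lipschitz s t : `|s| <= r -> `|t| <= r -> s <= t ->
  cubic t - cubic s <= (2 * beta * r ^+ 2 + h) * (t - s).
Proof.
move=> sr tr st; have ts : 0 <= t - s by rewrite subr_ge0.
have -> : cubic t - cubic s = (2 * beta / 3 * (t ^+ 2 + t * s + s ^+ 2) + h) * (t - s).
  by rewrite /cubic; ring.
rewrite ler_wpM2r// lerD2r.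
have sq y : `|y| <= r -> y ^+ 2 <= r ^+ 2.
  by move=> yr; rewrite -[y ^+ 2]real_normK ?num_real// ler_pXn2r// nnegrE (le_trans _ yr).
have := sq _ sr; have := sq _ tr; have := sqr_ge0 (t - s) => q1 q2 q3.
have -> : 2 * beta * r ^+ 2 = 2 * beta / 3 * (3 * r ^+ 2) by field.
by rewrite ler_wpM2l//; nra.
Qed.

(** A mean [p] is compared with an attained value of [phi]. Below [phi 0] the tilt 0 works, as
    [cubic] is monotone. Above [phi C] the tilt [C] works, as [C] bounds the slope of [cubic]. In
    between, [p] is itself some [phi l] by the intermediate value theorem. *)
Lemma scalar_bound p : `|p| <= r -> exists l, cubic p - (l * p - Lam l) <= free_energy l.
Proof.
move=> pr; pose C := 2 * beta * r ^+ 2 + h.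
have C0 : 0 <= C by rewrite addr_ge0// mulr_ge0 ?sqr_ge0// mulr_ge0.
have [p0|p0] := leP p (phi 0).
  exists 0; rewrite /free_energy !mul0r lerD2r; exact: cubic_mono.
have [pC|pC] := leP (phi C) p.
  exists C; have := cubic_lipschitz (norm_tilted_mean mu km_lt_kp C) pr pC.
  by rewrite /free_energy -/C mulrBr; lra.
have [l _ lE] : exists2 l, l \in `[0, C] & phi l = p.
  apply: IVT => //; first exact/continuous_subspaceT/continuous_tilted_mean.
  by rewrite ge_min le_max (ltW p0) (ltW pC) orbT.
by exists l; rewrite /free_energy lE.
Qed.

(** The rate [l * phi l - Lam l] is non-negative: this is the tangent inequality at [l] evaluated at
    0, where the cumulant vanishes. *)
Lemma free_energy_le l : free_energy l <= cubic r.
Proof.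
have := cumulant_convex km_lt_kp mu_itv l 0.
have -> : Lam 0 = 0.
  rewrite (cumulantE mu_itv) /mgf.
  by under eq_Rintegral do rewrite mul0r expR0; rewrite mean_cst ln1.
have : cubic (phi l) <= cubic r.
  by apply: cubic_mono; rewrite (le_trans (ler_norm _))// norm_tilted_mean.
by rewrite /free_energy; lra.
Qed.

Lemma free_energy_sup : exists F, (forall l, free_energy l <= F) /\
  forall eps, 0 < eps -> exists l, F - eps <= free_energy l.
Proof.
exists (sup (range free_energy)).
have hs : has_sup (range free_energy).
  by split; [exists (free_energy 0); exists 0|exists (cubic r) => _ [l _ <-]; exact: free_energy_le].
split=> [l|eps eps0]; first by apply: sup_upper_bound => //; exists l.
by have [_ [l _ <-] /ltW] := sup_adherent eps0 hs; exists l.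
Qed.

(* Reflecting a negative mean costs nothing in entropy. *)
Lemma reflect_rate q l eps : stochastically_nonneg mu -> 0 < eps ->
  exists l', l * `|q| - Lam l - eps <= l' * q - Lam l'.
Proof.
move=> sn eps0; have [q0|q0] := leP 0 q; first by rewrite ger0_norm//; exists l; lra.
rewrite ltr0_norm//.
have := sn (- q); rewrite opprK oppr_ge0 => /(_ (ltW q0)) rate_le.
have lt : ((l * - q - Lam l - eps)%:E < rate mu q)%E.
  apply: lt_le_trans rate_le.
  apply: (@lt_le_trans _ _ ((l * - q - Lam l)%:E)); first by rewrite lte_fin ltrBlDr ltrDl.
  by apply: ereal_sup_ubound; exists l.
have [_ [l' _ <-]] := ereal_sup_gt lt.
by rewrite lte_fin => /ltW; exists l'.
Qed.

End scalar_optimization.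

(** * Quantitative AM-GM and the energy defect *)

Section stability.
Context (R : realType) (km kp : R).
Hypothesis km_lt_kp : km < kp.
Local Notation r := (support_radius km kp).
Local Notation in_box := (in_box km kp).
Variables (beta h : R).
Hypotheses (beta0 : 0 < beta) (h_ge0 : 0 <= h).
Local Notation cubic := (cubic beta h).

(** What is lost when the exponent is bounded by its scalar version at the absolute values: the
    AM-GM deficit over paths of two edges, where 18 is the 3 of the exponent times the 6 of [amgm3],
    and the loss of the field term on negative weights. *)
Definition energy_defect n (x : weights R n) : R :=
  beta / (18 * n%:R) * (\sum_i \sum_j \sum_k `| `|adj x i j| - `|adj x j k| | ^+ 3)
  + h * \sum_e (`|weight x e| - weight x e).

(** By the factorization of [a ^ 3 + b ^ 3 + c ^ 3 - 3 a b c] as half of [a + b + c] times the sum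
    of squared differences, together with [|a - b| <= a + b + c]. *)
Lemma amgm3 (a b c : R) : 0 <= a -> 0 <= b -> 0 <= c ->
  a * b * c <= (a ^+ 3 + b ^+ 3 + c ^+ 3) / 3 - `|a - b| ^+ 3 / 6.
Proof.
move=> a0 b0 c0.
have E : (a ^+ 3 + b ^+ 3 + c ^+ 3) / 3 - a * b * c =
    (a + b + c) * ((a - b) ^+ 2 + (b - c) ^+ 2 + (c - a) ^+ 2) / 6 by field.
have D : `|a - b| ^+ 3 <= (a + b + c) * ((a - b) ^+ 2 + (b - c) ^+ 2 + (c - a) ^+ 2).
  rewrite exprS real_normK ?num_real//; apply: ler_pM => //; rewrite ?sqr_ge0//.
    by apply: le_trans (ler_normB _ _) _; rewrite !ger0_norm// lerDl.
  by rewrite -addrA lerDl addr_ge0 ?sqr_ge0.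
lra.
Qed.

(** AM-GM on each triple of absolute values. By symmetry the three cubes contribute equally and
    split over the edges; of the deficit only the difference of the first two factors is kept. *)
Lemma exponent_le_cubic n (x : weights R n) : (0 < n)%N ->
  edge_triangle_exponent beta h x <= \sum_e cubic `|weight x e| - energy_defect x.
Proof.
move=> n0; have n0' : 0 < n%:R :> R by rewrite ltr0n.
set V := \sum_i \sum_j \sum_k `| `|adj x i j| - `|adj x j k| | ^+ 3.
have tri : triangle_sum x <= n%:R * (\sum_i \sum_j `|adj x i j| ^+ 3) - V / 6.
  pose A i j := `|adj x i j|.
  have c1 : \sum_i \sum_j \sum_(k < n) A i j ^+ 3 = n%:R * \sum_i \sum_j A i j ^+ 3.
    by under eq_bigr do under eq_bigr do rewrite sum_ord_const; under eq_bigr do rewrite -mulr_sumr;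
      rewrite -mulr_sumr.
  have c2 : \sum_(i < n) \sum_j \sum_k A j k ^+ 3 = n%:R * \sum_i \sum_j A i j ^+ 3.
    by rewrite sum_ord_const.
  have c3 : \sum_i \sum_(j < n) \sum_k A k i ^+ 3 = n%:R * \sum_i \sum_j A i j ^+ 3.
    under eq_bigr do rewrite sum_ord_const; rewrite -mulr_sumr; congr (_ * _); exact: exchange_big.
  apply: (@le_trans _ _ (\sum_i \sum_j \sum_k
      ((A i j ^+ 3 + A j k ^+ 3 + A k i ^+ 3) / 3 - `|A i j - A j k| ^+ 3 / 6))).
    apply: ler_sum => i _; apply: ler_sum => j _; apply: ler_sum => k _.
    apply: le_trans (ler_norm _) _; rewrite !normrM; exact: amgm3.
  apply: le_of_eq.
  transitivity ((\sum_i \sum_j \sum_(k < n) A i j ^+ 3 + \sum_(i < n) \sum_j \sum_k A j k ^+ 3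
    + \sum_i \sum_(j < n) \sum_k A k i ^+ 3) / 3 - V / 6); last first.
    by rewrite c1 c2 c3; field.
  rewrite /V -!big_split !mulr_suml -sumrB; apply: eq_bigr => i _ /=.
  rewrite -!big_split !mulr_suml -sumrB; apply: eq_bigr => j _ /=.
  by rewrite -!big_split !mulr_suml -sumrB; apply: eq_bigr => k _ /=.
have cub : 2 * \sum_e `|weight x e| ^+ 3 = \sum_i \sum_j `|adj x i j| ^+ 3.
  by rewrite (sum_edges_adj (f := fun y => `|y| ^+ 3))// normr0 expr0n.
rewrite exponentE /energy_defect -/V.
have b3 : 0 <= beta / (3 * n%:R) by rewrite divr_ge0 ?mulr_ge0 ?ltW.
apply: le_trans (lerD (ler_wpM2l b3 tri) (lexx _)) _.
rewrite -cub /cubic big_split/= -!mulr_sumr sumrB.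
by apply: le_of_eq; field; rewrite gt_eqF.
Qed.

Lemma norm_weight_gap_ge0 n (x : weights R n) e : 0 <= `|weight x e| - weight x e.
Proof. by rewrite subr_ge0 ler_norm. Qed.

(** Passes from the cubes measured by the defect to first powers, at an arbitrarily small additive
    price [tau]. *)
Lemma cube_tradeoff (tau d : R) : 0 < tau -> 0 <= d -> d <= tau + d ^+ 3 / tau ^+ 2.
Proof.
move=> t0 d0; have t2 : 0 < tau ^+ 2 by rewrite exprn_gt0.
have [dt|dt] := leP d tau; first by apply: ler_wpDr => //; rewrite divr_ge0 ?exprn_ge0// ltW.
apply: ler_wpDl; first exact: ltW.
rewrite ler_pdivlMr// (exprS d 2) ler_wpM2l//.
by rewrite ler_pXn2r ?nnegrE ?(ltW t0) ?(ltW dt).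
Qed.

(** The variance is at most the maximal deviation times the mean difference of two local fields. The
    fields at [i j] and [k l] differ by no more than the l1 distances between rows [i], [k] and
    between rows [j], [l]. The constant comes from [N >= n ^ 2 / 4], used twice. *)
Lemma field_variance_le_oscillation n (x : weights R n) : (1 < n)%N -> in_box x ->
  field_variance x <= 64 * r ^+ 3 / n%:R ^+ 3 *
    \sum_(i < n) \sum_(k < n) \sum_(p < n) `|adj x i p - adj x k p|.
Proof.
move=> n1 bx; have N0 := num_edges_gt0 R n1; set N := num_edges R n in N0.
have n0 : 0 < n%:R :> R by rewrite ltr0n (ltn_trans _ n1).
have r0 : 0 < r := support_radius_gt0 km_lt_kp.
set Q := \sum_i _; set m := mean_field x.
have Q0 : 0 <= Q by do 3 (apply: sumr_ge0 => ? _).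
pose P2 := \sum_e \sum_f `|local_field x e - local_field x f|.
have dev e : N * `|local_field x e - m| <= \sum_f `|local_field x e - local_field x f|.
  rewrite -{1}[N]gtr0_norm// -normrM mulrBr -sum_local_field// -sum_edges_cst -sumrB.
  exact: ler_norm_sum.
have v1 : N * (N * field_variance x) <= 4 * r ^+ 2 * P2.
  rewrite -sum_sqr_local_field// mulr_sumr /P2 mulr_sumr; apply: ler_sum => e _.
  rewrite -[_ ^+ 2]real_normK ?num_real// expr2 mulrCA.
  apply: ler_pM => //; first by rewrite mulr_ge0// ltW.
  apply: le_trans (ler_normB _ _) _.
  have := norm_local_field_le km_lt_kp e bx; have := norm_mean_field_le km_lt_kp bx.
  rewrite -/m; lra.
have v2 : P2 <= r * n%:R * Q.
  rewrite -(@ler_pM2l _ 4)//.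
  apply: (@le_trans _ _ (\sum_i \sum_j \sum_k \sum_l
      `|matrix_field x i j - matrix_field x k l|)).
    pose F e := 2 * \sum_f `|local_field x e - local_field x f|.
    have -> : 4 * P2 = 2 * \sum_e F e by rewrite /F -mulr_sumr; rewrite /P2; ring.
    pose G i j := 2 * \sum_f `|matrix_field x i j - local_field x f|.
    apply: le_trans (_ : _ <= \sum_i \sum_j G i j) _.
      apply: sum_edges_le => [i j|e i j eE].
        by rewrite mulr_ge0// sumr_ge0.
      rewrite /F /G; congr (_ * _); apply: eq_bigr => f _.
      by rewrite (local_fieldE x eE).
    apply: ler_sum => i _; apply: ler_sum => j _.
    apply: sum_edges_le => // f k l fE.
    by rewrite (local_fieldE x fE).
  have term i j k l : `|matrix_field x i j - matrix_field x k l| <=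
      2 / n%:R * r * (\sum_p `|adj x i p - adj x k p| + \sum_p `|adj x j p - adj x l p|).
    rewrite /matrix_field -mulrBr normrM ger0_norm ?divr_ge0// -mulrA ler_wpM2l ?divr_ge0//.
    rewrite -sumrB; apply: le_trans (ler_norm_sum _ _ _) _.
    rewrite -big_split/= mulr_sumr; apply: ler_sum => p _.
    have -> : adj x i p * adj x p j - adj x k p * adj x p l =
      adj x p j * (adj x i p - adj x k p) + adj x k p * (adj x j p - adj x l p).
      by rewrite (adj_sym x p j) (adj_sym x p l); ring.
    apply: le_trans (ler_normD _ _) _; rewrite !normrM mulrDr.
    by rewrite lerD// ler_wpM2r// (norm_adj_le km_lt_kp).
  pose S i k := \sum_p `|adj x i p - adj x k p|.
  apply: (@le_trans _ _ (\sum_i \sum_j \sum_k \sum_l (2 / n%:R * r * (S i k + S j l)))).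
    by do 4 (apply: ler_sum => ? _); exact: term.
  have -> : \sum_(i < n) \sum_(j < n) \sum_(k < n) \sum_(l < n) (2 / n%:R * r * (S i k + S j l)) =
     2 / n%:R * r * (n%:R * (n%:R * Q) + n%:R * (n%:R * Q)).
    transitivity (\sum_(i < n) \sum_(j < n) (2 / n%:R * r *
        (n%:R * \sum_k S i k + n%:R * \sum_l S j l))).
      apply: eq_bigr => i _; apply: eq_bigr => j _.
      under eq_bigr do rewrite -mulr_sumr big_split sum_ord_const /=.
      by rewrite -mulr_sumr big_split sum_ord_const /= -mulr_sumr.
    transitivity (\sum_(i < n) (2 / n%:R * r * (n%:R * (n%:R * \sum_k S i k) + n%:R * Q))).
      apply: eq_bigr => i _; rewrite -mulr_sumr big_split sum_ord_const /= -mulr_sumr.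
      by rewrite /Q.
    rewrite -mulr_sumr big_split sum_ord_const /= -!mulr_sumr.
    by rewrite -/Q.
  by apply: le_of_eq; field; rewrite gt_eqF.
have Nn := num_edges_ge R n1; rewrite -/N in Nn.
have NN : n%:R ^+ 4 / 16 <= N * N.
  have -> : n%:R ^+ 4 / 16 = (n%:R ^+ 2 / 4) * (n%:R ^+ 2 / 4) :> R by field.
  by apply: ler_pM => //; rewrite divr_ge0// exprn_ge0// ltW.
have T0 := field_variance_ge0 x.
have n3 : 0 < n%:R ^+ 3 :> R by rewrite exprn_gt0.
have h1 : n%:R ^+ 4 / 16 * field_variance x <= 4 * r ^+ 2 * (r * n%:R * Q).
  apply: le_trans (ler_wpM2r T0 NN) _; rewrite -(mulrA N); apply: le_trans v1 _.
  by rewrite ler_wpM2l// mulr_ge0// exprn_ge0// ltW.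
rewrite mulrAC ler_pdivlMr// -(ler_pM2l n0).
have -> : n%:R * (field_variance x * n%:R ^+ 3) = 16 * (n%:R ^+ 4 / 16 * field_variance x).
  by field.
have -> : n%:R * (64 * r ^+ 3 * Q) = 16 * (4 * r ^+ 2 * (r * n%:R * Q)) by ring.
by rewrite ler_pM2l.
Qed.

Lemma defect_stability eta : 0 < h \/ 0 <= km -> 0 < eta -> exists2 delta : R, 0 < delta &
  forall n (x : weights R n), (1 < n)%N -> in_box x -> eta <= field_variance x ->
  delta * n%:R ^+ 2 <= energy_defect x.
Proof.
move=> hkm eta0; have r0 : 0 < r := support_radius_gt0 km_lt_kp.
(* The defect must also control the passage from weights to absolute values. With [h > 0] its second
   term does so with factor [h^-1]; with [km >= 0] the two coincide. *)
have [g g0 gapP] : exists2 g : R, 0 <= g & forall n (x : weights R n), (1 < n)%N -> in_box x ->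
    \sum_e (`|weight x e| - weight x e) <= g * energy_defect x.
  have V0 n (x : weights R n) : 0 <= beta / (18 * n%:R) *
      (\sum_i \sum_j \sum_k `| `|adj x i j| - `|adj x j k| | ^+ 3).
    apply: mulr_ge0; first by rewrite divr_ge0 ?(ltW beta0)// mulr_ge0.
    by do 3 (apply: sumr_ge0 => ? _); rewrite exprn_ge0.
  case: hkm => [h0|km0].
    exists h^-1 => [|n x n1 bx]; first by rewrite invr_ge0.
    by rewrite mulrC ler_pdivlMr// mulrC lerDr.
  exists 0 => // n x n1 bx; rewrite mul0r big1// => e _.
  rewrite ger0_norm ?subrr// (le_trans km0)//; by case/andP: (bx (enum_rank e)).
(* The price [tau] contributes [64 * r ^+ 3 * tau = eta / 2] to the variance, which leaves half of
   [eta] to be paid by the defect. *)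
pose tau := eta / (128 * r ^+ 3).
have r3 : 0 < r ^+ 3 by rewrite exprn_gt0.
have tau0 : 0 < tau by rewrite divr_gt0// mulr_gt0.
pose K := 18 / (beta * tau ^+ 2) + 4 * g.
have K0 : 0 < K.
  by rewrite ltr_wpDr ?mulr_ge0// divr_gt0// mulr_gt0// exprn_gt0.
exists (tau / K) => [|n x n1 bx etaT]; first by rewrite divr_gt0.
have n0 : 0 < n%:R :> R by rewrite ltr0n (ltn_trans _ n1).
set Def := energy_defect x.
set V := \sum_i \sum_j \sum_k `| `|adj x i j| - `|adj x j k| | ^+ 3.
pose gap := \sum_e (`|weight x e| - weight x e).
have gap0 : 0 <= gap by rewrite sumr_ge0// => e _; exact: norm_weight_gap_ge0.
have VD : V <= 18 * n%:R / beta * Def.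
  rewrite mulrAC ler_pdivlMr// -ler_pdivrMl ?mulr_gt0//.
  rewrite /Def /energy_defect -/V -/gap.
  have -> : (18 * n%:R)^-1 * (V * beta) = beta / (18 * n%:R) * V by ring.
  by rewrite lerDl mulr_ge0.
have gapE : \sum_i \sum_j (`|adj x i j| - adj x i j) = 2 * gap.
  by rewrite (sum_edges_adj (f := fun y => `|y| - y))// normr0 subr0.
have Qle : \sum_(i < n) \sum_(k < n) \sum_(p < n) `|adj x i p - adj x k p| <=
    n%:R ^+ 3 * tau + V / tau ^+ 2 + 4 * n%:R * gap.
  apply: (@le_trans _ _ (\sum_(i < n) \sum_(k < n) \sum_(p < n)
     (tau + `| `|adj x i p| - `|adj x p k| | ^+ 3 / tau ^+ 2
       + (`|adj x i p| - adj x i p) + (`|adj x k p| - adj x k p)))).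
    apply: ler_sum => i _; apply: ler_sum => k _; apply: ler_sum => p _.
    have := cube_tradeoff tau0 (normr_ge0 (`|adj x i p| - `|adj x p k|)).
    rewrite (adj_sym x p k); set a := adj x i p; set b := adj x k p.
    have : `|a - b| <= `| `|a| - `|b| | + (`|a| - a) + (`|b| - b).
      have -> : a - b = (`|a| - `|b|) - (`|a| - a) + (`|b| - b) by ring.
      apply: le_trans (ler_normD _ _) _; apply: lerD.
        apply: le_trans (ler_normB _ _) _; rewrite lerD2l.
        by rewrite ger0_norm// subr_ge0 ler_norm.
      by rewrite ger0_norm// subr_ge0 ler_norm.
    lra.
  apply: le_of_eq.
  transitivity (\sum_(i < n) \sum_(k < n) \sum_(p < n) tau
    + (\sum_(i < n) \sum_(k < n) \sum_(p < n) `| `|adj x i p| - `|adj x p k| | ^+ 3) / tau ^+ 2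
    + \sum_(i < n) \sum_(k < n) \sum_(p < n) (`|adj x i p| - adj x i p)
    + \sum_(i < n) \sum_(k < n) \sum_(p < n) (`|adj x k p| - adj x k p)).
    rewrite mulr_suml -!big_split; apply: eq_bigr => i _ /=.
    rewrite mulr_suml -!big_split; apply: eq_bigr => k _ /=.
    by rewrite mulr_suml -!big_split; apply: eq_bigr => p _ /=.
  have -> : \sum_(i < n) \sum_(k < n) \sum_(p < n) tau = n%:R ^+ 3 * tau.
    under eq_bigr do under eq_bigr do rewrite sum_ord_const.
    by under eq_bigr do rewrite sum_ord_const; rewrite sum_ord_const; ring.
  have -> : \sum_(i < n) \sum_(k < n) \sum_(p < n) `| `|adj x i p| - `|adj x p k| | ^+ 3 = V.
    by apply: eq_bigr => i _; exact: exchange_big.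
  have -> : \sum_(i < n) \sum_(k < n) \sum_(p < n) (`|adj x i p| - adj x i p) = n%:R * (2 * gap).
    by under eq_bigr do rewrite sum_ord_const; rewrite -mulr_sumr gapE.
  have -> : \sum_(i < n) \sum_(k < n) \sum_(p < n) (`|adj x k p| - adj x k p) = n%:R * (2 * gap).
    by rewrite sum_ord_const gapE.
  ring.
have T := field_variance_le_oscillation n1 bx.
have c0 : 0 <= 64 * r ^+ 3 / n%:R ^+ 3 by rewrite divr_ge0 ?exprn_ge0 ?mulr_ge0 ?ltW.
have gD := gapP n x n1 bx; rewrite -/gap -/Def in gD.
have t2 : 0 < tau ^+ 2 by rewrite exprn_gt0.
have Q2 : n%:R ^+ 3 * tau + V / tau ^+ 2 + 4 * n%:R * gap <= n%:R ^+ 3 * tau + n%:R * K * Def.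
  have e1 : V / tau ^+ 2 <= 18 * n%:R / beta * Def / tau ^+ 2.
    by rewrite ler_wpM2r ?invr_ge0 ?(ltW t2).
  have e2 : 4 * n%:R * gap <= 4 * n%:R * (g * Def) by rewrite ler_wpM2l// mulr_ge0// ltW.
  have -> : n%:R * K * Def = 18 * n%:R / beta * Def / tau ^+ 2 + 4 * n%:R * (g * Def).
    by rewrite /K; field; rewrite !gt_eqF.
  lra.
have F := le_trans etaT (le_trans T (ler_wpM2l c0 (le_trans Qle Q2))).
have F2 : eta <= eta / 2 + 64 * r ^+ 3 * K * Def / n%:R ^+ 2.
  apply: le_trans F _; apply: le_of_eq.
  by rewrite /tau; field; rewrite !gt_eqF.
have n2 : 0 < n%:R ^+ 2 :> R by rewrite exprn_gt0.
rewrite -ler_pdivlMr// ler_pdivrMr//.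
have -> : tau = eta / 2 / (64 * r ^+ 3) by rewrite /tau; field; rewrite gt_eqF.
rewrite ler_pdivrMr ?mulr_gt0//.
have -> : Def / n%:R ^+ 2 * K * (64 * r ^+ 3) = 64 * r ^+ 3 * K * Def / n%:R ^+ 2 by ring.
lra.
Qed.

End stability.

(** * Large negative interaction *)

Section bipartite.
Context (R : realType) (n : nat).
Implicit Types e : edge n.

Definition crossing e : bool := [exists i : 'I_n, exists j : 'I_n,
  (val e == [set i; j]%SET) && (odd i != odd j)].

Lemma crossingE e i j : val e = [set i; j]%SET -> crossing e = (odd i != odd j).
Proof.
move=> eE; apply/idP/idP => [|ij].
  case/existsP => a /existsP[b /andP[/eqP eab ab]].
  move/eqP: (eE); rewrite eab set2_eq; last exact: edge_neq eab.
  by case/orP => /andP[/eqP -> /eqP ->] //; rewrite eq_sym.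
by apply/existsP; exists i; apply/existsP; exists j; rewrite eE eqxx.
Qed.

Lemma sum_signs m : \sum_(i < m) (-1) ^+ odd i = (odd m)%:R :> R.
Proof.
elim: m => [|m IH]; first by rewrite big_ord0.
by rewrite big_ord_recr/= IH; case: (odd m); rewrite /= ?expr1 ?expr0 ?subrr ?add0r.
Qed.

(** The indicator of differing parities is [(1 - s i * s j) / 2] with alternating signs [s], and the
    signs sum to 0 or 1. *)
Lemma crossing_card : num_edges R n / 2 <= \sum_e (crossing e)%:R.
Proof.
pose s (i : 'I_n) : R := (-1) ^+ odd i.
have E : \sum_(i < n) \sum_(j < n) (1 - s i * s j) / 2 = 2 * \sum_e (crossing e)%:R.
  rewrite -(sum_edges (f := fun i j => (1 - s i * s j) / 2)) => [|e i j eE].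
    apply: eq_bigr => i _; rewrite [RHS]big_mkcond; apply: eq_bigr => j _.
    by case: eqP => // ->; rewrite /s -signr_addb addbb expr0 subrr mul0r.
  by rewrite (crossingE eE) /s; case: (odd i); case: (odd j); rewrite /= ?expr1 ?expr0; lra.
have E2 : \sum_(i < n) \sum_(j < n) (1 - s i * s j) / 2 = (n%:R ^+ 2 - (odd n)%:R) / 2.
  transitivity (\sum_(i < n) (n%:R - s i * (odd n)%:R) / 2).
    by apply: eq_bigr => i _; rewrite -mulr_suml sumrB sumr_const card_ord -mulr_sumr sum_signs.
  rewrite -mulr_suml sumrB sumr_const card_ord -mulr_suml sum_signs -mulr_natr -expr2.
  by case: (odd n) => /=; ring.
have on : (odd n)%:R <= n%:R :> R by rewrite ler_nat; case: (n) => //= m; case: (~~ _).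
rewrite num_edgesE; move: E; rewrite E2; lra.
Qed.

(** Among three vertices two share a parity, and the entry joining them is zero. *)
Lemma crossing_triangle_sum (x : weights R n) :
  (forall e, ~~ crossing e -> weight x e = 0) -> triangle_sum x = 0.
Proof.
move=> x0; have a0 (i j : 'I_n) : odd i = odd j -> adj x i j = 0.
  move=> ij; rewrite adjE big1// => e _; case: eqP => [eE|]; last by rewrite mul0r.
  by rewrite x0 ?mulr0// (crossingE eE) ij eqxx.
rewrite /triangle_sum big1// => i _; rewrite big1// => j _; rewrite big1// => k _.
have [ij|ij] := eqVneq (odd i) (odd j); first by rewrite (a0 i j)// !mul0r.
have [jk|jk] := eqVneq (odd j) (odd k); first by rewrite (a0 j k)// mulr0 mul0r.
by rewrite (a0 k i) ?mulr0//; move: ij jk; case: (odd i); case: (odd j); case: (odd k).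
Qed.

End bipartite.

(** * The atom at zero and a lower bound on the partition function *)

Section zero_atom.
Context (R : realType) (kp : R) (mu : probability (measurableTypeR R) R).
Hypothesis kp0 : 0 < kp.
Hypothesis mu_itv : mu [set z : R | 0 <= z <= kp] = 1%E.
Hypothesis kp_supp : measure_support mu kp.
Hypothesis atom : (0 < mu [set 0%R])%E.
Local Notation c := (clamp 0 kp).
Local Notation r := (support_radius 0 kp).
Local Notation mgf := (mgf 0 kp mu).
Local Notation in_box := (in_box 0 kp).
Local Notation expect := (expect 0 kp mu).

Definition mass0 : R := fine (mu [set 0%R]).
Local Notation m0 := mass0.

Lemma mass0_gt0 : 0 < m0.
Proof. by rewrite fine_gt0// atom (le_lt_trans (probability_le1 _ _)) ?ltry. Qed.

Let m1 : measurable [set 0 : measurableTypeR R]. Proof. exact: measurable_set1. Qed.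

Lemma mean_indic0 : \int[mu]_z \1_[set 0] (c z) = m0.
Proof.
rewrite -(mean_clamp mu_itv (f := \1_[set 0])) ?mean_indic//.
Qed.

Lemma clamp_ge0 z : 0 <= c z. Proof. by case/andP: (clamp_itv kp0 z). Qed.

(** The atom alone contributes [m0]; as [kp] is in the support, the half-line beyond [kp / 2] adds a
    positive amount. The strict inequality is the source of the exponential gap. *)
Lemma mass0_lt_mgf h : m0 < mgf h.
Proof.
pose U : set R := `]kp / 2, +oo[%classic.
have mU : measurable (U : set (measurableTypeR R)) by exact: measurable_itv.
have muU : 0 < fine (mu U).
  have oU : open U by exact: interval_open.
  have Uk : U kp by rewrite /U /= in_itv/= andbT ltr_pdivrMr// ltr_pMr// ltr1n.
  by rewrite fine_gt0// (kp_supp oU Uk) (le_lt_trans (probability_le1 _ mU)) ?ltry.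
pose e := expR (- (`|h| * r)); have e0 : 0 < e by exact: expR_gt0.
apply: (@lt_le_trans _ _ (m0 + e * fine (mu U))); first by rewrite ltrDl mulr_gt0.
rewrite -mean_indic0 -mean_indic// (mean_clamp mu_itv (f := \1_U)); last exact: measurable_indic.
have bI (A : set R) : measurable (A : set (measurableTypeR R)) ->
    bounded_mfun (fun z : measurableTypeR R => \1_A (c z) : R).
  by move=> mA; apply: (bounded_mfun_comp (bounded_mfun_indic R mA)); exact: measurable_clamp.
have bI0 := bI _ m1; have bIU := bI _ mU; have be := bounded_mfun_expc kp0 h.
rewrite -meanZl// -meanD//; last exact: bounded_mfunM (bounded_mfun_cst _ _) _.
apply: le_mean => [||z]; [bmf|exact: be|].
rewrite !indicE; have [cz|cz] := eqVneq (c z) 0.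
  rewrite cz mulr0 expR0 mem_set// memNset ?mulr0 ?addr0//.
  by rewrite /U /= in_itv/= andbT; apply/negP; rewrite -leNgt divr_ge0// ltW.
rewrite (memNset (A := [set 0])) ?add0r; last by apply/eqP.
case: (c z \in _); last by rewrite mulr0 expR_ge0.
rewrite mulr1 ler_expR lerNl -mulrN (le_trans (ler_norm _))// normrM normrN ler_wpM2l//.
exact: norm_clamp.
Qed.

(** Dominated convergence: on non-negative values, [expR (- k * z)] decreases to the indicator of
    0. *)
Lemma mgf_cvg_mass0 eps : 0 < eps -> exists2 l : R, 0 < l & mgf (- l) <= m0 + eps.
Proof.
move=> eps0.
pose f (k : nat) (z : measurableTypeR R) : \bar R := (expR (- k%:R * c z))%:E.
pose g (z : measurableTypeR R) : \bar R := (\1_[set 0] (c z) : R)%:E.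
have bI : bounded_mfun (fun z : measurableTypeR R => \1_[set 0] (c z) : R).
  by apply: (bounded_mfun_comp (bounded_mfun_indic R m1)); exact: measurable_clamp.
have mf k : measurable_fun setT (f k).
  by apply/measurable_EFinP; have [] := bounded_mfun_expc kp0 (- k%:R).
have mg : measurable_fun setT g by apply/measurable_EFinP; case: bI.
have fg z : f k z @[k --> \oo] --> g z.
  apply: cvg_EFin; first by near=> k.
  rewrite /g /= indicE; have [cz|cz] := eqVneq (c z) 0.
    rewrite cz mem_set//.
    under [X in X @ _ --> _]funext do rewrite /f /= cz mulr0 expR0.
    exact: cvg_cst.
  rewrite memNset; last by apply/eqP.
  have cz0 : 0 < c z by rewrite lt_def cz clamp_ge0.
  rewrite (_ : _ \o _ = (fun k => expR (- c z) ^+ k)); last first.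
    by apply/funext => k; rewrite /f /= -expRM_natl; congr expR; ring.
  apply: cvg_expr; rewrite ger0_norm ?expR_ge0// expR_lt1 oppr_lt0//.
have fle z k : (`|f k z| <= (cst 1 z)%:E)%E.
  rewrite /f /= lee_fin ger0_norm ?expR_ge0// -expR0 ler_expR mulNr oppr_le0.
  by rewrite mulr_ge0// clamp_ge0.
have H : (\int[mu]_z f k z @[k --> \oo] --> \int[mu]_z g z)%E.
  apply: (@dominated_cvg _ _ _ mu setT measurableT f g (EFin \o cst 1)) => //.
  exact: (integrable_bounded_mfun mu (bounded_mfun_cst _ 1)).
have int_g : (\int[mu]_z g z = m0%:E)%E.
  rewrite -mean_indic0 /Rintegral fineK//.
  exact: (integrable_fin_num _ (integrable_bounded_mfun mu bI)).
rewrite int_g in H; have {}H := fine_cvg H.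
have {}H : mgf (- k%:R) @[k --> \oo] --> m0 by exact: H.
near \oo => k.
exists k%:R; first by rewrite ltr0n; near: k; exact: nbhs_infty_gt.
have : `|m0 - mgf (- k%:R)| <= eps by near: k; move/cvgrPdist_le: H; exact.
by rewrite ler_norml; lra.
Unshelve. all: by end_near. Qed.

Section partition_lower_bound.
Variables (beta h : R).

(* A weight carried by the complete bipartite graph between even and odd vertices has no
   triangle, so only the field term contributes, whatever the value of [beta]. *)
Lemma gibbs_partition_bipartite n :
  expR (num_edges R n * ((ln m0 + ln (mgf h)) / 2)) <= gibbs_partition 0 kp mu beta h n.
Proof.
(* Each non-crossing edge is forced to 0 at the price [m0], and each crossing edge keeps its field
   factor. The product is at most the Gibbs weight, with equality on bipartite configurations and
   value 0 elsewhere. *)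
pose f (e : edge n) z : R := if crossing e then expR (h * z) else \1_[set 0] z.
have M0 := mgf_gt0 mu kp0 h; have mass_pos := mass0_gt0.
have lnM : ln m0 <= ln (mgf h) by rewrite ler_ln ?posrE// ltW// mass0_lt_mgf.
have bI : bounded_mfun (fun z : measurableTypeR R => \1_[set 0] (c z) : R).
  by apply: (bounded_mfun_comp (bounded_mfun_indic R m1)); exact: measurable_clamp.
have bf e : bounded_mfun (fun z : measurableTypeR R => f e (c z)).
  by rewrite /f; case: crossing => //; exact: bounded_mfun_expc.
apply: (@le_trans _ _ (expect (fun x => \prod_e f e (weight x e)))); last first.
  apply: le_mean => [||x].
  - apply: bounded_mfun_prod => e.
    under [X in bounded_mfun X]funext do rewrite /weight tnth_mktuple.
    by apply: (bounded_mfun_comp (bf e)); exact: measurable_tnth.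
  - exact/bounded_mfun_expR/(bounded_mfun_exponent kp0).
  - set X := clampt 0 kp x.
    have [/forallP xe|] := boolP [forall e : edge n, crossing e || (weight X e == 0)].
      have x0 e : ~~ crossing e -> weight X e = 0.
        by move=> /negbTE ne; have := xe e; rewrite ne => /eqP.
      rewrite exponentE crossing_triangle_sum// mulr0 add0r mulr_sumr expR_sum.
      apply: le_of_eq; apply: eq_bigr => e _; rewrite /f.
      case: (boolP (crossing _)) => // /x0 ->.
      by rewrite indicE mulr0 expR0 mem_set.
    rewrite negb_forall => /existsP[e]; rewrite negb_or => /andP[ne we].
    rewrite (bigD1 e)//= {1}/f (negbTE ne).
    by rewrite indicE memNset ?mul0r ?expR_ge0//; apply/eqP.
rewrite (expect_prod _ bf).
have fE e : \int[mu]_z f e (c z) =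
    expR (ln m0 + (crossing e)%:R * (ln (mgf h) - ln m0)).
  rewrite /f; case: crossing; rewrite ?mul1r ?mul0r.
    by rewrite addrC subrK lnK.
  by rewrite addr0 lnK// mean_indic0.
rewrite (eq_bigr _ (fun e _ => fE e)) -expR_sum ler_expR.
rewrite big_split/= sum_edges_cst -mulr_suml.
have := @crossing_card R n; have : 0 <= ln (mgf h) - ln m0 by rewrite subr_ge0.
nra.
Qed.

End partition_lower_bound.
End zero_atom.

(** * Triangle density in terms of edge density and field variance *)

Section triangle_lower_bound.
Context (R : realType) (kp : R).
Hypothesis kp0 : 0 < kp.
Local Notation r := (support_radius 0 kp).
Local Notation in_box := (in_box 0 kp).
Context (n : nat).
Hypothesis n1 : (1 < n)%N.
Local Notation N := (num_edges R n).
Variable x : weights R n.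
Hypothesis bx : in_box x.

Let n0 : 0 < n%:R :> R. Proof. by rewrite ltr0n (ltn_trans _ n1). Qed.
Let N0 : 0 < N. Proof. exact: num_edges_gt0. Qed.
Let r0 : 0 < r. Proof. exact: support_radius_gt0. Qed.

Lemma weight_ge0 e : 0 <= weight x e.
Proof. by case/andP: (bx (enum_rank e)). Qed.

Lemma adj_ge0 i j : 0 <= adj x i j.
Proof. by rewrite /adj; case: insub => [e|//]; exact: weight_ge0. Qed.

Lemma local_field_ge0 e : 0 <= local_field x e.
Proof.
have [i [j [_ eE]]] := edgeP e; rewrite (local_fieldE x eE) mulr_ge0 ?divr_ge0//.
by rewrite sumr_ge0// => k _; rewrite mulr_ge0 ?adj_ge0.
Qed.

(* Cauchy-Schwarz for the degrees. *)
Lemma mean_field_ge :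
  ((\sum_e weight x e) / N) ^+ 2 - 4 * r ^+ 2 / n%:R <= mean_field x.
Proof.
set S := \sum_e weight x e.
pose deg k := \sum_i adj x i k.
have degS : \sum_k deg k = 2 * S.
  rewrite /deg exchange_big -(sum_edges (f := adj x)) => [|e i j eE]; last first.
    by rewrite (adj_edge x eE).
  apply: eq_bigr => i _; rewrite [RHS]big_mkcond; apply: eq_bigr => j _.
  by case: eqP => // ->; rewrite adj_diag.
have CS : (2 * S) ^+ 2 / n%:R <= \sum_k deg k ^+ 2.
  pose a := (2 * S) / n%:R.
  have : 0 <= \sum_k (deg k - a) ^+ 2 by rewrite sumr_ge0// => k _; rewrite sqr_ge0.
  have -> : \sum_k (deg k - a) ^+ 2 = \sum_k (deg k ^+ 2 + ((- (2 * a)) * deg k + a ^+ 2)).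
    by apply: eq_bigr => k _; ring.
  rewrite big_split big_split/= -mulr_sumr degS sum_ord_const.
  have -> : - (2 * a) * (2 * S) + n%:R * a ^+ 2 = - ((2 * S) ^+ 2 / n%:R).
    by rewrite /a; field; rewrite gt_eqF.
  by rewrite subr_ge0.
have NmE : N * mean_field x =
    n%:R^-1 * (\sum_k deg k ^+ 2 - \sum_i \sum_k adj x i k ^+ 2).
  rewrite -sum_local_field//; apply: (@mulfI _ 2); first by rewrite pnatr_eq0.
  rewrite -(sum_edges (f := matrix_field x)) => [|e i j eE]; last exact: local_fieldE.
  have -> : \sum_(i < n) \sum_(j < n | j != i) matrix_field x i j =
      \sum_i \sum_j matrix_field x i j - \sum_i matrix_field x i i.
    rewrite -sumrB; apply: eq_bigr => i _.
    by rewrite [in RHS](bigD1 i)//= addrAC subrr add0r.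
  have -> : \sum_i matrix_field x i i = 2 / n%:R * \sum_i \sum_k adj x i k ^+ 2.
    rewrite mulr_sumr; apply: eq_bigr => i _; congr (_ * _).
    by apply: eq_bigr => k _; rewrite (adj_sym x k i) expr2.
  have -> : \sum_i \sum_j matrix_field x i j = 2 / n%:R * \sum_k deg k ^+ 2.
    under eq_bigr do rewrite -mulr_sumr exchange_big/=.
    rewrite -mulr_sumr exchange_big/=; congr (_ * _); apply: eq_bigr => k _.
    under eq_bigr do rewrite -mulr_sumr.
    rewrite -mulr_suml expr2; congr (_ * _); apply: eq_bigr => j _.
    exact: adj_sym.
  by field; rewrite gt_eqF.
have sq : \sum_i \sum_k adj x i k ^+ 2 <= n%:R ^+ 2 * r ^+ 2.
  apply: (@le_trans _ _ (\sum_(i < n) \sum_(k < n) r ^+ 2)).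
    apply: ler_sum => i _; apply: ler_sum => k _.
    rewrite -[leLHS]real_normK ?num_real// lerXn2r ?nnegrE ?(ltW r0)//.
    exact: (norm_adj_le kp0).
  by under eq_bigr do rewrite sum_ord_const; rewrite sum_ord_const; apply: le_of_eq; ring.
have Nn := num_edges_ge R n1.
have m1 : (4 * S ^+ 2 / n%:R - n%:R ^+ 2 * r ^+ 2) / n%:R <= N * mean_field x.
  rewrite NmE mulrC ler_wpM2l ?invr_ge0 ?(ltW n0)//; apply: lerB => //.
  by apply: le_trans CS; rewrite exprMn; apply: le_of_eq; ring.
rewrite -(ler_pM2l N0); apply: le_trans m1.
have h1 : N * (S / N) ^+ 2 <= 4 * S ^+ 2 / n%:R / n%:R.
  have -> : N * (S / N) ^+ 2 = S ^+ 2 / N by field; rewrite gt_eqF.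
  have -> : 4 * S ^+ 2 / n%:R / n%:R = S ^+ 2 / (n%:R ^+ 2 / 4) by field; rewrite gt_eqF.
  by rewrite ler_wpM2l ?sqr_ge0// lef_pV2 ?posrE// divr_gt0// exprn_gt0.
have h2 : n%:R ^+ 2 * r ^+ 2 / n%:R <= N * (4 * r ^+ 2 / n%:R).
  have -> : N * (4 * r ^+ 2 / n%:R) = (N * 4) * (r ^+ 2 / n%:R) by ring.
  rewrite -mulrA ler_wpM2r ?divr_ge0 ?sqr_ge0 ?(ltW n0)//.
  by rewrite ler_pdivrMr in Nn.
rewrite mulrBr mulrBl; exact: lerB.
Qed.

(** The sum splits into the mean field times the total weight and a covariance. The former is at
    least the cube of the density up to [O(1/n)]; the covariance is controlled by the variance
    through [|d| <= tau + d ^ 2 / tau]. *)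
Lemma triangle_density_ge tau : 0 < tau ->
  N * ((\sum_e weight x e) / N) ^+ 3 <=
  \sum_e weight x e * local_field x e
  + N * (r * (tau + field_variance x / tau) + 4 * r ^+ 3 / n%:R).
Proof.
move=> tau0; set S := \sum_e weight x e; set m := mean_field x.
have S0 : 0 <= S by rewrite sumr_ge0// => e _; exact: weight_ge0.
have SN : S <= N * r.
  rewrite -sum_edges_cst; apply: ler_sum => e _.
  by rewrite (le_trans (ler_norm _))// (norm_weight_le e bx).
have dev : - (N * (r * (tau + field_variance x / tau))) <=
    \sum_e weight x e * (local_field x e - m).
  have -> : N * (r * (tau + field_variance x / tau)) =
      \sum_e r * (tau + (local_field x e - m) ^+ 2 / tau).
    rewrite -mulr_sumr big_split/= -mulr_suml sum_edges_cst sum_sqr_local_field//.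
    by ring.
  rewrite -sumrN; apply: ler_sum => e _; set d := local_field x e - m.
  have w0 := weight_ge0 e.
  have wr : weight x e <= r by rewrite (le_trans (ler_norm _))// (norm_weight_le e bx).
  have dd : `|d| <= tau + d ^+ 2 / tau.
    rewrite -(ler_pM2l tau0) mulrDr mulrCA divff ?gt_eqF// mulr1 -[d ^+ 2]real_normK ?num_real//.
    by have := sqr_ge0 (tau - `|d|); have := normr_ge0 d; nra.
  apply: le_trans (_ : - (weight x e * `|d|) <= _); last by rewrite -mulrN ler_wpM2l// lerNl -normrN ler_norm.
  by rewrite lerN2 ler_pM.
have E : \sum_e weight x e * local_field x e =
    \sum_e weight x e * (local_field x e - m) + m * S.
  rewrite mulr_sumr -big_split; apply: eq_bigr => e _ /=; ring.
have mS : S * ((S / N) ^+ 2 - 4 * r ^+ 2 / n%:R) <= m * S.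
  by rewrite [leRHS]mulrC ler_wpM2l// mean_field_ge.
have e3 : N * (S / N) ^+ 3 = S * (S / N) ^+ 2 by field; rewrite gt_eqF.
have err : S * (4 * r ^+ 2 / n%:R) <= N * (4 * r ^+ 3 / n%:R).
  have -> : N * (4 * r ^+ 3 / n%:R) = (N * r) * (4 * r ^+ 2 / n%:R) by ring.
  by rewrite ler_wpM2r// divr_ge0 ?(ltW n0)// mulr_ge0 ?sqr_ge0.
rewrite e3 E; move: mS dev err; rewrite mulrBr mulrDr; lra.
Qed.

End triangle_lower_bound.

(** The number of edges is quadratic in [n], so a gain of order [N] absorbs any factor
    [expR (C * n)]. *)
Lemma near_expR_le (R : realType) (C g eps : R) : 0 < g -> 0 < eps ->
  \forall n \near \oo, expR (C * n%:R - g * num_edges R n) <= eps.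
Proof.
move=> g0 eps0; near=> n.
have n2 : (1 < n)%N by near: n; exact: nbhs_infty_gt.
have nC : (4 * (C + 1)) / g <= n%:R :> R by near: n; exact: nbhs_infty_ger.
have neps : eps^-1 <= n%:R :> R by near: n; exact: nbhs_infty_ger.
have n0 : 0 < n%:R :> R by rewrite ltr0n (ltn_trans _ n2).
have Nn := num_edges_ge R n2.
rewrite ler_pdivrMr// in nC.
apply: (@le_trans _ _ (expR (- n%:R))).
  rewrite ler_expR; have : g * (n%:R ^+ 2 / 4) <= g * num_edges R n by rewrite ler_pM2l.
  nra.
rewrite expRN -[eps]invrK lef_pV2 ?posrE ?invr_gt0 ?expR_gt0//.
by have := expR_ge1Dx (n%:R : R); lra.
Unshelve. all: by end_near. Qed.

(** * Small field variance is unlikely for large negative interaction *)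

Section small_variance.
Context (R : realType) (kp : R) (mu : probability (measurableTypeR R) R).
Hypothesis kp0 : 0 < kp.
Hypothesis mu_itv : mu [set z : R | 0 <= z <= kp] = 1%E.
Hypothesis kp_supp : measure_support mu kp.
Hypothesis atom : (0 < mu [set 0%R])%E.
Local Notation r := (support_radius 0 kp).
Local Notation mgf := (mgf 0 kp mu).
Local Notation m0 := (mass0 mu).
Local Notation expect := (expect 0 kp mu).

(** Two cases on the event. With triangle density at least [rho], the interaction pushes the weight
    below the bipartite bound. Otherwise the edge density is at most [th], and an exponential Markov
    bound with tilt [- l] leaves little more than [m0] per edge. Both cases lose [g / 2] per edge
    against the bipartite bound. *)
Lemma small_variance_unlikely h0 : exists L c g : R, [/\ 0 < L, 0 < c, 0 < g &
  \forall n \near \oo, forall beta, beta <= - L ->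
  gibbs_prob 0 kp mu beta h0 [set x : weights R n | field_variance x <= c] <=
  2 * expR (- (g * num_edges R n))].
Proof.
have r0 : 0 < r := support_radius_gt0 kp0.
have mpos := mass0_gt0 atom; have Mpos := mgf_gt0 mu kp0 h0.
pose l0 := ln m0; pose lh := ln (mgf h0).
(* [z0] is the bipartite rate per edge, and [g] is its excess over [l0], the rate of the empty
   graph. *)
pose g := (lh - l0) / 2; pose z0 := (l0 + lh) / 2.
have g0 : 0 < g.
  by rewrite divr_gt0// subr_gt0 ltr_ln ?posrE// (mass0_lt_mgf kp0 mu_itv kp_supp).
have z0E : z0 = l0 + g by rewrite /z0 /g; field.
(* This tolerance makes [ln (mgf (- l))] at most [l0 + g / 4]; another [g / 4] is spent on [th]
   below, for a total of [l0 + g / 2 = z0 - g / 2]. *)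
have eg : 0 < m0 * (expR (g / 4) - 1).
  by rewrite mulr_gt0// subr_gt0 -expR0 ltr_expR divr_gt0.
have [l lpos Ml] := mgf_cvg_mass0 kp0 mu_itv eg.
have lnMl : ln (mgf (- l)) <= l0 + g / 4.
  have -> : l0 + g / 4 = ln (m0 * expR (g / 4)) by rewrite lnM ?posrE ?expR_gt0// expRK.
  rewrite ler_ln ?posrE ?mulr_gt0 ?expR_gt0 ?mgf_gt0//.
  by apply: le_trans Ml _; apply: le_of_eq; ring.
pose D := `|h0| + l + 1; have D0 : 0 < D by rewrite ltr_wpDl// addr_ge0// ltW.
pose th := g / (4 * D); have th0 : 0 < th by rewrite divr_gt0// mulr_gt0.
have thD : (`|h0| + l) * th <= g / 4.
  have -> : g / 4 = D * th by rewrite /th; field; rewrite gt_eqF.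
  by rewrite ler_pM2r// /D lerDl.
(* The triangle density, the covariance error (at most [2 * r * tau]) and the [1/n] error are each
   allotted [th ^ 3 / 4]; their sum stays below [th ^ 3] and forces an edge density of at most
   [th]. *)
pose rho := th ^+ 3 / 4; have rho0 : 0 < rho by rewrite divr_gt0// exprn_gt0.
pose tau := th ^+ 3 / (8 * r); have tau0 : 0 < tau by rewrite divr_gt0 ?exprn_gt0// mulr_gt0.
(* With at least [rho * N] of triangle weight, this [L] makes the interaction term at most
   [- (|h0| * r + |z0| + g) * N], which offsets the field term and falls below [z0 - g / 2] per
   edge. *)
exists (3 * (`|h0| * r + `|z0| + g) / rho), (tau ^+ 2), (g / 2); split.
- by rewrite divr_gt0// mulr_gt0// ltr_wpDl// addr_ge0// mulr_ge0// ltW.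
- by rewrite exprn_gt0.
- by rewrite divr_gt0.
near=> n => beta betaL.
have n2 : (1 < n)%N by near: n; exact: nbhs_infty_gt.
have nr : 16 * r ^+ 3 / th ^+ 3 <= n%:R :> R by near: n; exact: nbhs_infty_ger.
have n0 : 0 < n%:R :> R by rewrite ltr0n (ltn_trans _ n2).
have N0 := num_edges_gt0 R n2.
set N := num_edges R n in N0 *.
have L0 : 0 < 3 * (`|h0| * r + `|z0| + g) / rho.
  by rewrite divr_gt0// mulr_gt0// ltr_wpDl// addr_ge0// mulr_ge0// ltW.
have beta0 : beta <= 0 by rewrite (le_trans betaL)// oppr_le0 ltW.
have nr4 : 4 * r ^+ 3 / n%:R <= th ^+ 3 / 4.
  have nr' : 16 * r ^+ 3 <= n%:R * th ^+ 3 by rewrite -ler_pdivrMr ?exprn_gt0.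
  by rewrite ler_pdivrMr//; lra.
have pointwise (x : weights R n) : in_box 0 kp x -> field_variance x <= tau ^+ 2 ->
    expR (edge_triangle_exponent beta h0 x) <=
    expR (N * (z0 - g / 2)) + expR (N * (`|h0| + l) * th) * expR (- l * \sum_e weight x e).
  move=> bx Tx; rewrite exponent_edges.
  set W := \sum_e _ * _; set S := \sum_e weight x e.
  have S0 : 0 <= S by rewrite sumr_ge0// => e _; exact: (weight_ge0 bx).
  have SN : S <= N * r.
    rewrite -sum_edges_cst; apply: ler_sum => e _.
    by rewrite (le_trans (ler_norm _))// (norm_weight_le e bx).
  have W0 : 0 <= W.
    by rewrite sumr_ge0// => e _; rewrite mulr_ge0 ?(weight_ge0 bx) ?(local_field_ge0 bx).
  have hS : h0 * S <= `|h0| * S by rewrite ler_wpM2r// ler_norm.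
  have [WN|WN] := leP (rho * N) W.
    apply: ler_wpDr; [by rewrite mulr_ge0 ?expR_ge0|rewrite ler_expR].
    have h1 : beta / 3 * W <= - (`|h0| * r + `|z0| + g) * N.
      have : beta * W <= - (3 * (`|h0| * r + `|z0| + g) / rho) * (rho * N).
        apply: le_trans (ler_wpM2r W0 betaL) _.
        by rewrite !mulNr lerN2 ler_wpM2l// ltW.
      have -> : - (3 * (`|h0| * r + `|z0| + g) / rho) * (rho * N) =
        3 * (- (`|h0| * r + `|z0| + g) * N) by field; rewrite gt_eqF.
      lra.
    have h2 : h0 * S <= `|h0| * r * N.
      by apply: le_trans hS _; rewrite -mulrA ler_wpM2l// mulrC.
    have h3 : - `|z0| * N <= N * z0.
      by rewrite mulrC ler_pM2l// lerNl -normrN ler_norm.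
    have h4 : 0 <= N * g by rewrite mulr_ge0// ltW.
    have h5 : - (`|h0| * r + `|z0| + g) * N = - (`|h0| * r * N) - `|z0| * N - g * N by ring.
    rewrite h5 in h1; rewrite mulrBr; lra.
  have := triangle_density_ge kp0 n2 bx tau0; rewrite -/N -/S -/W => dens.
  have dev : r * (tau + field_variance x / tau) <= th ^+ 3 / 4.
    have -> : th ^+ 3 / 4 = r * (tau + tau) by rewrite /tau; field; rewrite gt_eqF.
    by rewrite ler_pM2l// lerD2l ler_pdivrMr// -expr2.
  have Sth : S <= th * N.
    rewrite -ler_pdivrMr//; have SN0 : 0 <= S / N by rewrite divr_ge0// ltW.
    rewrite -(@ler_pXn2r _ 3)// ?nnegrE// ?(ltW th0)//.
    rewrite -(ler_pM2l N0); apply: le_trans dens _.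
    have : N * (r * (tau + field_variance x / tau) + 4 * r ^+ 3 / n%:R) <=
       N * (th ^+ 3 / 4 + th ^+ 3 / 4) by rewrite ler_pM2l// lerD.
    have : 0 < N * th ^+ 3 by rewrite mulr_gt0 ?exprn_gt0.
    move: WN; rewrite /rho; nra.
  apply: ler_wpDl; [exact: expR_ge0|rewrite -expRD ler_expR].
  have h1 : beta / 3 * W <= 0 by rewrite mulr_le0_ge0// mulr_le0_ge0.
  have h2 : `|h0| * S <= `|h0| * (th * N) by rewrite ler_wpM2l.
  have h3 : l * S <= l * (th * N) by rewrite ler_wpM2l// ltW.
  have -> : N * (`|h0| + l) * th = `|h0| * (th * N) + l * (th * N) by ring.
  lra.
have Z0 := gibbs_partition_gt0 mu kp0 beta h0 n.
rewrite /gibbs_prob -/(gibbs_partition 0 kp mu beta h0 n) ler_pdivrMr//.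
have bH := bounded_mfun_expR (@bounded_mfun_exponent R 0 kp kp0 n beta h0).
have mT := measurable_sublevel (tau ^+ 2) (@measurable_field_variance R n).
have bI := bounded_mfun_indic_clampt 0 kp mT.
have bw (e : edge n) := bounded_mfun_weight kp0 e.
have bS : bounded_mfun (fun x : weights R n => \sum_e weight (clampt 0 kp x) e).
  exact: bounded_mfun_sum.
have bE : bounded_mfun (fun x : weights R n => expR (- l * \sum_e weight (clampt 0 kp x) e)).
  by bmf.
apply: (@le_trans _ _ (expR (N * (z0 - g / 2)) +
    expR (N * (`|h0| + l) * th) * expR (N * ln (mgf (- l))))).
  have -> : expR (N * ln (mgf (- l))) = expect (fun x : weights R n => expR (- l * \sum_e weight x e)).
    rewrite -(cumulantE mu_itv) -sum_edges_cst -(expect_expR_sum kp0 mu_itv).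
    by apply: eq_Rintegral => x _; rewrite mulr_sumr.
  rewrite /expect -meanZl//.
  rewrite -[X in X + _](mean_cst (power_measure mu #|{: edge n}|)) -meanD; [|by bmf..].
  apply: le_mean => [||x]; [bmf|bmf|].
  rewrite indicE; case: (boolP (_ \in _)) => xT.
    rewrite mul1r pointwise//; first exact: in_box_clampt.
    by move: xT; rewrite inE.
  by rewrite mul0r addr_ge0 ?mulr_ge0 ?expR_ge0.
apply: le_trans (_ : _ <= 2 * expR (- (g / 2 * N)) * expR (N * z0)) _; last first.
  rewrite ler_pM2l ?mulr_gt0 ?expR_gt0//.
  exact: (gibbs_partition_bipartite kp0 mu_itv kp_supp atom beta h0).
have -> : 2 * expR (- (g / 2 * N)) * expR (N * z0) =
    expR (N * (z0 - g / 2)) + expR (N * (z0 - g / 2)).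
  have -> : N * (z0 - g / 2) = - (g / 2 * N) + N * z0 by ring.
  by rewrite expRD; ring.
rewrite lerD2l -expRD ler_expR -mulrA -mulrDr ler_pM2l// z0E; lra.
Unshelve. all: by end_near. Qed.

End small_variance.

(** * Elementary bounds for Gibbs probabilities *)

Section gibbs_prob_bounds.
Context (R : realType) (km kp : R) (mu : probability (measurableTypeR R) R).
Hypothesis km_lt_kp : km < kp.
Variables (beta h : R) (n : nat).
Local Notation gp := (gibbs_prob km kp mu beta h (n := n)).
Implicit Types A B : set (weights R n).

Let bH : bounded_mfun (fun x : weights R n =>
  expR (edge_triangle_exponent beta h (clampt km kp x))).
Proof. exact/bounded_mfun_expR/bounded_mfun_exponent. Qed.

Let bI A : measurable A -> bounded_mfun (fun x : weights R n => \1_A (clampt km kp x) *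
  expR (edge_triangle_exponent beta h (clampt km kp x))).
Proof. by move=> mA; apply: bounded_mfunM => //; exact: bounded_mfun_indic_clampt. Qed.

Lemma gibbs_prob_le1 A : measurable A -> gp A <= 1.
Proof.
move=> mA; rewrite ler_pdivrMr ?mul1r; last exact: gibbs_partition_gt0.
apply: le_mean => [||x]; [exact: bI|exact: bH|].
by rewrite ler_piMl ?expR_ge0// indicE; case: (_ \in _).
Qed.

Lemma gibbs_prob_ge0 A : 0 <= gp A.
Proof.
rewrite divr_ge0//; last exact/ltW/gibbs_partition_gt0.
by apply: mean_ge0 => x; rewrite mulr_ge0 ?expR_ge0// indicE; case: (_ \in _).
Qed.

(** Union bound over a list of exceptional events. The covering is only asked inside the box, since
    means are evaluated at clamped weights. *)
Lemma gibbs_prob_cover A (s : seq (set (weights R n))) : measurable A ->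
  (forall B, List.In B s -> measurable B) ->
  (forall x, in_box km kp x -> A x \/ exists2 B, List.In B s & B x) ->
  1 - \sum_(B <- s) gp B <= gp A.
Proof.
move=> mA ms cover.
have Z0 := gibbs_partition_gt0 mu km_lt_kp beta h n.
have sumE : forall t : seq (set (weights R n)), (forall B, List.In B t -> measurable B) ->
   bounded_mfun (fun x : weights R n => (\sum_(B <- t) \1_B (clampt km kp x)) *
    expR (edge_triangle_exponent beta h (clampt km kp x))) /\
  \sum_(B <- t) gp B = expect km kp mu (fun x => (\sum_(B <- t) \1_B x) *
    expR (edge_triangle_exponent beta h x)) / gibbs_partition km kp mu beta h n.
  elim=> [|B t IH] mt.
    split; first by under [X in bounded_mfun X]funext do rewrite big_nil; bmf.
    rewrite big_nil /expect; under eq_Rintegral do rewrite big_nil mul0r.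
    by rewrite mean_cst mul0r.
  have [bt tE] := IH (fun B' H => mt B' (or_intror H)).
  have bB := bI (mt B (or_introl erefl)).
  split.
    under [X in bounded_mfun X]funext do rewrite big_cons mulrDl.
    exact: bounded_mfunD.
  rewrite big_cons tE /gibbs_prob -/(gibbs_partition km kp mu beta h n) -mulrDl; congr (_ / _).
  rewrite /expect -meanD//; apply: eq_Rintegral => x _.
  by rewrite big_cons mulrDl.
have [bs ->] := sumE s ms.
rewrite lerBlDr /gibbs_prob -/(gibbs_partition km kp mu beta h n) -mulrDl ler_pdivlMr// mul1r.
have bA := bI mA.
rewrite /gibbs_partition /expect -meanD//; apply: le_mean => [||x]; [exact: bH|exact: bounded_mfunD|].
rewrite -mulrDl ler_peMl ?expR_ge0//.
have sum0 (t : seq (set (weights R n))) (y : weights R n) : 0 <= \sum_(B <- t) (\1_B y : R).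
  by apply: sumr_ge0 => B _; rewrite indicE; case: (_ \in _).
have [Ax|[B Bs Bx]] := cover _ (in_box_clampt km_lt_kp x).
  by rewrite indicE mem_set// lerDl.
apply: ler_wpDl; first by rewrite indicE; case: (_ \in _).
elim: s Bs {ms cover sumE bs} => [//|B' s IH] /= [->|Bs]; rewrite big_cons.
  by rewrite indicE mem_set// lerDl.
by apply: ler_wpDl; [rewrite indicE; case: (_ \in _)|exact: IH].
Qed.

End gibbs_prob_bounds.

(** * Existence and consistency of the estimator *)

Section part_b.
Context (R : realType) (kp : R) (mu : probability (measurableTypeR R) R).
Hypothesis kp0 : 0 < kp.
Hypothesis mu_itv : mu [set z : R | 0 <= z <= kp] = 1%E.
Hypothesis km_supp : measure_support mu 0.
Hypothesis kp_supp : measure_support mu kp.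
Hypothesis atom : (0 < mu [set 0%R])%E.
Local Notation in_box := (in_box 0 kp).
Local Notation residual := (residual 0 kp mu).

(** A measurable event inside the one on which the estimator exists near the truth. The scores are
    squared, and the first one keeps its coefficient 1, to match the form of the Chebyshev bound. *)
Definition good_event beta h c s n : set (weights R n) := [set x |
  [/\ in_box x, c < field_variance x,
     (\sum_e 1 * residual beta h x e) ^+ 2 <= (s * num_edges R n) ^+ 2 &
     (\sum_e local_field x e * residual beta h x e) ^+ 2 <= (s * num_edges R n) ^+ 2]].

Lemma measurable_score (a : forall n, weights R n -> edge n -> R) beta h n :
  score_weights 0 kp a ->
  measurable_fun setT (fun x : weights R n => (\sum_e a n x e * residual beta h x e) ^+ 2).
Proof.
case=> ma _ _ _; apply: measurable_funX; apply: measurable_sum => e.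
apply: measurable_funM; first exact: ma.
exact: measurable_residual.
Qed.

Let sw1 := @score_weights1 R 0 kp.
Let sw2 := score_weights_local_field kp0.

Lemma measurable_good_event beta h c s n : measurable (@good_event beta h c s n).
Proof.
have -> : @good_event beta h c s n = [set x : weights R n | in_box x] `&`
  [set x | c < field_variance x] `&`
  [set x : weights R n | (\sum_e 1 * residual beta h x e) ^+ 2 <= (s * num_edges R n) ^+ 2] `&`
  [set x | (\sum_e local_field x e * residual beta h x e) ^+ 2 <= (s * num_edges R n) ^+ 2].
  by apply/seteqP; split => x /= => [[]|[[[]]]].
apply: measurableI; [apply: measurableI; [apply: measurableI|]|].
- exact: measurable_box.
- by apply: measurable_superlevel; exact: measurable_field_variance.
- by apply: measurable_sublevel; exact: (measurable_score beta h sw1).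
- by apply: measurable_sublevel; exact: (measurable_score beta h sw2).
Qed.

(** The level [s] is left free: a fixed [s] gives existence with probability tending to one, and [s]
    of order [N ^ (-1/2)] gives the rate of convergence. *)
Lemma good_event_prob beta h c : exists2 C : R, 0 < C & forall n s, 0 < s -> (1 < n)%N ->
  1 - gibbs_prob 0 kp mu beta h [set x : weights R n | field_variance x <= c]
    - C / (s ^+ 2 * num_edges R n) <= gibbs_prob 0 kp mu beta h (@good_event beta h c s n).
Proof.
have [C1 C10 cheb1] := score_chebyshev mu kp0 beta h sw1.
have [C2 C20 cheb2] := score_chebyshev mu kp0 beta h sw2.
exists (C1 + C2) => [|n s s0 n1]; first by rewrite addr_gt0.
have N0 := num_edges_gt0 R n1; set N := num_edges R n in N0 *.
pose K := s * Num.sqrt N.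
have K0 : 0 < K by rewrite mulr_gt0// sqrtr_gt0.
have K2 : K ^+ 2 = s ^+ 2 * N by rewrite exprMn sqr_sqrtr// ltW.
have sN : (s * N) ^+ 2 = K ^+ 2 * N by rewrite K2; ring.
set B0 := [set x | _].
pose B1 := [set x : weights R n | K ^+ 2 * N < (\sum_e 1 * residual beta h x e) ^+ 2].
pose B2 := [set x : weights R n | K ^+ 2 * N < (\sum_e local_field x e * residual beta h x e) ^+ 2].
have H1 := cheb1 n K K0 n1; have H2 := cheb2 n K K0 n1.
rewrite -/N in H1 H2.
have := @gibbs_prob_cover R 0 kp mu kp0 beta h n (@good_event beta h c s n) [:: B0; B1; B2].
rewrite !big_cons big_nil addr0 => cov.
apply: le_trans (cov _ _ _).
- rewrite -K2 mulrDl; move: H1 H2; rewrite -/B1 -/B2; lra.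
- exact: measurable_good_event.
- move=> B /= [<-|[<-|[<-|//]]].
  + by apply: measurable_sublevel; exact: measurable_field_variance.
  + by apply: measurable_superlevel; exact: (measurable_score beta h sw1).
  + by apply: measurable_superlevel; exact: (measurable_score beta h sw2).
- move=> x bx.
  have [T|T] := ltP c (field_variance x); last by right; exists B0 => //=; left.
  have [S1|S1] := ltP (K ^+ 2 * N) ((\sum_e 1 * residual beta h x e) ^+ 2).
    by right; exists B1 => //=; right; left.
  have [S2|S2] := ltP (K ^+ 2 * N) ((\sum_e local_field x e * residual beta h x e) ^+ 2).
    by right; exists B2 => //=; right; right; left.
  by left; split => //; rewrite -/N sN.
Qed.

Lemma mple_good_event beta h c : 0 < c -> exists K s0 : R, [/\ 0 < K, 0 < s0 &
  forall n s, (1 < n)%N -> 0 <= s -> s <= s0 -> forall x : weights R n,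
  @good_event beta h c s n x -> exists beta' h',
    is_mple mu x beta' h' /\ Num.max `|beta' - beta| `|h' - h| <= K * s].
Proof.
move=> c0; have [K [s0 [K0 s00 HK]]] := mple_near kp0 mu_itv km_supp kp_supp beta h c0.
exists K, s0; split=> // n s n1 s_ge0 ss x [bx cT S1 S2].
have sN : 0 <= s * num_edges R n by rewrite mulr_ge0 ?num_edges_ge0.
have sq (y : R) : y ^+ 2 <= (s * num_edges R n) ^+ 2 -> `|y| <= s * num_edges R n.
  by rewrite -[y ^+ 2]real_normK ?num_real// ler_pXn2r// nnegrE.
apply: HK => //; first exact: sq.
by apply: sq; under eq_bigr do rewrite -[_ - _]mul1r.
Qed.

Lemma negative_beta_consistency h0 : exists2 L : R, 0 < L &
    forall beta0 : R, beta0 <= - L ->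
    [/\ exists2 c : R, 0 < c &
          edge_triangle_model mu beta0 h0
            [set x : weights R n | c < field_variance x] @[n --> \oo] --> 1%E,
        with_prob_to_one (edge_triangle_model mu beta0 h0)
          (fun n => [set x | exists beta h : R, is_mple mu x beta h]) &
        mple_sqrtN_consistent (edge_triangle_model mu beta0 h0)
          mu beta0 h0].
Proof.
have [L [c [g [L0 c0 g0 small]]]] := small_variance_unlikely kp0 mu_itv kp_supp atom h0.
exists L => // beta0 betaL.
have small_eps eps : 0 < eps -> \forall n \near \oo,
    gibbs_prob 0 kp mu beta0 h0 [set x : weights R n | field_variance x <= c] <= eps.
  move=> eps0; near=> n.
  apply: le_trans (_ : _ <= 2 * expR (- (g * num_edges R n))) _.
    by near: n; apply: filterS small => n; exact.
  have -> : - (g * num_edges R n) = 0 * n%:R - g * num_edges R n by rewrite mul0r add0r.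
  rewrite mulrC -ler_pdivlMr//; near: n; apply: near_expR_le => //.
  by rewrite divr_gt0.
have [K [s0 [K0 s00 mple]]] := mple_good_event beta0 h0 c0.
have [C C0 good] := good_event_prob beta0 h0 c.
have N_large A : \forall n \near \oo, A <= num_edges R n.
  near=> n; have n2 : (2 <= n)%N by near: n; exact: nbhs_infty_ge.
  have nA : 4 * `|A| <= n%:R :> R by near: n; exact: nbhs_infty_ger.
  apply: le_trans (num_edges_ge R n2); have := ler_norm A.
  have : 2 <= n%:R :> R by rewrite ler_nat.
  nra.
have cvg1 (u : nat -> R) : (forall n, u n <= 1) ->
    (forall eps, 0 < eps -> \forall n \near \oo, 1 - eps <= u n) ->
    (u n)%:E @[n --> \oo] --> 1%E.
  move=> u1 uge; apply: cvg_EFin; first by near=> n.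
  apply/cvgrPdist_le => eps eps0; near=> n => /=.
  rewrite ger0_norm ?subr_ge0 ?u1// lerBlDl -lerBlDr.
  by near: n; exact: uge.
split.
- exists c => //.
  have mT n : measurable [set x : weights R n | c < field_variance x].
    by apply: measurable_superlevel; exact: measurable_field_variance.
  rewrite (_ : (fun n => _) = fun n => (gibbs_prob 0 kp mu beta0 h0
     [set x : weights R n | c < field_variance x])%:E); last first.
    by apply/funext => n; exact: (model_gibbs kp0 mu_itv).
  apply: cvg1 => [n|eps eps0]; first exact: gibbs_prob_le1.
  near=> n; have sm : gibbs_prob 0 kp mu beta0 h0
      [set x : weights R n | field_variance x <= c] <= eps.
    by near: n; exact: small_eps.
  have := @gibbs_prob_cover R 0 kp mu kp0 beta0 h0 n [set x | c < field_variance x]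
     [:: [set x | field_variance x <= c]] (mT n).
  rewrite big_cons big_nil addr0 => cov; apply: le_trans (cov _ _); first lra.
    move=> B /= [<-|//]; apply: measurable_sublevel; exact: measurable_field_variance.
  move=> x _; have [T|T] := ltP c (field_variance x); first by left.
  by right; exists [set x | field_variance x <= c] => //=; left.
(* Fixed level [s0]; for [n <= 1] the empty event is a harmless default. *)
- exists (fun n => if (1 < n)%N then @good_event beta0 h0 c s0 n else set0); split.
  + by move=> n; case: ifP => _; [exact: measurable_good_event|exact: measurable0].
  + move=> n x; case: ifPn => // n1 gx.
    by have [b [h' [hm _]]] := mple n s0 n1 (ltW s00) (lexx _) x gx; exists b, h'.
  + rewrite (_ : (fun n => _) = fun n => (gibbs_prob 0 kp mu beta0 h0
      (if (1 < n)%N then @good_event beta0 h0 c s0 n else set0))%:E); last first.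
      apply/funext => n; apply: (model_gibbs kp0 mu_itv).
      by case: ifP => _; [exact: measurable_good_event|exact: measurable0].
    apply: cvg1 => [n|eps eps0].
      by apply: gibbs_prob_le1 => //; case: ifP => _; [exact: measurable_good_event|exact: measurable0].
    near=> n; have n1 : (1 < n)%N by near: n; exact: nbhs_infty_gt.
    have sm : gibbs_prob 0 kp mu beta0 h0
        [set x : weights R n | field_variance x <= c] <= eps / 2.
      by near: n; apply: small_eps; rewrite divr_gt0.
    rewrite n1; apply: le_trans (good n s0 s00 n1).
    have N0 := num_edges_gt0 R n1.
    have : C / (s0 ^+ 2 * num_edges R n) <= eps / 2.
      have : C / (s0 ^+ 2 * (eps / 2)) <= num_edges R n by near: n; exact: N_large.
      rewrite !ler_pdivrMr ?mulr_gt0 ?exprn_gt0 ?divr_gt0//.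
      by move=> H; apply: le_trans H _; apply: le_of_eq; ring.
    lra.
- move=> eps eps0.
  (* With [s = Q / sqrt N] the Chebyshev term is [C / Q ^ 2 = eps / 2]; the other half of [eps]
     covers small variance. *)
  pose Q := Num.sqrt (2 * C / eps).
  have Q0 : 0 < Q by rewrite sqrtr_gt0 divr_gt0// mulr_gt0.
  have Q2 : Q ^+ 2 = 2 * C / eps by rewrite sqr_sqrtr// divr_ge0 ?ltW// mulr_gt0.
  exists (K * Q); first by rewrite mulr_gt0.
  near=> n; have n1 : (1 < n)%N by near: n; exact: nbhs_infty_gt.
  have N0 := num_edges_gt0 R n1.
  have sq0 : 0 < Num.sqrt (num_edges R n) by rewrite sqrtr_gt0.
  pose s := Q / Num.sqrt (num_edges R n).
  have spos : 0 < s by rewrite divr_gt0.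
  have ss0 : s <= s0.
    rewrite ler_pdivrMr// -ler_pdivrMl// -(@ler_pXn2r _ 2)// ?nnegrE ?(ltW sq0)//; last first.
      by rewrite mulr_ge0 ?invr_ge0 ?ltW.
    by rewrite [leRHS]sqr_sqrtr ?(ltW N0)//; near: n; exact: N_large.
  exists (@good_event beta0 h0 c s n); split; first exact: measurable_good_event.
    rewrite (model_gibbs kp0 mu_itv); last exact: measurable_good_event.
    rewrite lee_fin; apply: le_trans (good n s spos n1).
    have sm : gibbs_prob 0 kp mu beta0 h0
        [set x : weights R n | field_variance x <= c] <= eps / 2.
      by near: n; apply: small_eps; rewrite divr_gt0.
    have -> : s ^+ 2 * num_edges R n = Q ^+ 2.
      by rewrite /s expr_div_n [X in _ / X * _]sqr_sqrtr ?(ltW N0)// -mulrA mulVf ?mulr1 ?gt_eqF.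
    have -> : C / Q ^+ 2 = eps / 2 by rewrite Q2; field; rewrite !gt_eqF.
    lra.
  move=> x gx; have [b [h' [hm hb]]] := mple n s n1 (ltW spos) ss0 x gx.
  by exists b, h'; split => //; rewrite -mulrA.
Unshelve. all: by end_near. Qed.

End part_b.

(** * Positive interaction *)

Section mean_field_lower_bound.
Context (R : realType) (km kp : R) (mu : probability (measurableTypeR R) R).
Hypothesis km_lt_kp : km < kp.
Hypothesis mu_itv : mu [set z : R | km <= z <= kp] = 1%E.
Local Notation r := (support_radius km kp).
Local Notation c := (clamp km kp).
Local Notation phi := (tilted_mean km kp mu).
Local Notation Lam := (cumulant mu).
Local Notation mgf := (mgf km kp mu).
Local Notation clampt := (clampt km kp).
Local Notation expect := (expect km kp mu).

Variable l : R.
Variable n : nat.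
Local Notation N := (num_edges R n).
Local Notation W := (expR (N * Lam l)).
Local Notation tilt := (fun x : weights R n => expR (l * \sum_e weight x e)).

Let M0 : 0 < mgf l. Proof. exact: mgf_gt0. Qed.

Lemma prod_edge_if (a : edge n) (f : edge n -> R) : \prod_e (if e == a then f e else 1) = f a.
Proof. by rewrite -big_mkcond big_pred1_eq. Qed.

Lemma tilt_prod (x : weights R n) : tilt x = \prod_e expR (l * weight x e).
Proof. by rewrite /= mulr_sumr expR_sum. Qed.

Lemma prod_mgf : \prod_(e : edge n) mgf l = W.
Proof.
by rewrite prodr_const card_edge expRM_natl (expR_cumulant km_lt_kp mu_itv).
Qed.

Lemma expect_tilt : expect tilt = W.
Proof.
rewrite -[N * _]sum_edges_cst -(expect_expR_sum km_lt_kp mu_itv).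
by apply: eq_Rintegral => x _; rewrite mulr_sumr.
Qed.

Lemma expect_tilt3 (a b d : edge n) : a != b -> b != d -> d != a ->
  expect (fun x => tilt x * (weight x a * weight x b * weight x d)) = W * phi l ^+ 3.
Proof.
move=> ab bd da.
pose F (e : edge n) z := expR (l * z) * ((if e == a then z else 1) * (if e == b then z else 1)
   * (if e == d then z else 1)).
transitivity (expect (fun x : weights R n => \prod_e F e (weight x e))).
  apply: eq_Rintegral => x _; rewrite tilt_prod /F !big_split/=; congr (_ * _).
  by rewrite !prod_edge_if.
have be := bounded_mfun_expc km_lt_kp l; have bce := bounded_mfun_cexpc km_lt_kp l.
have FE e : (fun z => F e (c z)) =
    if (e == a) || (e == b) || (e == d) then fun z => c z * expR (l * c z)
    else fun z => expR (l * c z).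
  apply/funext => z; rewrite /F; case: (eqVneq e a) => [->|_].
    by rewrite (negbTE ab) eq_sym (negbTE da) !mulr1 mulrC.
  case: (eqVneq e b) => [->|_]; first by rewrite (negbTE bd) mul1r mulr1 mulrC.
  by case: (eqVneq e d) => _; rewrite ?mul1r ?mulr1// mulrC.
rewrite expect_prod => [|e]; last by rewrite FE; case: ifP.
transitivity (\prod_(e : edge n) (mgf l * ((if e == a then phi l else 1) *
   (if e == b then phi l else 1) * (if e == d then phi l else 1)))).
  apply: eq_bigr => e _; rewrite FE; case: (eqVneq e a) => [->|_] /=.
    by rewrite (negbTE ab) eq_sym (negbTE da) !mulr1 mulrC divfK// gt_eqF.
  case: (eqVneq e b) => [->|_] /=.
    by rewrite (negbTE bd) mul1r mulr1 mulrC divfK// gt_eqF.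
  case: (eqVneq e d) => [_|_] /=; last by rewrite !mulr1.
  by rewrite !mul1r mulrC divfK// gt_eqF.
by rewrite !big_split/= !prod_edge_if prod_mgf; congr (_ * _); ring.
Qed.

Lemma expect_tilt1 (a : edge n) : expect (fun x => tilt x * weight x a) = W * phi l.
Proof.
pose F (e : edge n) z := expR (l * z) * (if e == a then z else 1).
transitivity (expect (fun x : weights R n => \prod_e F e (weight x e))).
  by apply: eq_Rintegral => x _; rewrite tilt_prod /F !big_split/= prod_edge_if.
have be := bounded_mfun_expc km_lt_kp l; have bce := bounded_mfun_cexpc km_lt_kp l.
have FE e : (fun z => F e (c z)) =
    if e == a then fun z => c z * expR (l * c z) else fun z => expR (l * c z).
  by apply/funext => z; rewrite /F; case: (e == a); rewrite ?mulr1// mulrC.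
rewrite expect_prod => [|e]; last by rewrite FE; case: ifP.
transitivity (\prod_(e : edge n) (mgf l * (if e == a then phi l else 1))).
  apply: eq_bigr => e _; rewrite FE; case: (e == a); last by rewrite mulr1.
  by rewrite mulrC divfK// gt_eqF.
by rewrite big_split/= prod_edge_if prod_mgf.
Qed.

(** For distinct vertices the three edges are distinct and independent under the tilted product law.
    Otherwise an entry is diagonal and the mean is 0, and the correction term makes the left-hand
    side non-positive. *)
Lemma expect_tilt_adj3 i j k :
  W * (phi l ^+ 3 - r ^+ 3 * ((i == j)%:R + (j == k)%:R + (k == i)%:R)) <=
  expect (fun x => tilt x * (adj x i j * adj x j k * adj x k i)).
Proof.
have W0 : 0 < W by exact: expR_gt0.
have p3 : phi l ^+ 3 <= r ^+ 3.
  rewrite (le_trans (ler_norm _))// normrX lerXn2r ?nnegrE ?(ltW (support_radius_gt0 km_lt_kp))//.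
  exact: norm_tilted_mean.
have r3 : 0 <= r ^+ 3 by rewrite exprn_ge0// ltW// support_radius_gt0.
have degenerate : [|| i == j, j == k | k == i] ->
    W * (phi l ^+ 3 - r ^+ 3 * ((i == j)%:R + (j == k)%:R + (k == i)%:R)) <=
    expect (fun x => tilt x * (adj x i j * adj x j k * adj x k i)).
  move=> deg; have -> : expect (fun x => tilt x * (adj x i j * adj x j k * adj x k i)) = 0.
    rewrite /expect -[RHS](mean_cst (power_measure mu #|{: edge n}|)).
    apply: eq_Rintegral => x _.
    by case/or3P: deg => /eqP ->; rewrite adj_diag ?mul0r ?mulr0 ?mul0r ?mulr0.
  rewrite pmulr_rle0// subr_le0; apply: le_trans p3 _; rewrite ler_peMr//.
  have b01 (b : bool) : 0 <= (b%:R : R) by [].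
  have := b01 (i == j); have := b01 (j == k); have := b01 (k == i).
  by case/or3P: deg => -> /=; rewrite mulr1n; lra.
have [/degenerate//|] := boolP [|| i == j, j == k | k == i].
rewrite !negb_or => /and3P[ij jk ki].
have mk (a b : 'I_n) : a != b -> exists e : edge n, val e = [set a; b]%SET.
  by move=> ab; exists (exist (fun e : {set 'I_n} => #|e| == 2) [set a; b]%SET
     (introT eqP (etrans (cards2 a b) (congr1 S (congr1 nat_of_bool ab))))).
have [e1 e1E] := mk _ _ ij; have [e2 e2E] := mk _ _ jk; have [e3 e3E] := mk _ _ ki.
have neq (e e' : edge n) a b d : val e = [set a; b]%SET -> val e' = [set b; d]%SET ->
    d != a -> a != b -> e != e'.
  move=> eE eE' da ab; apply/eqP => ee; move/eqP: eE'; rewrite -ee eE set2_eq//.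
  by rewrite (negbTE da) andbF orbF (eq_sym b) (negbTE ab).
rewrite (negbTE ij) (negbTE jk) (negbTE ki) !addr0 mulr0 subr0.
rewrite -(@expect_tilt3 e1 e2 e3).
- by apply: le_of_eq; apply: eq_Rintegral => x _; rewrite (adj_edge _ e1E) (adj_edge _ e2E) (adj_edge _ e3E).
- exact: (neq _ _ _ _ _ e1E e2E ki ij).
- exact: (neq _ _ _ _ _ e2E e3E ij jk).
- exact: (neq _ _ _ _ _ e3E e1E jk ki).
Qed.

(** Gibbs variational bound at a product law: Jensen under the weights tilted by [l]. The error
    linear in [n] collects the degenerate triples and the difference between [N] and [n ^ 2 / 2]. *)
Lemma gibbs_partition_mean_field beta h : 0 <= beta -> (0 < n)%N ->
  expR (N * free_energy km kp mu beta h l - 2 * beta * r ^+ 3 * n%:R) <=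
  gibbs_partition km kp mu beta h n.
Proof.
move=> beta0 n0; have n0' : 0 < n%:R :> R by rewrite ltr0n.
have W0 : 0 < W by exact: expR_gt0.
have r0 := support_radius_gt0 km_lt_kp.
have bw (e : edge n) := bounded_mfun_weight km_lt_kp e.
have ba i j := @bounded_mfun_adj R km kp km_lt_kp n i j.
have bS : bounded_mfun (fun x : weights R n => \sum_e weight (clampt x) e).
  exact: bounded_mfun_sum.
have btilt : bounded_mfun (fun x => tilt (clampt x)).
  by apply: bounded_mfun_expR; apply: bounded_mfunM => //; exact: bounded_mfun_cst.
(* The tilt is subtracted from the exponent, so that [tilt * expR f] is the Gibbs weight. *)
pose f x := edge_triangle_exponent beta h x - l * \sum_(e : edge n) weight x e.
have bf : bounded_mfun (fun x => f (clampt x)).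
  apply: bounded_mfunB; first exact: bounded_mfun_exponent.
  by apply: bounded_mfunM => //; exact: bounded_mfun_cst.
have J := jensen_expR (P := power_measure mu #|{: edge n}|) btilt bf.
rewrite -/(expect tilt) expect_tilt in J.
have {}J := J (fun x => expR_ge0 _) W0.
have ZE : expect (fun x => tilt x * expR (f x)) = gibbs_partition km kp mu beta h n.
  apply: eq_Rintegral => x _; rewrite -expRD /f; congr expR; ring.
rewrite -/(expect (fun x => tilt x * expR (f x))) ZE in J; apply: le_trans J.
rewrite -/(expect (fun x => tilt x * f x)).
pose T := \sum_i \sum_j \sum_k expect (fun x : weights R n => tilt x * (adj x i j * adj x j k * adj x k i)).
have Ef : expect (fun x => tilt x * f x) =
    beta / (3 * n%:R) * T + (h - l) * (\sum_(e : edge n) W * phi l).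
  transitivity (\int[power_measure mu #|{: edge n}|]_x
     (beta / (3 * n%:R) * (\sum_i \sum_j \sum_k (tilt (clampt x) * (adj (clampt x) i j *
         adj (clampt x) j k * adj (clampt x) k i)))
      + (h - l) * \sum_e tilt (clampt x) * weight (clampt x) e)).
    apply: eq_Rintegral => x _; rewrite /f exponentE.
    have -> : \sum_i \sum_j \sum_k (tilt (clampt x) * (adj (clampt x) i j *
         adj (clampt x) j k * adj (clampt x) k i)) = tilt (clampt x) * triangle_sum (clampt x).
      rewrite /triangle_sum [RHS]mulr_sumr; apply: eq_bigr => i _.
      by rewrite [RHS]mulr_sumr; apply: eq_bigr => j _; rewrite [RHS]mulr_sumr.
    rewrite -mulr_sumr; ring.
  have b3 i j k : bounded_mfun (fun x => tilt (clampt x) * (adj (clampt x) i j *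
         adj (clampt x) j k * adj (clampt x) k i)).
    by apply: bounded_mfunM => //; do 2 apply: bounded_mfunM => //.
  have bt e := bounded_mfunM btilt (bw e).
  have bs3 : bounded_mfun (fun x => \sum_i \sum_j \sum_k (tilt (clampt x) * (adj (clampt x) i j *
         adj (clampt x) j k * adj (clampt x) k i))).
    by do 3 (apply: bounded_mfun_sum => ?).
  have bs1 : bounded_mfun (fun x => \sum_e tilt (clampt x) * weight (clampt x) e).
    exact: bounded_mfun_sum.
  rewrite meanD; [|by bmf..]; rewrite !meanZl//; congr (_ * _ + _ * _).
    rewrite mean_sum => [|i]; last by do 2 (apply: bounded_mfun_sum => ?).
    apply: eq_bigr => i _; rewrite mean_sum => [|j]; last by apply: bounded_mfun_sum.
    by apply: eq_bigr => j _; rewrite mean_sum.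
  by rewrite mean_sum//; apply: eq_bigr => e _; exact: expect_tilt1.
have Tge : W * (n%:R ^+ 3 * phi l ^+ 3 - 3 * n%:R ^+ 2 * r ^+ 3) <= T.
  apply: (@le_trans _ _ (\sum_i \sum_j \sum_k
     W * (phi l ^+ 3 - r ^+ 3 * ((i == j)%:R + (j == k)%:R + (k == i)%:R)))); last first.
    by do 3 (apply: ler_sum => ? _); exact: expect_tilt_adj3.
  have d1 (i : 'I_n) : \sum_(k < n) (k == i)%:R = 1 :> R.
    by have := sum_delta (fun _ : 'I_n => 1 : R) i; under eq_bigr do rewrite mulr1.
  have d2 (i : 'I_n) : \sum_(k < n) (i == k)%:R = 1 :> R.
    by under eq_bigr do rewrite eq_sym.
  apply: le_of_eq.
  transitivity (\sum_(i < n) \sum_(j < n) W * (n%:R * phi l ^+ 3 - r ^+ 3 * (n%:R * (i == j)%:R + 2))); last first.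
    apply: eq_bigr => i _; apply: eq_bigr => j _; rewrite -mulr_sumr; congr (_ * _).
    by rewrite sumrB sum_ord_const -mulr_sumr !big_split/= sum_ord_const d1 d2; ring.
  transitivity (\sum_(i < n) W * (n%:R ^+ 2 * phi l ^+ 3 - r ^+ 3 * (3 * n%:R))); last first.
    apply: eq_bigr => i _; rewrite -mulr_sumr; congr (_ * _).
    by rewrite sumrB sum_ord_const -mulr_sumr big_split/= -mulr_sumr d2 sum_ord_const; ring.
  by rewrite sum_ord_const; ring.
rewrite Ef sum_edges_cst.
rewrite -expRD ler_expR.
have p3 : - r ^+ 3 <= phi l ^+ 3.
  rewrite lerNl (le_trans (ler_norm _))// normrN normrX lerXn2r ?nnegrE ?(ltW r0)//.
  exact: norm_tilted_mean.
have r3 : 0 <= r ^+ 3 by rewrite exprn_ge0// ltW.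
have -> : (beta / (3 * n%:R) * T + (h - l) * (N * (W * phi l))) / W =
    beta / (3 * n%:R) * (T / W) + (h - l) * (N * phi l) by field; rewrite !gt_eqF.
have TW : n%:R ^+ 3 * phi l ^+ 3 - 3 * n%:R ^+ 2 * r ^+ 3 <= T / W.
  by rewrite ler_pdivlMr// mulrC.
have b3 : 0 <= beta / (3 * n%:R) by rewrite divr_ge0// mulr_ge0// ltW.
have := ler_wpM2l b3 TW.
have -> : beta / (3 * n%:R) * (n%:R ^+ 3 * phi l ^+ 3 - 3 * n%:R ^+ 2 * r ^+ 3) =
    beta * n%:R ^+ 2 * phi l ^+ 3 / 3 - beta * n%:R * r ^+ 3 by field; rewrite gt_eqF.
have -> : N * free_energy km kp mu beta h l = beta * n%:R ^+ 2 * phi l ^+ 3 / 3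
   - beta * n%:R * phi l ^+ 3 / 3 + N * Lam l + (h - l) * (N * phi l).
  by rewrite /free_energy /cubic num_edgesE; field.
have bn : 0 <= beta * n%:R by rewrite mulr_ge0// ltW.
have := ler_wpM2l bn p3; have := mulr_ge0 bn r3.
have -> : 2 * beta * r ^+ 3 * n%:R = 2 * (beta * n%:R * r ^+ 3) by ring.
rewrite mulrN; lra.
Qed.

End mean_field_lower_bound.

(** * Energy against entropy over the cut-norm net *)

Section part_a.
Context (R : realType) (km kp : R) (mu : probability (measurableTypeR R) R).
Hypothesis km_lt_kp : km < kp.
Hypothesis mu_itv : mu [set z : R | km <= z <= kp] = 1%E.
Hypothesis nonneg : stochastically_nonneg mu.
Variables (beta h : R).
Hypotheses (beta0 : 0 < beta) (h_ge0 : 0 <= h) (hkm : 0 < h \/ 0 <= km).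
Local Notation r := (support_radius km kp).
Local Notation clampt := (clampt km kp).
Local Notation in_box := (in_box km kp).
Local Notation expect := (expect km kp mu).
Local Notation exponent := (@edge_triangle_exponent R _ beta h).
Local Notation cut_step n := (option ({ffun 'I_n -> bool} * {ffun 'I_n -> bool})).

(** One step has [4 ^ n + 1] choices, at most [2 ^ (2n + 1)] and hence at most [expR (3 * n)]. *)
Lemma card_cut_step n k : (0 < n)%N ->
  (#|{: k.-tuple (cut_step n)}|)%:R <= expR ((3 * k)%:R * n%:R) :> R.
Proof.
move=> n0; rewrite card_tuple card_option card_prod card_ffun card_bool card_ord.
have e2 : 2 <= expR 1 :> R by have := expR_ge1Dx (1 : R); lra.
have le1 : ((2 ^ n * 2 ^ n).+1)%:R <= expR (3 * n%:R) :> R.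
  apply: (@le_trans _ _ (2 ^+ (2 * n).+1)).
    rewrite -natrX ler_nat.
    have m0 : (0 < 2 ^ n * 2 ^ n)%N by rewrite muln_gt0 !expn_gt0.
    have -> : (2 ^ (2 * n).+1 = 2 * (2 ^ n * 2 ^ n))%N by rewrite expnS -expnD addnn -mul2n.
    by rewrite mul2n -addnn -addn1 leq_add2l.
  apply: (@le_trans _ _ (expR 1 ^+ (2 * n).+1)); first by rewrite lerXn2r ?nnegrE ?expR_ge0 ?ler0n.
  rewrite -expRM_natl mulr1 ler_expR -natrM ler_nat.
  by rewrite (mulSn 2 n) -add1n leq_add2r.
rewrite natrX; apply: le_trans (_ : _ <= expR (3 * n%:R) ^+ k) _.
  by rewrite lerXn2r ?nnegrE ?expR_ge0 ?ler0n.
by rewrite -expRM_natl natrM; apply: le_of_eq; congr expR; ring.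
Qed.

(* On a cell of the cut-norm net the exponent is nearly constant, the mass is controlled by
   the entropy of the barycenter, and the defect of the barycenter is of order [n ^ 2]. *)
Lemma cell_bound eta delta F xi n (W : 'I_n -> 'I_n -> R) (B : R) :
  (1 < n)%N -> 0 <= B -> 0 < xi ->
  (forall l, free_energy km kp mu beta h l <= F) ->
  (forall x : weights R n, in_box x -> eta <= field_variance x ->
     delta * n%:R ^+ 2 <= energy_defect beta h x) ->
  32 * r ^+ 3 * (2 * B) / num_edges R n <= eta ->
  expect (fun x => \1_(cell W B) x * (\1_[set x | 2 * eta < field_variance x] x * expR (exponent x)))
  <= expR (num_edges R n * (F + xi) - delta * n%:R ^+ 2 + (`|beta| * r ^+ 2 + `|h|) * (2 * B)).
Proof.
move=> n1 B0 xi0 FP stab Beta.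
have n0 : (0 < n)%N := ltn_trans (ltn0Sn 0) n1.
set K := cell W B; set A := [set x | _]; set E := (`|beta| * _ + _) * _.
have mK : measurable K by exact: measurable_cell.
have mA : measurable A by apply: measurable_superlevel; exact: measurable_field_variance.
have bK := bounded_mfun_indic_clampt km kp mK.
have bA := bounded_mfun_indic_clampt km kp mA.
have bH := bounded_mfun_expR (@bounded_mfun_exponent R km kp km_lt_kp n beta h).
have bAH := bounded_mfunM bA bH.
have K0 x : 0 <= \1_K x :> R by rewrite indicE; case: (_ \in _).
have massE : mass km kp mu K = \int[power_measure mu #|{: edge n}|]_x \1_K (clampt x) by [].
have m0 : 0 <= mass km kp mu K by rewrite massE; apply: mean_ge0 => x; exact: K0.
have bound M : (forall x, in_box x -> K x -> A x -> expR (exponent x) <= M) -> 0 <= M ->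
    expect (fun x => \1_K x * (\1_A x * expR (exponent x))) <= mass km kp mu K * M.
  move=> HM M0; rewrite massE -meanZr//; apply: le_mean => [||x]; [bmf|bmf|].
  set X := clampt x; rewrite [\1_K X]indicE; case: (boolP (X \in K)) => [XK|_]; last by rewrite !mul0r.
  rewrite !mul1r indicE; case: (boolP (X \in A)) => [XA|_]; last by rewrite mul0r.
  rewrite mul1r; apply: HM; [exact: in_box_clampt|by rewrite inE in XK|by rewrite inE in XA].
(* A cell of zero mass has no meaningful barycenter; there the Gibbs weight is bounded crudely by a
   constant times the mass. *)
have [m_gt0|] := ltP 0 (mass km kp mu K); last first.
  move=> m_le0; have {m_le0} mE : mass km kp mu K = 0 by apply/eqP; rewrite eq_le m_le0.
  have [_ [C HC]] := bH.
  apply: le_trans (_ : _ <= mass km kp mu K * C) _; last by rewrite mE mul0r expR_ge0.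
  apply: bound => [x bx _ _|]; last by apply: le_trans (HC [tuple 0 | _ < _]); exact: normr_ge0.
  by have := HC x; rewrite (clampt_id bx); apply: le_trans; exact: ler_norm.
(* One point of the cell with variance above [2 * eta] suffices: variances within a cell differ by
   at most [eta], so the barycenter has variance at least [eta]. *)
have [[x0 [bx0 Kx0 Ax0]]|none] := pselect (exists x, [/\ in_box x, K x & A x]); last first.
  apply: le_trans (bound 0 _ (lexx _)) _; last by rewrite mulr0 expR_ge0.
  by move=> x bx Kx Ax; case: none; exists x.
pose q := barycenter km kp mu K.
have bq : in_box q := barycenter_in_box km_lt_kp mK m_gt0.
have Kq : K q := barycenter_cell km_lt_kp mK m_gt0 (fun x => id).
have Tq : eta <= field_variance q.
  have := cut_field_variance km_lt_kp bx0 bq (cell_diff Kx0 Kq) n1.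
  have := ler_norm (field_variance x0 - field_variance q).
  by move: Ax0; rewrite /A /=; lra.
have Dq := stab q bq Tq.
have Hq := exponent_le_cubic h beta0 q n0.
(* The scalar bound yields a tilt for the absolute value of the barycenter weight, and reflection
   turns it into one for the signed weight at the price [xi]. *)
have ex_tilt (e : edge n) : exists l, cubic beta h `|weight q e| - F - xi <=
    l * weight q e - cumulant mu l.
  have pr : `| `|weight q e| | <= r by rewrite normr_id (norm_weight_le e bq).
  have [l1 Hl1] := scalar_bound mu km_lt_kp (ltW beta0) h_ge0 pr.
  have [l Hl] := reflect_rate (weight q e) l1 nonneg xi0.
  exists l; apply: le_trans Hl; rewrite lerD2r lerBlDr -lerBlDl.
  exact: le_trans Hl1 (FP l1).
have [l Hl] := choice ex_tilt.
have ent := mass_entropy km_lt_kp mu_itv mK m_gt0 l.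
rewrite -/q in ent.
have suml : \sum_e cubic beta h `|weight q e| - num_edges R n * (F + xi) <=
    \sum_e (l e * weight q e - cumulant mu (l e)).
  rewrite -sum_edges_cst -sumrB; apply: ler_sum => e _; have := Hl e; lra.
apply: le_trans (bound (expR (exponent q + E)) _ (expR_ge0 _)) _.
  move=> x bx Kx _; rewrite ler_expR -lerBlDl.
  apply: le_trans (ler_norm _) _.
  exact: (cut_exponent km_lt_kp bx bq (cell_diff Kx Kq)).
have mle : mass km kp mu K <= expR (- (\sum_e (l e * weight q e - cumulant mu (l e)))).
  by rewrite expRN -[leRHS]mul1r ler_pdivlMr ?expR_gt0.
apply: le_trans (ler_wpM2r (expR_ge0 _) mle) _.
rewrite -expRD ler_expR; lra.
Qed.

Lemma field_variance_unlikely eta : 0 < eta -> exists C g : R, 0 < g /\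
  \forall n \near \oo, gibbs_prob km kp mu beta h
    [set x : weights R n | 2 * eta < field_variance x] <= expR (C * n%:R - g * num_edges R n).
Proof.
move=> eta0.
have r0 := support_radius_gt0 km_lt_kp.
have r3 : 0 < r ^+ 3 by rewrite exprn_gt0.
have [delta delta0 stab] := defect_stability km_lt_kp beta0 h_ge0 hkm eta0.
have [F [FP Fsup]] := free_energy_sup km_lt_kp mu_itv (ltW beta0) h_ge0.
(* Of the gain [delta * n ^ 2], a quarter pays for the two losses of [xi] per edge, in the cells and
   in the partition function, and a quarter for the cut-norm error. The remaining half is at least
   [delta * N]. *)
pose xi := delta / 4; have xi0 : 0 < xi by rewrite divr_gt0.
have [l0 Hl0] := Fsup xi xi0.
pose C1 := `|beta| * r ^+ 2 + `|h|.
have C10 : 0 <= C1 by rewrite addr_ge0// mulr_ge0// sqr_ge0.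
(* The first bound keeps the variation of the variance within a cell below [eta], the second the
   variation of the exponent below [delta / 4 * n ^ 2]. *)
pose eps := Num.min (eta / (256 * r ^+ 3)) (delta / (8 * (C1 + 1))).
have C11 : 0 < 8 * (C1 + 1) by rewrite mulr_gt0// ltr_wpDl.
have eps0 : 0 < eps.
  by rewrite lt_min; apply/andP; split; apply: divr_gt0 => //; exact: mulr_gt0.
have eps1 : eps * (256 * r ^+ 3) <= eta by rewrite -ler_pdivlMr ?ge_min ?lexx// mulr_gt0.
have eps2 : eps * (8 * (C1 + 1)) <= delta by rewrite -ler_pdivlMr// ge_min lexx orbT.
(* The squared norm of the matrix is at most [r ^ 2 * n ^ 2], so this many energy decrements of
   [eps ^ 2 * n ^ 2] suffice, independently of [n]. *)
pose k := Num.Def.archi_bound (r ^+ 2 / eps ^+ 2).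
have kP : r ^+ 2 <= k%:R * eps ^+ 2.
  rewrite -ler_pdivrMr ?exprn_gt0//; apply: ltW; apply: Num.Theory.archi_boundP.
  by rewrite divr_ge0// exprn_ge0// ltW.
(* The linear term collects the logarithm of the size of the net and the error of the mean-field
   lower bound. *)
exists ((3 * k)%:R + 2 * beta * r ^+ 3), delta; split=> //.
near=> n.
have n1 : (1 < n)%N by near: n; exact: nbhs_infty_gt.
have n0 : (0 < n)%N := ltn_trans (ltn0Sn 0) n1.
have n0' : 0 < n%:R :> R by rewrite ltr0n.
have N0 := num_edges_gt0 R n1; have Nn := num_edges_ge R n1; have nN := num_edges_le R n.
set N := num_edges R n in N0 Nn nN *.
set A := [set x : weights R n | _]; pose B := eps * n%:R ^+ 2.
have B0 : 0 <= B by rewrite mulr_ge0 ?sqr_ge0 ?ltW.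
have mA : measurable A by apply: measurable_superlevel; exact: measurable_field_variance.
have bA := bounded_mfun_indic_clampt km kp mA.
have bH := bounded_mfun_expR (@bounded_mfun_exponent R km kp km_lt_kp n beta h).
have bAH := bounded_mfunM bA bH.
pose K (l : k.-tuple (cut_step n)) := cell (step_matrix eps l) B.
have bK (l : k.-tuple (cut_step n)) :=
  bounded_mfun_indic_clampt km kp (measurable_cell (step_matrix eps l) B).
pose M := expR (N * (F + xi) - delta * n%:R ^+ 2 + C1 * (2 * B)).
have cells : expect (fun x => \1_A x * expR (exponent x)) <=
    \sum_(l : k.-tuple (cut_step n)) expect (fun x => \1_(K l) x * (\1_A x * expR (exponent x))).
  rewrite /expect -(mean_sum _ _ _ (fun l => bounded_mfunM (bK l) bAH)).
  apply: le_mean => [||x]; [exact: bAH|apply: bounded_mfun_sum => l; exact: (bounded_mfunM (bK l) bAH)|].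
  set X := clampt x; have bX : in_box X := in_box_clampt km_lt_kp x.
  have AH0 : 0 <= \1_A X * expR (exponent X).
    by rewrite mulr_ge0 ?expR_ge0// indicE; case: (_ \in _).
  have [|l Kl] := @weak_regularity R n eps k (adj X) eps0.
    apply: (@le_trans _ _ (\sum_(i < n) \sum_(j < n) r ^+ 2)).
      apply: ler_sum => i _; apply: ler_sum => j _.
      rewrite -[leLHS]real_normK ?num_real// ler_pXn2r ?nnegrE ?(ltW r0)//.
      exact: (norm_adj_le km_lt_kp).
    under eq_bigr do rewrite sum_ord_const; rewrite sum_ord_const mulrA -expr2.
    by rewrite [leRHS]mulrA [leRHS]mulrC ler_wpM2l ?sqr_ge0.
  rewrite (bigD1 l)//= [\1_(K l) X]indicE mem_set; last exact: Kl.
  rewrite mul1r lerDl; apply: sumr_ge0 => l' _.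
  by rewrite mulr_ge0// indicE; case: (_ \in _).
have cell_le l : expect (fun x => \1_(K l) x * (\1_A x * expR (exponent x))) <= M.
  apply: cell_bound => //.
  - by move=> x; exact: stab.
  - rewrite ler_pdivrMr//; apply: le_trans (_ : _ <= eta * (n%:R ^+ 2 / 4)) _.
      have -> : 32 * r ^+ 3 * (2 * B) = (eps * (256 * r ^+ 3)) * (n%:R ^+ 2 / 4).
        by rewrite /B; field.
      by rewrite ler_wpM2r// divr_ge0// sqr_ge0.
    by rewrite ler_pM2l.
have Zle := gibbs_partition_mean_field km_lt_kp mu_itv l0 h (ltW beta0) n0.
rewrite /gibbs_prob -/(gibbs_partition km kp mu beta h n) ler_pdivrMr ?gibbs_partition_gt0//.
apply: le_trans cells _.
apply: le_trans (_ : _ <= \sum_(l : k.-tuple (cut_step n)) M) _.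
  by apply: ler_sum => l _; exact: cell_le.
rewrite sumr_const -[M *+ _]mulr_natl.
apply: le_trans (ler_wpM2r (expR_ge0 _) (card_cut_step k n0)) _.
apply: le_trans _ (ler_wpM2l (expR_ge0 _) Zle).
rewrite -!expRD ler_expR -/N.
have Ff : N * (F - xi) <= N * free_energy km kp mu beta h l0 by rewrite ler_pM2l.
have NN : delta * N <= delta * (n%:R ^+ 2 / 2) by rewrite ler_pM2l.
have CB : C1 * (2 * B) <= delta / 4 * n%:R ^+ 2.
  rewrite /B; have -> : C1 * (2 * (eps * n%:R ^+ 2)) = (C1 * 2 * eps) * n%:R ^+ 2 by ring.
  rewrite ler_wpM2r ?sqr_ge0//; move: eps2 C10 eps0; nra.
have -> : N * (F + xi) = N * (F - xi) + delta * N / 2 by rewrite /xi; field.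
rewrite -/C1 [X in _ <= X - _ + _]mulrDl; lra.
Unshelve. all: by end_near. Qed.

Lemma field_variance_op1 : little_op1 (edge_triangle_model mu beta h) (@field_variance R).
Proof.
move=> eps eps0; have eta0 : 0 < eps / 2 by rewrite divr_gt0.
have [C [g [g0 unlikely]]] := field_variance_unlikely eta0.
have e2 : 2 * (eps / 2) = eps by field.
rewrite e2 in unlikely.
have TE n : [set x : weights R n | eps < `|field_variance x|] =
    [set x | eps < field_variance x].
  by apply/seteqP; split => x /=; rewrite ger0_norm// field_variance_ge0.
have mT n : measurable [set x : weights R n | eps < field_variance x].
  by apply: measurable_superlevel; exact: measurable_field_variance.
rewrite (_ : (fun n => _) = fun n => (gibbs_prob km kp mu beta h
    [set x : weights R n | eps < field_variance x])%:E); last first.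
  by apply/funext => n; rewrite TE; exact: (model_gibbs km_lt_kp mu_itv).
apply: cvg_EFin; first by near=> n.
apply/cvgrPdist_le => d d0; near=> n => /=.
rewrite sub0r normrN ger0_norm ?gibbs_prob_ge0//.
apply: le_trans (_ : _ <= expR (C * n%:R - g * num_edges R n)) _; near: n => //.
exact: near_expR_le.
Unshelve. all: by end_near. Qed.

End part_a.

Theorem theorem2p1 (R : realType) (km kp : R)
    (mu : probability (measurableTypeR R) R)
    (km_lt_kp : km < kp)
    (mu_itv : mu [set z : R | km <= z <= kp] = 1%E)
    (km_supp : measure_support mu km) (kp_supp : measure_support mu kp) :
  (stochastically_nonneg mu ->
    forall beta0 h0 : R, 0 < beta0 -> 0 <= h0 -> (0 < h0 \/ 0 <= km) ->
    little_op1 (edge_triangle_model mu beta0 h0) (@field_variance R))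
  /\
  (km = 0 -> (0 < mu [set 0%R])%E ->
    forall h0 : R, exists2 L : R, 0 < L &
    forall beta0 : R, beta0 <= - L ->
    [/\ exists2 c : R, 0 < c &
          edge_triangle_model mu beta0 h0
            [set x : weights R n | c < field_variance x] @[n --> \oo] --> 1%E,
        with_prob_to_one (edge_triangle_model mu beta0 h0)
          (fun n => [set x | exists beta h : R, is_mple mu x beta h]) &
        mple_sqrtN_consistent (edge_triangle_model mu beta0 h0)
          mu beta0 h0]).
Proof.
split=> [nonneg beta0 h0 beta_gt0 h_ge0 hkm|km0 atom h0].
  exact (field_variance_op1 km_lt_kp mu_itv nonneg beta_gt0 h_ge0 hkm).
move: km_lt_kp mu_itv km_supp; rewrite km0 => kp_gt0 mu_itv0 supp0.
exact (negative_beta_consistency kp_gt0 mu_itv0 supp0 kp_supp atom h0).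
Qed.
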